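(* Let $p>3$ be prime, let $m$ be an integer, and let $\vec n=(n_0,n_1,\dots,n_{\frac12(p-1)})\in\mathbb Z^{\frac12(p+1)}$. Suppose (1) $n_0+\sum_{k=1}^{\frac12(p-1)}n_k=2$; (2) $\sum_{k=1}^{\frac12(p-1)}k^2n_k\equiv 2m\pmod p$; (3) $n_0+3\sum_{k=1}^{\frac12(p-1)}n_k\equiv0\pmod{24}$. Then $j(p,\vec n,z)$ is a weakly holomorphic modular form of weight $1$ on $\Gamma(p)$, and it satisfies $$j(p,\vec n,z)\big|_1A=\exp\Big(\frac{2\pi i bm}{p}\Big)\,j(p,\vec n,z)\quad\text{for all }A=\begin{pmatrix}a&b\\c&d\end{pmatrix}\in\Gamma_1(p).$$
   Context: $q=e^{2\pi i z}$, $\operatorname{Im}z>0$, $(x;q)_\infty=\prod_{k\ge0}(1-xq^k)$. $\eta(z)=q^{1/24}\prod_{n\ge1}(1-q^n)$. For $N\ge1$, $N\nmid\rho$: $f_{N,\rho}(z):=q^{(N-2\rho)^2/(8N)}(q^\rho,q^{N-\rho},q^N;q^N)_\infty$ (product of the three infinite products). For $\vec n=(n_0,\dots,n_{\frac12(p-1)})$, $j(p,\vec n,z):=\eta(pz)^{n_0}\prod_{k=1}^{\frac12(p-1)}f_{p,k}(z)^{n_k}$. The weight $k$ stroke operator is $(F|_kA)(z)=(ad-bc)^{k/2}(cz+d)^{-k}F(Az)$ for $A=\begin{pmatrix}a&b\\c&d\end{pmatrix}\in GL_2^+(\mathbb Z)$, principal branch. $\Gamma_1(p)$ consists of matrices in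 $SL_2(\mathbb Z)$ congruent to $\begin{pmatrix}1&*\\0&1\end{pmatrix}$ mod $p$. *)

(* Defs.v *)
From Stdlib Require Import Reals ZArith Znumtheory List.
From Coquelicot Require Import Coquelicot.

Open Scope C_scope.

Definition Cexp (w : C) : C :=
  (exp (Re w) * cos (Im w), exp (Re w) * sin (Im w))%R.

Definition Cpowz (w : C) (k : Z) : C :=
  match k with
  | Z0 => 1
  | Zpos n => w ^ Pos.to_nat n
  | Zneg n => / w ^ Pos.to_nat n
  end.

Definition Cprod (l : list C) : C := fold_right Cmult (RtoC 1) l.

Definition Zsum (l : list Z) : Z := fold_right Z.add 0%Z l.

(* [Lim_seq] is total, so this is the limit of [u] only when [u] converges. *)
Definition Clim_seq (u : nat -> C) : C :=
  (real (Lim_seq (fun n => Re (u n))), real (Lim_seq (fun n => Im (u n)))).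

(* u 0 * u 1 * u 2 * ... *)
Definition Cprod_inf (u : nat -> C) : C :=
  Clim_seq (fun n => Cprod (map u (seq 0 n))).

Definition upper_half_plane (z : C) : Prop := (0 < Im z)%R.

(* q^r, q = exp (2 pi i z): real powers of q are exp (2 pi i r z), so that
   no branch of the logarithm of q is involved. *)
Definition qpow (r : R) (z : C) : C := Cexp (2 * PI * Ci * r * z).

(* (x; q)_oo *)
Definition qpoch_inf (x q : C) : C := Cprod_inf (fun k => 1 - x * q ^ k).

Definition eta (z : C) : C :=
  qpow (1 / 24) z * Cprod_inf (fun n => 1 - qpow 1 z ^ S n).

Definition f (N rho : Z) (z : C) : C :=
  qpow ((IZR N - 2 * IZR rho) ^ 2 / (8 * IZR N)) z
  * (qpoch_inf (qpow (IZR rho) z) (qpow (IZR N) z)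
     * qpoch_inf (qpow (IZR (N - rho)) z) (qpow (IZR N) z)
     * qpoch_inf (qpow (IZR N) z) (qpow (IZR N) z)).

(* The exponent vector is represented by a function on nat, of which only the
   entries 0, ..., (p - 1) / 2 are used. *)
Definition j (p : nat) (n : nat -> Z) (z : C) : C :=
  Cpowz (eta (INR p * z)) (n 0%nat)
  * Cprod (map (fun k => Cpowz (f (Z.of_nat p) (Z.of_nat k) z) (n k))
             (seq 1 ((p - 1) / 2))).

(* The matrix with rows (ma, mb) and (mc, md). *)
Record mat2 := Mat2 { ma : Z; mb : Z; mc : Z; md : Z }.

Definition det2 (A : mat2) : Z := (ma A * md A - mb A * mc A)%Z.

Definition moebius (A : mat2) (z : C) : C :=
  (IZR (ma A) * z + IZR (mb A)) / (IZR (mc A) * z + IZR (md A)).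

(* (F |_k A) (z) for k an integer and det A > 0; for integral k the power of
   c z + d does not depend on a branch. *)
Definition slash (k : Z) (F : C -> C) (A : mat2) (z : C) : C :=
  RtoC (Rpower (IZR (det2 A)) (IZR k / 2))
  * Cpowz (IZR (mc A) * z + IZR (md A)) (- k) * F (moebius A z).

Definition SL2Z (A : mat2) : Prop := det2 A = 1%Z.

Definition Gamma1 (N : Z) (A : mat2) : Prop :=
  SL2Z A /\ (N | ma A - 1)%Z /\ (N | mc A)%Z /\ (N | md A - 1)%Z.

Definition Gamma (N : Z) (A : mat2) : Prop :=
  Gamma1 N A /\ (N | mb A)%Z.

Definition holomorphic_H (F : C -> C) : Prop :=
  forall z : C, upper_half_plane z ->
    @ex_derive C_AbsRing C_NormedModule F z.

(* F is given on the upper half plane by a Laurent expansion in q^(1/N) with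
   finitely many terms of negative exponent. *)
Definition meromorphic_at_infinity (N : Z) (F : C -> C) : Prop :=
  exists (v : Z) (a : nat -> C), forall z : C, upper_half_plane z ->
    @is_series C_AbsRing C_NormedModule
      (fun i => a i * qpow (IZR (v + Z.of_nat i) / IZR N) z) (F z).

(* Every cusp is the image of infinity under some A in SL2(Z).  Since Gamma(N)
   is normal in SL2(Z) and contains z |-> z + N, the expansion of F |_k A is in
   powers of q^(1/N). *)
Definition weakly_holomorphic_Gamma (N k : Z) (F : C -> C) : Prop :=
  holomorphic_H F
  /\ (forall A : mat2, Gamma N A ->
        forall z : C, upper_half_plane z -> slash k F A z = F z)
  /\ (forall A : mat2, SL2Z A -> meromorphic_at_infinity N (slash k F A)).

(* Main.v *)
Require Import Defs.
From Stdlib Require Import Reals ZArith Znumtheory List.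
From Coquelicot Require Import Coquelicot.
From Stdlib Require Import Lra Lia Psatz Classical_Prop.

(** With e(w) = exp(2 pi i w) and t = p z, each f_{p,k}(z) equals
    - eta(t)^3 K_{(k/p,0)}(t), where K_{(r,s)} is the Klein form
    e(r v / 2) P(v, t) at v = r t + s and P is the odd Jacobi theta function
    divided by eta^3.  Hence j is eta(t)^{24 T} times a product of integral
    powers of Klein forms, all of integral weight, and the eta multiplier never
    enters.

    The one analytic fact is P(u/t, -1/t) = e(u^2/(2t)) P(u, t) / t.  By Euler's
    product for the sine, P(u, t) and P(u/t, -1/t) are, up to elementary factors,
    the two iterated limits of the product of 1 - u^2/w^2 over the lattice
    Z + Z t.  For a = u^2, b = v^2 the product of
    (1 - a/w^2)(1 - b/w^2)/(1 - (a+b)/w^2) = 1 + O(w^{-4}) converges absolutely,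
    so R(u) = t P(u/t, -1/t)/P(u, t) satisfies R(u) R(v) = R(w) whenever
    u^2 + v^2 = w^2.  Taking w = v + k with k a positive integer, the
    quasi-periodicity of P gives R(v + k)/R(v) = e(((v+k)^2 - v^2)/(2t)), that is
    R(u) = e(u^2/(2t)).

    The Klein forms at the points of order two multiply to a constant times
    eta^{-6}, which transfers the modularity to eta^24.  At a cusp, j becomes a
    constant times such a product in e((L z + b)/p), an infinite product in
    e(z/p) whose power series expansion also yields holomorphy. *)

Local Open Scope C_scope.

(** * Limits, infinite products and Tannery's theorem *)

(** The lattice products behind P(u, t) and P(u/t, -1/t) converge only conditionally, because the
    sum of |w|^(-2) over the lattice diverges; the factor e(u^2/(2t)) is exactly the discrepancy
    between multiplying by rows and by columns. In (1 - a/w^2)(1 - b/w^2)/(1 - (a+b)/w^2) the terms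
    in 1/w^2 cancel, so the order no longer matters, and what this quotient forgets is recovered
    from the quasi-periods, which are elementary on both sides. Dominated convergence of products
    thus takes the place of Poisson summation or contour integration.

    The integer T is (n_0 + 3 sum n_k)/24. Conditions (1) and (3) give 12 T - sum n_k = 1, which is
    the weight, since a Klein form has weight -1. Condition (2) enters through the multiplier on
    Gamma_1(p), whose exponent is a quadratic polynomial in k summed against n_k.

    The n_k may be negative, so every factor is carried together with its reciprocal: it is shown
    not to vanish, and the reciprocal gets an expansion of its own. *)

Definition Ccvg (u : nat -> C) (l : C) : Prop :=
  is_lim_seq (fun n => Cmod (u n - l)) 0%R.

Lemma is_lim_seq_0_le (u v : nat -> R) :
  (forall n, 0 <= u n <= v n)%R -> is_lim_seq v 0%R -> is_lim_seq u 0%R.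
Proof.
  intros H Hv. apply is_lim_seq_le_le with (u := fun _ => 0%R) (w := v); auto.
  apply is_lim_seq_const.
Qed.

Lemma is_lim_seq_0_plus (u v : nat -> R) :
  is_lim_seq u 0%R -> is_lim_seq v 0%R -> is_lim_seq (fun n => u n + v n)%R 0%R.
Proof.
  intros Hu Hv. replace (Finite 0) with (Finite (0 + 0)) by (f_equal; ring).
  now apply is_lim_seq_plus'.
Qed.

Lemma is_lim_seq_0_scal (c : R) (u : nat -> R) :
  is_lim_seq u 0%R -> is_lim_seq (fun n => c * u n)%R 0%R.
Proof.
  intros Hu. replace (Finite 0) with (Rbar_mult c 0%R)
    by (simpl; f_equal; ring).
  now apply is_lim_seq_scal_l.
Qed.

Lemma is_lim_seq_0_eps (u : nat -> R) :
  (forall n, 0 <= u n)%R ->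
  is_lim_seq u 0%R <->
  (forall eps, 0 < eps -> exists N, forall n, (N <= n)%nat -> u n < eps)%R.
Proof.
  intros Hu. rewrite <- is_lim_seq_spec. simpl. split; intros H.
  - intros eps He. destruct (H (mkposreal eps He)) as [N HN]. exists N.
    intros n Hn. specialize (HN n Hn). simpl in HN.
    rewrite Rminus_0_r in HN. apply Rabs_def2 in HN. lra.
  - intros [eps He]. destruct (H eps He) as [N HN]. exists N.
    intros n Hn. simpl. rewrite Rminus_0_r, Rabs_pos_eq; auto.
Qed.

Lemma Ccvg_eps (u : nat -> C) (l : C) :
  Ccvg u l <->
  (forall eps, (0 < eps)%R ->
     exists N, forall n, (N <= n)%nat -> (Cmod (u n - l) < eps)%R).
Proof. apply is_lim_seq_0_eps. intros; apply Cmod_ge_0. Qed.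

Lemma Ccvg_ext (u v : nat -> C) (l : C) :
  (forall n, u n = v n) -> Ccvg u l -> Ccvg v l.
Proof.
  intros H. apply is_lim_seq_ext. intros n. now rewrite H.
Qed.

Lemma Ccvg_ext_loc (N : nat) (u v : nat -> C) (l : C) :
  (forall n, (N <= n)%nat -> u n = v n) -> Ccvg u l -> Ccvg v l.
Proof.
  intros H. apply is_lim_seq_ext_loc. exists N. intros n Hn. now rewrite H.
Qed.

Lemma Ccvg_const (c : C) : Ccvg (fun _ => c) c.
Proof.
  apply is_lim_seq_ext with (u := fun _ => 0%R); [|apply is_lim_seq_const].
  intros _. unfold Cminus. now rewrite Cplus_opp_r, Cmod_0.
Qed.

Lemma Ccvg_subseq (phi : nat -> nat) (u : nat -> C) (l : C) :
  filterlim phi eventually eventually -> Ccvg u l -> Ccvg (fun n => u (phi n)) l.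
Proof.
  intros Hphi Hu. unfold Ccvg.
  now apply (is_lim_seq_subseq (fun n => Cmod (u n - l))).
Qed.

Lemma Ccvg_plus (u v : nat -> C) (a b : C) :
  Ccvg u a -> Ccvg v b -> Ccvg (fun n => u n + v n) (a + b).
Proof.
  intros Hu Hv. apply is_lim_seq_0_le with (2 := is_lim_seq_0_plus _ _ Hu Hv).
  intros n. split; [apply Cmod_ge_0|].
  replace (u n + v n - (a + b)) with ((u n - a) + (v n - b)) by ring.
  apply Cmod_triangle.
Qed.

Lemma Ccvg_scal (c : C) (u : nat -> C) (a : C) :
  Ccvg u a -> Ccvg (fun n => c * u n) (c * a).
Proof.
  intros Hu. apply is_lim_seq_0_le with (2 := is_lim_seq_0_scal (Cmod c) _ Hu).
  intros n. split; [apply Cmod_ge_0|].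
  replace (c * u n - c * a) with (c * (u n - a)) by ring.
  rewrite Cmod_mult. lra.
Qed.

Lemma Ccvg_opp (u : nat -> C) (a : C) : Ccvg u a -> Ccvg (fun n => - u n) (- a).
Proof.
  intros Hu. replace (- a) with ((-(1)) * a) by ring.
  apply Ccvg_ext with (fun n => (-(1)) * u n); [intros; ring|].
  now apply Ccvg_scal.
Qed.

Lemma Ccvg_minus (u v : nat -> C) (a b : C) :
  Ccvg u a -> Ccvg v b -> Ccvg (fun n => u n - v n) (a - b).
Proof. intros Hu Hv. apply Ccvg_plus; auto. now apply Ccvg_opp. Qed.

Lemma Ccvg_bounded (u : nat -> C) (a : C) :
  Ccvg u a -> exists N, forall n, (N <= n)%nat -> (Cmod (u n) <= Cmod a + 1)%R.
Proof.
  intros Hu. destruct (proj1 (Ccvg_eps _ _) Hu 1%R Rlt_0_1) as [N HN].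
  exists N. intros n Hn. specialize (HN n Hn).
  replace (u n) with ((u n - a) + a) by ring.
  eapply Rle_trans; [apply Cmod_triangle|]. lra.
Qed.

Lemma Ccvg_mult (u v : nat -> C) (a b : C) :
  Ccvg u a -> Ccvg v b -> Ccvg (fun n => u n * v n) (a * b).
Proof.
  intros Hu Hv. destruct (Ccvg_bounded _ _ Hu) as [N HN].
  unfold Ccvg. rewrite (is_lim_seq_incr_n _ N).
  pose proof (proj1 (is_lim_seq_incr_n _ N _) Hu) as Hu'.
  pose proof (proj1 (is_lim_seq_incr_n _ N _) Hv) as Hv'.
  cbv beta in Hu', Hv'.
  refine (is_lim_seq_0_le _ _ _ (is_lim_seq_0_plus _ _
    (is_lim_seq_0_scal (Cmod b) _ Hu') (is_lim_seq_0_scal (Cmod a + 1) _ Hv'))).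
  intros n. split; [apply Cmod_ge_0|].
  replace (u (n + N)%nat * v (n + N)%nat - a * b) with
    (b * (u (n + N)%nat - a) + u (n + N)%nat * (v (n + N)%nat - b)) by ring.
  eapply Rle_trans; [apply Cmod_triangle|]. rewrite !Cmod_mult.
  apply Rplus_le_compat_l, Rmult_le_compat_r; [apply Cmod_ge_0|].
  apply HN. lia.
Qed.

Lemma Ccvg_inv (u : nat -> C) (a : C) :
  a <> 0 -> Ccvg u a -> Ccvg (fun n => / u n) (/ a).
Proof.
  intros Ha Hu. apply Cmod_gt_0 in Ha as Ha'.
  destruct (proj1 (Ccvg_eps _ _) Hu (Cmod a / 2)%R ltac:(lra)) as [N HN].
  assert (Hlow : forall n, (N <= n)%nat -> (Cmod a / 2 <= Cmod (u n))%R).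
  { intros n Hn. specialize (HN n Hn).
    pose proof (Cmod_triangle (u n) (a - u n)) as T.
    replace (u n + (a - u n)) with a in T by ring.
    rewrite <- (Cmod_opp (a - u n)) in T.
    replace (- (a - u n)) with (u n - a) in T by ring. lra. }
  unfold Ccvg. rewrite (is_lim_seq_incr_n _ N).
  pose proof (proj1 (is_lim_seq_incr_n _ N _) Hu) as Hu'. cbv beta in Hu'.
  refine (is_lim_seq_0_le _ _ _
    (is_lim_seq_0_scal (2 / (Cmod a * Cmod a)) _ Hu')).
  intros n. split; [apply Cmod_ge_0|].
  specialize (Hlow (n + N)%nat ltac:(lia)). set (x := u (n + N)%nat) in *.
  assert (Hx : x <> 0) by (apply Cmod_gt_0; lra).
  replace (/ x - / a) with (- (x - a) * / (x * a)) by (field; auto).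
  rewrite Cmod_mult, Cmod_opp, Cmod_inv, Cmod_mult by now apply Cmult_neq_0.
  rewrite Rmult_comm. apply Rmult_le_compat_r; [apply Cmod_ge_0|].
  apply Rle_trans with (/ (Cmod a / 2 * Cmod a))%R.
  - apply Rinv_le_contravar; nra.
  - right. field. lra.
Qed.

Lemma Ccvg_div (u v : nat -> C) (a b : C) :
  b <> 0 -> Ccvg u a -> Ccvg v b -> Ccvg (fun n => u n / v n) (a / b).
Proof. intros. apply Ccvg_mult; auto. now apply Ccvg_inv. Qed.

Lemma Ccvg_unique (u : nat -> C) (a b : C) : Ccvg u a -> Ccvg u b -> a = b.
Proof.
  intros Ha Hb. apply Ceq_minus, Cmod_eq_0.
  pose proof (Ccvg_minus _ _ _ _ Hb Ha) as H.
  assert (H' : is_lim_seq (fun _ : nat => Cmod (a - b)) 0%R).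
  { eapply is_lim_seq_ext; [|exact H]. intros n. cbv beta.
    replace (u n - u n - (b - a)) with (a - b) by ring. reflexivity. }
  pose proof (is_lim_seq_unique _ _ H') as H1. rewrite Lim_seq_const in H1.
  now injection H1.
Qed.

Lemma Ccvg_le (N : nat) (u : nat -> C) (l c : C) (B : R) :
  Ccvg u l -> (forall n, (N <= n)%nat -> Cmod (u n - c) <= B)%R ->
  (Cmod (l - c) <= B)%R.
Proof.
  intros Hu HB. apply le_epsilon. intros eps He.
  destruct (proj1 (Ccvg_eps _ _) Hu eps He) as [M HM].
  specialize (HM (N + M)%nat ltac:(lia)). specialize (HB (N + M)%nat ltac:(lia)).
  replace (l - c) with (- (u (N + M)%nat - l) + (u (N + M)%nat - c)) by ring.
  eapply Rle_trans; [apply Cmod_triangle|]. rewrite Cmod_opp. lra.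
Qed.

Lemma Ccvg_Re_Im (u : nat -> C) (l : C) :
  Ccvg u l <-> is_lim_seq (fun n => Re (u n)) (Re l) /\
               is_lim_seq (fun n => Im (u n)) (Im l).
Proof.
  assert (L : forall (x : nat -> R) (a : R),
    is_lim_seq (fun n => Rabs (x n - a)) 0%R <-> is_lim_seq x a).
  { intros x a. rewrite <- is_lim_seq_abs_0. split; intros H.
    - replace (Finite a) with (Finite (0 + a)) by (f_equal; ring).
      apply is_lim_seq_ext with (fun n => (x n - a) + a)%R; [intros; ring|].
      apply is_lim_seq_plus'; auto. apply is_lim_seq_const.
    - replace (Finite 0) with (Finite (a - a)) by (f_equal; ring).
      apply is_lim_seq_minus'; auto. apply is_lim_seq_const. }
  rewrite <- (L (fun n => Re (u n))), <- (L (fun n => Im (u n))). split.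
  - intros H.
    split; refine (is_lim_seq_0_le _ _ _ H); intros n; split;
      try apply Rabs_pos; pose proof (Rmax_Cmod (u n - l)) as T;
      pose proof (Rmax_l (Rabs (fst (u n - l))) (Rabs (snd (u n - l))));
      pose proof (Rmax_r (Rabs (fst (u n - l))) (Rabs (snd (u n - l))));
      unfold Re, Im; simpl in *; unfold Rminus; lra.
  - intros [H1 H2].
    refine (is_lim_seq_0_le _ _ _ (is_lim_seq_0_plus _ _ H1 H2)).
    intros n; split; [apply Cmod_ge_0|].
    replace (u n - l) with ((Re (u n) - Re l)%R + Ci * (Im (u n) - Im l)%R).
    + eapply Rle_trans; [apply Cmod_triangle|].
      rewrite Cmod_mult, Cmod_Ci, !Cmod_R. lra.
    + destruct (u n), l. apply injective_projections; simpl; ring.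
Qed.

(** The total function [Clim_seq] of the statement is read only through this lemma, so that
    convergence is always established first. *)
Lemma Ccvg_Clim_seq (u : nat -> C) (l : C) : Ccvg u l -> Clim_seq u = l.
Proof.
  intros H. apply Ccvg_Re_Im in H as [H1 H2].
  unfold Clim_seq. rewrite (is_lim_seq_unique _ _ H1), (is_lim_seq_unique _ _ H2).
  now destruct l.
Qed.

Lemma Ccvg_cauchy (u : nat -> C) :
  (forall eps, 0 < eps -> exists N, forall n, (N <= n)%nat ->
     Cmod (u n - u N) < eps)%R ->
  exists l, Ccvg u l.
Proof.
  intros H.
  assert (L : forall p : C -> R,
    (forall a b, Rabs (p a - p b) <= Cmod (a - b))%R ->
    exists l : R, is_lim_seq (fun n => p (u n)) l).
  { intros p Hp. apply ex_lim_seq_cauchy_corr. intros [eps He].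
    destruct (H (eps / 2)%R ltac:(lra)) as [N HN]. exists N.
    intros n m Hn Hm. simpl.
    pose proof (Hp (u n) (u m)) as T. specialize (HN n Hn) as A.
    specialize (HN m Hm) as B. pose proof (Cmod_triangle (u n - u N) (- (u m - u N))) as T2.
    rewrite Cmod_opp in T2.
    replace (u n - u N + - (u m - u N)) with (u n - u m) in T2 by ring. lra. }
  destruct (L Re) as [a Ha].
  { intros a b. replace (Re a - Re b)%R with (Re (a - b)) by (destruct a, b; simpl; ring).
    apply re_le_Cmod. }
  destruct (L Im) as [b Hb].
  { intros a' b. pose proof (Rmax_Cmod (a' - b)) as T.
    pose proof (Rmax_r (Rabs (fst (a' - b))) (Rabs (snd (a' - b)))).
    unfold Im. simpl in *. unfold Rminus. lra. }
  exists (a, b). apply Ccvg_Re_Im. now split.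
Qed.

(** * Finite products and sums *)

Fixpoint prodn (u : nat -> C) (n : nat) : C :=
  match n with O => 1 | S k => prodn u k * u k end.

Fixpoint csum (u : nat -> C) (n : nat) : C :=
  match n with O => 0 | S k => csum u k + u k end.

Fixpoint rsum (u : nat -> R) (n : nat) : R :=
  match n with O => 0%R | S k => (rsum u k + u k)%R end.

Lemma prodn_ext (u v : nat -> C) (n : nat) :
  (forall i, (i < n)%nat -> u i = v i) -> prodn u n = prodn v n.
Proof.
  induction n as [|n IH]; intros H; simpl; auto. rewrite IH, H; auto.
Qed.

Lemma prodn_mult (u v : nat -> C) (n : nat) :
  prodn (fun i => u i * v i) n = prodn u n * prodn v n.
Proof. induction n as [|n IH]; simpl; [ring|]. rewrite IH. ring. Qed.

Lemma prodn_inv (u : nat -> C) (n : nat) :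
  (forall i, u i <> 0) -> prodn (fun i => / u i) n = / prodn u n
  /\ prodn u n <> 0.
Proof.
  intros H. induction n as [|n [IH1 IH2]]; simpl.
  - split; [field|]; apply C1_nz.
  - split; [|now apply Cmult_neq_0]. rewrite IH1. field. auto.
Qed.

Lemma prodn_const (c : C) (n : nat) : prodn (fun _ => c) n = c ^ n.
Proof. induction n as [|n IH]; simpl; auto. rewrite IH. ring. Qed.

Lemma prodn_add (u : nat -> C) (n m : nat) :
  prodn u (n + m) = prodn u n * prodn (fun i => u (n + i)%nat) m.
Proof.
  induction m as [|m IH]; simpl.
  - rewrite Nat.add_0_r. ring.
  - rewrite Nat.add_succ_r. simpl. rewrite IH. ring.
Qed.

Lemma prodn_S_l (u : nat -> C) (n : nat) :
  prodn u (S n) = u O * prodn (fun i => u (S i)) n.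
Proof.
  change (S n) with (1 + n)%nat. rewrite prodn_add. simpl. ring.
Qed.

Lemma prodn_rev (u : nat -> C) (n : nat) :
  prodn u n = prodn (fun i => u (n - 1 - i)%nat) n.
Proof.
  induction n as [|n IH]; auto.
  rewrite (prodn_S_l (fun i => u (S n - 1 - i)%nat)).
  change (prodn u (S n)) with (prodn u n * u n). rewrite IH.
  replace (S n - 1 - 0)%nat with n by lia. rewrite Cmult_comm. f_equal.
  apply prodn_ext. intros i Hi. f_equal. lia.
Qed.

Lemma prodn_swap (u : nat -> nat -> C) (n m : nat) :
  prodn (fun i => prodn (fun k => u i k) m) n
  = prodn (fun k => prodn (fun i => u i k) n) m.
Proof.
  induction n as [|n IH]; simpl.
  - induction m as [|m IH]; simpl; auto. rewrite <- IH. ring.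
  - now rewrite IH, prodn_mult.
Qed.

Lemma prodn_eq0 (u : nat -> C) (n i : nat) :
  (i < n)%nat -> u i = 0 -> prodn u n = 0.
Proof.
  induction n as [|n IH]; intros Hi H; [lia|]. simpl.
  destruct (Nat.eq_dec i n) as [->|Hne]; [rewrite H; ring|].
  rewrite IH; auto; [ring|lia].
Qed.

Lemma prodn_Cprod (u : nat -> C) (n k : nat) :
  Cprod (map u (seq k n)) = prodn (fun i => u (k + i)%nat) n.
Proof.
  revert k. induction n as [|n IH]; intros k; auto.
  rewrite prodn_S_l. simpl. rewrite IH, Nat.add_0_r. f_equal.
  apply prodn_ext. intros i _. f_equal. lia.
Qed.

Lemma Cprod_inf_cvg (u : nat -> C) (l : C) : Ccvg (prodn u) l -> Cprod_inf u = l.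
Proof.
  intros H. apply Ccvg_Clim_seq. eapply Ccvg_ext; [|exact H].
  intros n. now rewrite prodn_Cprod.
Qed.

Lemma rsum_ext (u v : nat -> R) (n : nat) :
  (forall i, (i < n)%nat -> u i = v i) -> rsum u n = rsum v n.
Proof.
  induction n as [|n IH]; intros H; simpl; auto. rewrite IH, H; auto.
Qed.

Lemma rsum_le (u v : nat -> R) (n : nat) :
  (forall i, (i < n)%nat -> u i <= v i)%R -> (rsum u n <= rsum v n)%R.
Proof.
  induction n as [|n IH]; intros H; simpl; [lra|].
  specialize (IH ltac:(auto)). specialize (H n ltac:(lia)). lra.
Qed.

Lemma rsum_ge0 (u : nat -> R) (n : nat) :
  (forall i, 0 <= u i)%R -> (0 <= rsum u n)%R.
Proof.
  intros H. induction n as [|n IH]; simpl; [lra|]. specialize (H n). lra.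
Qed.

Lemma rsum_scal (c : R) (u : nat -> R) (n : nat) :
  rsum (fun i => c * u i)%R n = (c * rsum u n)%R.
Proof. induction n as [|n IH]; simpl; [ring|]. rewrite IH. ring. Qed.

Lemma rsum_add (u : nat -> R) (n m : nat) :
  rsum u (n + m) = (rsum u n + rsum (fun i => u (n + i)%nat) m)%R.
Proof.
  induction m as [|m IH]; simpl.
  - rewrite Nat.add_0_r. ring.
  - rewrite Nat.add_succ_r. simpl. rewrite IH. ring.
Qed.

Lemma rsum_mono (u : nat -> R) (n m : nat) :
  (forall i, 0 <= u i)%R -> (n <= m)%nat -> (rsum u n <= rsum u m)%R.
Proof.
  intros H Hnm. replace m with (n + (m - n))%nat by lia. rewrite rsum_add.
  pose proof (rsum_ge0 (fun i => u (n + i)%nat) (m - n) (fun i => H _)). lra.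
Qed.

Lemma csum_ext (u v : nat -> C) (n : nat) :
  (forall i, (i < n)%nat -> u i = v i) -> csum u n = csum v n.
Proof.
  induction n as [|n IH]; intros H; simpl; auto. rewrite IH, H; auto.
Qed.

Lemma csum_scal (c : C) (u : nat -> C) (n : nat) :
  csum (fun i => c * u i) n = c * csum u n.
Proof. induction n as [|n IH]; simpl; [ring|]. rewrite IH. ring. Qed.

Lemma csum_plus (u v : nat -> C) (n : nat) :
  csum (fun i => u i + v i) n = csum u n + csum v n.
Proof. induction n as [|n IH]; simpl; [ring|]. rewrite IH. ring. Qed.

Lemma csum_minus (u v : nat -> C) (n : nat) :
  csum (fun i => u i - v i) n = csum u n - csum v n.
Proof. induction n as [|n IH]; simpl; [ring|]. rewrite IH. ring. Qed.

Lemma csum_add (u : nat -> C) (n m : nat) :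
  csum u (n + m) = csum u n + csum (fun i => u (n + i)%nat) m.
Proof.
  induction m as [|m IH]; simpl.
  - rewrite Nat.add_0_r. ring.
  - rewrite Nat.add_succ_r. simpl. rewrite IH. ring.
Qed.

Lemma csum_0 (u : nat -> C) (n : nat) :
  (forall i, (i < n)%nat -> u i = 0) -> csum u n = 0.
Proof.
  induction n as [|n IH]; intros H; simpl; auto. rewrite IH, H; auto. ring.
Qed.

Lemma Cmod_csum (u : nat -> C) (n : nat) :
  (Cmod (csum u n) <= rsum (fun i => Cmod (u i)) n)%R.
Proof.
  induction n as [|n IH]; simpl; [rewrite Cmod_0; lra|].
  eapply Rle_trans; [apply Cmod_triangle|]. lra.
Qed.

(** * Majorants, dominated convergence and infinite products *)

Definition summable (M : nat -> R) : Prop :=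
  (forall i, 0 <= M i)%R /\ exists B, forall n, (rsum M n <= B)%R.

Lemma summable_tail (M : nat -> R) (eps : R) :
  summable M -> (0 < eps)%R ->
  exists N, forall n, (rsum (fun i => M (N + i)%nat) n < eps)%R.
Proof.
  intros [H0 [B HB]] He.
  destruct (ex_finite_lim_seq_incr (rsum M) B) as [l Hl]; auto.
  { intros n. simpl. specialize (H0 n). lra. }
  assert (Hle : forall n, (rsum M n <= l)%R).
  { intros n. apply (is_lim_seq_incr_compare (rsum M) l Hl).
    intros k. simpl. specialize (H0 k). lra. }
  apply is_lim_seq_spec in Hl. destruct (Hl (mkposreal eps He)) as [N HN].
  exists N. intros n. specialize (HN N (le_n _)). simpl in HN.
  apply Rabs_def2 in HN. specialize (Hle (N + n)%nat).
  rewrite rsum_add in Hle. lra.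
Qed.

Lemma summable_le (M M' : nat -> R) :
  (forall i, 0 <= M' i <= M i)%R -> summable M -> summable M'.
Proof.
  intros H [H0 [B HB]]. split; [apply H|]. exists B. intros n.
  eapply Rle_trans; [|apply HB]. apply rsum_le. intros; apply H.
Qed.

Lemma summable_scal (c : R) (M : nat -> R) :
  (0 <= c)%R -> summable M -> summable (fun i => c * M i)%R.
Proof.
  intros Hc [H0 [B HB]]. split.
  - intros i. specialize (H0 i). nra.
  - exists (c * B)%R. intros n. rewrite rsum_scal. specialize (HB n). nra.
Qed.

Lemma rsum_geom_le (r : R) (n : nat) : (0 <= r < 1)%R -> (rsum (fun i => r ^ i) n <= / (1 - r))%R.
Proof.
  intros Hr.
  assert (E : rsum (fun i => r ^ i)%R n = ((1 - r ^ n) / (1 - r))%R).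
  { induction n as [|n IH]; simpl; [field; lra|]. rewrite IH. field. lra. }
  rewrite E. pose proof (pow_le r n ltac:(lra)).
  apply Rle_trans with (1 * / (1 - r))%R; [|lra].
  apply Rmult_le_compat_r; [|lra]. left. apply Rinv_0_lt_compat. lra.
Qed.

Lemma summable_geom (r : R) : (0 <= r < 1)%R -> summable (fun i => r ^ i)%R.
Proof.
  intros Hr. split; [intros; apply pow_le; lra|].
  exists (/ (1 - r))%R. intros n. now apply rsum_geom_le.
Qed.

Lemma summable_inv_sq : summable (fun i => / (INR (S i) * INR (S i)))%R.
Proof.
  assert (P : forall i, (0 < INR (S i))%R) by (intros; apply lt_0_INR; lia).
  split.
  - intros i. left. apply Rinv_0_lt_compat. specialize (P i). nra.
  (* Telescoping 1/(x+1)^2 <= 1/x - 1/(x+1) suggests the inductive bound 2 - 1/(n+1). *)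
  - assert (E : forall n, (rsum (fun i => / (INR (S i) * INR (S i)))%R (S n)
            <= 2 - / INR (S n))%R).
    { induction n as [|n IH]; [simpl; lra|].
      set (g := fun i => (/ (INR (S i) * INR (S i)))%R) in *.
      change (rsum g (S (S n))) with (rsum g (S n) + g (S n))%R.
      enough (g (S n) <= / INR (S n) - / INR (S (S n)))%R by lra.
      unfold g. specialize (P n). rewrite (S_INR (S n)).
      set (x := INR (S n)) in *.
      replace (/ x - / (x + 1))%R with (/ (x * (x + 1)))%R by (field; lra).
      apply Rinv_le_contravar; nra. }
    exists 2%R. intros n. specialize (E n).
    pose proof (Rinv_0_lt_compat _ (P n)).
    eapply Rle_trans; [apply (rsum_mono _ n (S n)); [|lia]|lra].
    intros i. left. apply Rinv_0_lt_compat. specialize (P i). nra.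
Qed.

(** The first K terms converge one by one, and beyond K both families are below M, whose tail is
    small uniformly in N. The number of terms [J N] may grow with N. *)
Lemma csum_tannery (x : nat -> nat -> C) (y : nat -> C) (M : nat -> R)
  (J : nat -> nat) (l : C) :
  summable M -> filterlim J eventually eventually ->
  (forall N i, (i < J N)%nat -> Cmod (x N i) <= M i)%R ->
  (forall i, Ccvg (fun N => x N i) (y i)) ->
  Ccvg (csum y) l -> Ccvg (fun N => csum (x N) (J N)) l.
Proof.
  intros HM HJ Hx Hy Hl.
  (* The limits inherit the majorant because index i is eventually below [J N]. *)
  assert (Hy' : forall i, (Cmod (y i) <= M i)%R).
  { intros i. replace (y i) with (y i - 0) by ring.
    assert (Ev : eventually (fun N => (S i <= J N)%nat)) by (apply HJ; now exists (S i)).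
    destruct Ev as [N0 HN0].
    apply (Ccvg_le N0 _ _ _ _ (Hy i)). intros n Hn.
    replace (x n i - 0) with (x n i) by ring. apply Hx. apply HN0, Hn. }
  replace l with (0 + l) by ring.
  apply Ccvg_ext with (fun N => csum (fun i => x N i - y i) (J N) + csum y (J N)).
  { intros N. rewrite csum_minus. ring. }
  apply Ccvg_plus; [|now apply (Ccvg_subseq J (csum y))].
  apply Ccvg_eps. intros eps He.
  destruct (summable_tail M (eps / 4) HM ltac:(lra)) as [K HK].
  assert (F : forall k, Ccvg (fun N => csum (fun i => x N i - y i) k) 0).
  { induction k as [|k IH]; simpl; [apply Ccvg_const|].
    replace (RtoC 0) with (0 + (y k - y k)) by ring. apply Ccvg_plus; auto.
    apply Ccvg_minus; auto. apply Ccvg_const. }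
  destruct (proj1 (Ccvg_eps _ _) (F K) (eps / 2)%R ltac:(lra)) as [N1 HN1].
  assert (Ev : eventually (fun N => (K <= J N)%nat)) by (apply HJ; now exists K).
  destruct Ev as [N2 HN2].
  exists (N1 + N2)%nat. intros n Hn.
  specialize (HN1 n ltac:(lia)). specialize (HN2 n ltac:(lia)).
  replace (J n) with (K + (J n - K))%nat by lia. rewrite csum_add.
  set (a := csum _ K) in *. set (b := csum _ (J n - K)).
  replace (a + b - 0) with ((a - 0) + b) by ring.
  assert (T : (Cmod b <= eps / 2)%R).
  { eapply Rle_trans; [apply Cmod_csum|].
    eapply Rle_trans; [apply (rsum_le _ (fun i => 2 * M (K + i)%nat)%R)|].
    - intros i Hi. unfold Cminus.
      eapply Rle_trans; [apply Cmod_triangle|]. rewrite Cmod_opp.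
      pose proof (Hx n (K + i)%nat ltac:(lia)). pose proof (Hy' (K + i)%nat). lra.
    - rewrite rsum_scal. specialize (HK (J n - K)%nat). lra. }
  eapply Rle_lt_trans; [apply Cmod_triangle|]. lra.
Qed.

Lemma csum_abs_cvg (u : nat -> C) :
  summable (fun i => Cmod (u i)) -> exists l, Ccvg (csum u) l.
Proof.
  intros H. apply Ccvg_cauchy. intros eps He.
  destruct (summable_tail _ eps H He) as [N HN]. exists N. intros n Hn.
  replace n with (N + (n - N))%nat by lia. rewrite csum_add.
  replace (csum u N + csum (fun i => u (N + i)%nat) (n - N) - csum u N)
    with (csum (fun i => u (N + i)%nat) (n - N)) by ring.
  eapply Rle_lt_trans; [apply Cmod_csum|]. apply HN.
Qed.

Lemma prodn_Cmod_le (u : nat -> C) (M : nat -> R) (n : nat) :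
  (forall i, (i < n)%nat -> Cmod (u i) <= 1 + M i)%R ->
  (Cmod (prodn u n) <= exp (rsum M n))%R.
Proof.
  induction n as [|n IH]; intros H; simpl.
  - rewrite Cmod_1, exp_0. lra.
  - rewrite Cmod_mult, exp_plus. apply Rmult_le_compat; try apply Cmod_ge_0.
    + apply IH. auto.
    + eapply Rle_trans; [apply H; lia|]. apply exp_ineq1_le.
Qed.

(** Exchange the factors one at a time: each exchange costs |u_i - v_i| times a mixed product of the
    others, which is at most the exponential of the sum of M. *)
Lemma prodn_diff (u v : nat -> C) (M : nat -> R) (n : nat) :
  (forall i, (i < n)%nat -> 0 <= M i /\ Cmod (u i) <= 1 + M i
                            /\ Cmod (v i) <= 1 + M i)%R ->
  (Cmod (prodn u n - prodn v n)
   <= exp (rsum M n) * rsum (fun i => Cmod (u i - v i)) n)%R.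
Proof.
  induction n as [|n IH]; intros H; simpl.
  - replace (1 - 1) with (RtoC 0) by ring. rewrite Cmod_0. lra.
  - assert (H' : forall i, (i < n)%nat -> (0 <= M i)%R /\
      (Cmod (u i) <= 1 + M i)%R /\ (Cmod (v i) <= 1 + M i)%R) by auto.
     destruct (H n ltac:(lia)) as [H0 [H1 H2]].
    pose proof (prodn_Cmod_le u M n (fun i Hi => proj1 (proj2 (H' i Hi)))) as HU.
    replace (prodn u n * u n - prodn v n * v n) with
      (prodn u n * (u n - v n) + (prodn u n - prodn v n) * v n) by ring.
    eapply Rle_trans; [apply Cmod_triangle|]. rewrite !Cmod_mult, exp_plus.
    pose proof (exp_ineq1_le (M n)) as HE.
    pose proof (exp_pos (rsum M n)) as HP.
    pose proof (Cmod_ge_0 (u n - v n)) as HC.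
    pose proof (Cmod_ge_0 (prodn u n - prodn v n)) as HD.
    pose proof (Cmod_ge_0 (v n)).
    set (E := exp (rsum M n)) in *. set (e := exp (M n)) in *.
    set (s := rsum (fun i => Cmod (u i - v i)) n) in *.
    apply Rle_trans with (E * e * Cmod (u n - v n) + (E * s) * e)%R; [|right; ring].
    apply Rplus_le_compat.
    + apply Rmult_le_compat_r; auto. nra.
    + apply Rmult_le_compat; auto. lra.
Qed.

Lemma prodn_minus1 (u : nat -> C) (n : nat) :
  (Cmod (prodn u n - 1)
   <= exp (rsum (fun i => Cmod (u i - 1)) n) * rsum (fun i => Cmod (u i - 1)) n)%R.
Proof.
  replace (RtoC 1) with (prodn (fun _ => RtoC 1) n) by (rewrite prodn_const; apply Cpow_1_l).
  eapply Rle_trans; [apply (prodn_diff u (fun _ => RtoC 1) (fun i => Cmod (u i - 1)))|].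
  - intros i _. split; [apply Cmod_ge_0|]. split.
    + replace (u i) with (1 + (u i - 1)) at 1 by ring.
      eapply Rle_trans; [apply Cmod_triangle|]. rewrite Cmod_1. lra.
    + rewrite Cmod_1. pose proof (Cmod_ge_0 (u i - 1)). lra.
  - rewrite prodn_const, Cpow_1_l. lra.
Qed.

Lemma Cmod_le_minus1 (x : C) (b : R) :
  (Cmod (x - 1) <= b)%R -> (Cmod x <= 1 + b)%R.
Proof.
  intros H. replace x with (1 + (x - 1)) by ring.
  eapply Rle_trans; [apply Cmod_triangle|]. rewrite Cmod_1. lra.
Qed.

Lemma exp_le (x y : R) : (x <= y)%R -> (exp x <= exp y)%R.
Proof. intros [H| ->]; [left; now apply exp_increasing|lra]. Qed.

Lemma prodn_cvg (u : nat -> C) :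
  summable (fun i => Cmod (u i - 1)) -> exists l, Ccvg (prodn u) l.
Proof.
  intros H. pose proof H as [H0 [B HB]]. apply Ccvg_cauchy. intros eps He.
  pose proof (exp_pos B) as HE.
  (* One factor exp B bounds the partial product up to N, the other comes from [prodn_minus1] for
     the tail. *)
  set (e := (eps / (2 * (exp B * exp B)))%R).
  assert (He' : (0 < e)%R) by (apply Rdiv_lt_0_compat; nra).
  destruct (summable_tail _ e H He') as [N HN]. exists N. intros n Hn.
  replace n with (N + (n - N))%nat by lia. rewrite prodn_add.
  set (v := fun i => u (N + i)%nat).
  replace (prodn u N * prodn v (n - N) - prodn u N) with
    (prodn u N * (prodn v (n - N) - 1)) by ring.
  rewrite Cmod_mult.
  assert (A : (Cmod (prodn u N) <= exp B)%R).
  { eapply Rle_trans; [apply (prodn_Cmod_le u (fun i => Cmod (u i - 1)))|].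
    - intros i _. apply Cmod_le_minus1. lra.
    - apply exp_le, HB. }
  assert (D : (Cmod (prodn v (n - N) - 1) <= exp B * e)%R).
  { eapply Rle_trans; [apply prodn_minus1|].
    specialize (HN (n - N)%nat).
    pose proof (rsum_ge0 (fun i => Cmod (v i - 1)) (n - N) ltac:(intros; apply Cmod_ge_0)).
    apply Rmult_le_compat; auto; try (left; apply exp_pos); [|unfold v in *; lra].
    apply exp_le. specialize (HB (N + (n - N))%nat). rewrite rsum_add in HB.
    pose proof (rsum_ge0 (fun i => Cmod (u i - 1)) N H0). unfold v. lra. }
  apply Rle_lt_trans with (exp B * (exp B * e))%R.
  - apply Rmult_le_compat; auto; apply Cmod_ge_0.
  - unfold e. replace (exp B * (exp B * (eps / (2 * (exp B * exp B)))))%R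
      with (eps / 2)%R by (field; lra). lra.
Qed.

(** By [prodn_diff] the product version follows from the version for sums, M now bounding the
    deviations from 1. It is made for products such as that of the sine, where the factors and their
    number vary together. *)
Lemma prodn_tannery (u : nat -> nat -> C) (v : nat -> C) (M : nat -> R)
  (J : nat -> nat) (l : C) :
  summable M -> filterlim J eventually eventually ->
  (forall N i, (i < J N)%nat -> Cmod (u N i - 1) <= M i)%R ->
  (forall i, Ccvg (fun N => u N i) (v i)) ->
  Ccvg (prodn v) l -> Ccvg (fun N => prodn (u N) (J N)) l.
Proof.
  intros HM HJ Hu Hv Hl. pose proof HM as [M0 [B HB]].
  assert (Hv' : forall i, (Cmod (v i - 1) <= M i)%R).
  { intros i.
    assert (Ev : eventually (fun N => (S i <= J N)%nat)) by (apply HJ; now exists (S i)).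
    destruct Ev as [N0 HN0].
    apply (Ccvg_le N0 _ _ _ _ (Hv i)). intros n Hn. apply Hu, HN0, Hn. }
  replace l with (0 + l) by ring.
  apply Ccvg_ext with (fun N => (prodn (u N) (J N) - prodn v (J N)) + prodn v (J N)).
  { intros N. ring. }
  apply Ccvg_plus; [|now apply (Ccvg_subseq J (prodn v))].
  (* The sum of |u_N i - v i| tends to 0 by Tannery's theorem for sums. *)
  assert (S0 : Ccvg (fun N => csum (fun i => RtoC (Cmod (u N i - v i))) (J N)) 0).
  { apply (csum_tannery _ (fun _ => RtoC 0) (fun i => 2 * M i)%R); auto.
    - apply summable_scal; auto; lra.
    - intros N i Hi. rewrite Cmod_R, Rabs_pos_eq by apply Cmod_ge_0.
      replace (u N i - v i) with ((u N i - 1) + - (v i - 1)) by ring.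
      eapply Rle_trans; [apply Cmod_triangle|]. rewrite Cmod_opp.
      specialize (Hu N i Hi). specialize (Hv' i). lra.
    - intros i. unfold Ccvg. eapply is_lim_seq_ext; [|exact (Hv i)].
      intros n. cbv beta. replace (RtoC (Cmod (u n i - v i)) - 0)
        with (RtoC (Cmod (u n i - v i))) by ring.
      rewrite Cmod_R, Rabs_pos_eq; auto. apply Cmod_ge_0.
    - apply Ccvg_ext with (fun _ => RtoC 0); [|apply Ccvg_const].
      intros n. symmetry. apply csum_0. auto. }
  refine (is_lim_seq_0_le _ _ _ (is_lim_seq_0_scal (exp B) _ S0)).
  intros N. split; [apply Cmod_ge_0|].
  replace (prodn (u N) (J N) - prodn v (J N) - 0)
    with (prodn (u N) (J N) - prodn v (J N)) by ring.
  eapply Rle_trans; [apply (prodn_diff _ _ M)|].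
  { intros i Hi. split; [apply M0|]. split; apply Cmod_le_minus1; auto. }
  apply Rmult_le_compat; try (left; apply exp_pos).
  - apply rsum_ge0. intros; apply Cmod_ge_0.
  - apply exp_le, HB.
  -  induction (J N) as [|k IH]; simpl.
    + replace (0 - 0) with (RtoC 0) by ring. rewrite Cmod_0. lra.
    + assert (E : forall n, csum (fun i => RtoC (Cmod (u N i - v i))) n
        = RtoC (rsum (fun i => Cmod (u N i - v i)) n)).
      { induction n as [|n IHn]; simpl; auto. now rewrite IHn, RtoC_plus. }
      rewrite E, <- RtoC_plus, <- RtoC_minus, Cmod_R, Rminus_0_r. apply Rle_abs.
Qed.

(** Once |x - 1| <= 1/2 one has |1/x - 1| <= 2 |x - 1|, so the product of the inverses converges
    too, and the two limits multiply to 1. *)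
Lemma prodn_cvg_neq0 (u : nat -> C) (l : C) :
  summable (fun i => Cmod (u i - 1)) -> (forall i, u i <> 0) ->
  Ccvg (prodn u) l -> l <> 0.
Proof.
  intros H Hu Hl.
  destruct (summable_tail _ (/ 2) H ltac:(lra)) as [N HN].
  assert (Hhalf : forall i, (Cmod (u (N + i)%nat - 1) <= / 2)%R).
  { intros i. specialize (HN (S i)). simpl in HN.
    pose proof (rsum_ge0 (fun i => Cmod (u (N + i)%nat - 1)) i
      ltac:(intros; apply Cmod_ge_0)). lra. }
  assert (Hi : exists l', Ccvg (prodn (fun i => / u i)) l').
  { apply prodn_cvg. destruct H as [H0 [B HB]].
    split; [intros; apply Cmod_ge_0|].
    exists (rsum (fun i => Cmod (/ u i - 1)) N + 2 * B)%R. intros n.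
    apply Rle_trans with (rsum (fun i => Cmod (/ u i - 1)) (N + n)).
    { apply rsum_mono; [intros; apply Cmod_ge_0|lia]. }
    rewrite rsum_add. apply Rplus_le_compat_l.
    apply Rle_trans with (rsum (fun i => 2 * Cmod (u (N + i)%nat - 1))%R n).
    - apply rsum_le. intros i _. specialize (Hhalf i).
      set (x := u (N + i)%nat) in *. assert (Hx : x <> 0) by apply Hu.
      assert (Hlow : (/ 2 <= Cmod x)%R).
      { pose proof (Cmod_triangle x (- (x - 1))) as T. rewrite Cmod_opp in T.
        replace (x + - (x - 1)) with (RtoC 1) in T by ring.
        rewrite Cmod_1 in T. lra. }
      replace (/ x - 1) with (- (x - 1) * / x) by (field; auto).
      rewrite Cmod_mult, Cmod_opp, Cmod_inv, Rmult_comm by auto.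
      apply Rmult_le_compat_r; [apply Cmod_ge_0|].
      replace 2%R with (/ / 2)%R by field. apply Rinv_le_contravar; lra.
    - rewrite rsum_scal. specialize (HB (N + n)%nat). rewrite rsum_add in HB.
      pose proof (rsum_ge0 _ N H0). cbv beta in *. lra. }
  destruct Hi as [l' Hl'].
  pose proof (Ccvg_mult _ _ _ _ Hl Hl') as Hp.
  assert (E : l * l' = 1).
  { apply (Ccvg_unique _ _ _ Hp). eapply Ccvg_ext; [|apply Ccvg_const].
    intros n. destruct (prodn_inv u n Hu) as [-> Hn]. now rewrite Cinv_r. }
  intros ->. rewrite Cmult_0_l in E. apply C1_nz. now rewrite <- E.
Qed.

(** * The complex exponential *)

Lemma RtoC_neq0 (r : R) : r <> 0%R -> RtoC r <> 0.
Proof. intros H E. apply H. now injection E. Qed.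

Lemma INR_S_neq0 (n : nat) : RtoC (INR (S n)) <> 0.
Proof. apply RtoC_neq0, not_0_INR. lia. Qed.

Lemma INR_C_neq0 (n : nat) : (0 < n)%nat -> RtoC (INR n) <> 0.
Proof. intros H. apply RtoC_neq0, not_0_INR. lia. Qed.

Lemma PI_C_neq0 : RtoC PI <> 0.
Proof. apply RtoC_neq0. pose proof PI_RGT_0. lra. Qed.

Lemma Ci2 : Ci * Ci = - (1).
Proof. apply injective_projections; simpl; ring. Qed.

Ltac nzc := repeat split; try apply C1_nz; try apply Ci_nz; try apply PI_C_neq0;
  try apply INR_S_neq0; try assumption; try (apply RtoC_neq0; lra).

Lemma Cexp_plus (a b : C) : Cexp (a + b) = Cexp a * Cexp b.
Proof.
  destruct a as [a1 a2], b as [b1 b2]. unfold Cexp; simpl.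
  rewrite exp_plus, cos_plus, sin_plus.
  apply injective_projections; simpl; ring.
Qed.

Lemma Cexp_0 : Cexp 0 = 1.
Proof.
  unfold Cexp; simpl. rewrite exp_0, cos_0, sin_0.
  apply injective_projections; simpl; ring.
Qed.

Lemma Cmod_Cexp (w : C) : Cmod (Cexp w) = exp (Re w).
Proof.
  unfold Cexp, Cmod; simpl.
  replace (_ + _)%R with (exp (Re w) * exp (Re w) * (Rsqr (sin (Im w)) + Rsqr (cos (Im w))))%R
    by (unfold Rsqr; ring).
  rewrite sin2_cos2, Rmult_1_r. apply sqrt_square. left; apply exp_pos.
Qed.

Lemma Cexp_neq0 (w : C) : Cexp w <> 0.
Proof. apply Cmod_gt_0. rewrite Cmod_Cexp. apply exp_pos. Qed.

Lemma Cexp_opp (w : C) : Cexp (- w) = / Cexp w.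
Proof.
  pose proof (Cexp_neq0 w) as H.
  assert (E : Cexp w * Cexp (- w) = 1)
    by (rewrite <- Cexp_plus, Cplus_opp_r; apply Cexp_0).
  replace (Cexp (- w)) with (/ Cexp w * (Cexp w * Cexp (- w))) by (field; auto).
  rewrite E. ring.
Qed.

(** Real and imaginary parts are each at most 4 |h|^2. This estimate is the source both of the limit
    of N sin(w/N) and of the holomorphy of e(c z). *)
Lemma Cexp_quadratic (h : C) :
  (Cmod h <= / 2)%R -> (Cmod (Cexp h - 1 - h) <= 8 * (Cmod h * Cmod h))%R.
Proof.
  intros Hh. destruct h as [x y].
  pose proof (Rmax_Cmod (x, y)) as T. simpl in T.
  pose proof (Rmax_l (Rabs x) (Rabs y)). pose proof (Rmax_r (Rabs x) (Rabs y)).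
  set (m := Cmod (x, y)) in *.
  assert (Hx : (Rabs x <= m)%R) by lra. assert (Hy : (Rabs y <= m)%R) by lra.
  apply Rabs_le_between in Hx. apply Rabs_le_between in Hy.
  assert (E1 : (1 + x <= exp x)%R) by apply exp_ineq1_le.
  assert (E2 : (exp x <= 1 + x + 2 * (m * m))%R).
  (* Hence exp x <= 1/(1 - x), and 1/(1 - x) = 1 + x + x^2/(1 - x) with 1 - x >= 1/2. *)
  { assert (1 - x <= exp (- x))%R by (pose proof (exp_ineq1_le (- x)); lra).
    rewrite exp_Ropp in H1.
    assert (exp x * (1 - x) <= 1)%R.
    { replace 1%R with (exp x * / exp x)%R at 2
        by (field; pose proof (exp_pos x); lra).
      apply Rmult_le_compat_l; auto. left; apply exp_pos. }
     nra. }
  assert (E3 : (exp x <= 2)%R) by nra.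
  assert (S1 : (Rabs (cos y - 1) <= m * m)%R).
  { assert (1 - y * y / 2 <= cos y)%R.
    { replace y with (2 * (y / 2))%R at 3 by field. rewrite cos_2a_sin.
      assert (Rabs (sin (y / 2)) <= Rabs (y / 2))%R.
      { destruct (Rle_dec 0 y) as [P|P].
        - rewrite (Rabs_pos_eq (y/2)) by lra.
          destruct (Req_dec y 0) as [->|Q].
          + replace (0/2)%R with 0%R by field. rewrite sin_0, Rabs_R0. lra.
          + rewrite Rabs_pos_eq; [left; apply sin_lt_x; lra|].
            apply sin_ge_0; pose proof PI2_3_2; unfold PI2 in *; lra.
        - rewrite <- Rabs_Ropp, <- sin_neg, <- (Rabs_Ropp (y/2)).
          rewrite (Rabs_pos_eq (-(y/2))) by lra.
          rewrite Rabs_pos_eq; [left; apply sin_lt_x; lra|].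
          apply sin_ge_0; pose proof PI2_3_2; unfold PI2 in *; lra. }
      apply Rsqr_le_abs_1 in H1. unfold Rsqr in H1. nra. }
    pose proof (COS_bound y). apply Rabs_le. split; nra. }
  assert (S2 : (Rabs (sin y - y) <= m * m)%R).
  (* The lower bound is the Taylor polynomial [sin_lb] of degree 7, simplified with t^2 <= 1/4. *)
  { assert (G : forall t, (0 <= t <= / 2 -> t - t * t <= sin t <= t)%R).
    { intros t Ht. destruct (Req_dec t 0) as [->|Q]; [rewrite sin_0; lra|].
      split; [|left; apply sin_lt_x; lra].
      pose proof (sin_lb_ge_0 t ltac:(lra)).
      assert (sin_lb t <= sin t)%R by
        (apply SIN; pose proof PI2_3_2; unfold PI2 in *; lra).
      assert (Elb : sin_lb t = (t - t * (t * t) / 6 + t * (t * t) * (t * t) / 120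
                 - t * (t * t) * (t * t) * (t * t) / 5040)%R).
      { unfold sin_lb, sin_approx, sin_term. simpl. field. }
      rewrite Elb in H2. set (u := (t * t)%R) in *.
      assert (U : (0 <= u <= / 4)%R) by (unfold u; nra).
      assert (0 <= t * u)%R by (apply Rmult_le_pos; lra).
      assert (t * u <= u / 2)%R by nra.
      assert (0 <= t * u * u <= t * u / 4)%R by (split; nra).
      assert (0 <= t * u * u * u <= t * u * u / 4)%R by (split; nra).
      lra. }
    destruct (Rle_dec 0 y) as [P|P].
    - specialize (G y ltac:(lra)). apply Rabs_le. nra.
    - specialize (G (-y)%R ltac:(lra)). rewrite sin_neg in G. apply Rabs_le. nra. }
  unfold Cexp. simpl.
  match goal with |- (Cmod ?z <= _)%R =>
    replace z with (((exp x - 1 - x) + exp x * (cos y - 1))%R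
      + Ci * ((exp x * (sin y - y)) + y * (exp x - 1))%R) end.
  2:{ apply injective_projections; simpl; ring. }
  eapply Rle_trans; [apply Cmod_triangle|].
  rewrite Cmod_mult, Cmod_Ci, !Cmod_R, Rmult_1_l.
  apply Rabs_le_between in S1. apply Rabs_le_between in S2.
  assert (Rabs (exp x - 1 - x + exp x * (cos y - 1)) <= 4 * (m * m))%R.
  { apply Rabs_le. split; nra. }
  assert (Rabs (exp x * (sin y - y) + y * (exp x - 1)) <= 4 * (m * m))%R.
  { assert (- (2 * (m * m)) <= exp x * (sin y - y) <= 2 * (m * m))%R by (split; nra).
    assert (- (2 * (m * m)) <= y * (exp x - 1) <= 2 * (m * m))%R by (split; nra).
    apply Rabs_le. lra. }
  lra.
Qed.

(** * The normalised exponential e(w) and the sine *)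

Definition ee (w : C) : C := Cexp (2 * PI * Ci * w).

Lemma ee_plus (a b : C) : ee (a + b) = ee a * ee b.
Proof. unfold ee. rewrite <- Cexp_plus. f_equal. ring. Qed.

Lemma ee_0 : ee 0 = 1.
Proof. unfold ee. rewrite <- Cexp_0. f_equal. ring. Qed.

Lemma ee_neq0 (w : C) : ee w <> 0.
Proof. apply Cexp_neq0. Qed.

Lemma ee_opp (w : C) : ee (- w) = / ee w.
Proof. unfold ee. rewrite <- Cexp_opp. f_equal. ring. Qed.

Lemma Cmod_ee (w : C) : Cmod (ee w) = exp (- (2 * PI * Im w)).
Proof.
  unfold ee. rewrite Cmod_Cexp. f_equal. destruct w; simpl. ring.
Qed.

Lemma ee_half : ee (/ 2) = - (1).
Proof.
  unfold ee. replace (2 * PI * Ci * / 2) with (PI * Ci) by (field; nzc).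
  unfold Cexp; simpl.
  replace (PI * 0 - 0 * 1)%R with 0%R by ring.
  replace (PI * 1 + 0 * 0)%R with PI by ring.
  rewrite exp_0, cos_PI, sin_PI. apply injective_projections; simpl; ring.
Qed.

Lemma ee_quarter : ee (/ 4) = Ci.
Proof.
  unfold ee. replace (2 * PI * Ci * / 4) with ((PI / 2)%R * Ci).
  2:{ rewrite RtoC_div by lra. field; nzc. }
  unfold Cexp; simpl.
  replace (PI / 2 * 0 - 0 * 1)%R with 0%R by field.
  replace (PI / 2 * 1 + 0 * 0)%R with (PI / 2)%R by field.
  rewrite exp_0, cos_PI2, sin_PI2. apply injective_projections; simpl; ring.
Qed.

Lemma ee_1 : ee 1 = 1.
Proof.
  replace (RtoC 1) with (/ 2 + / 2) at 1 by (field; nzc).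
  rewrite ee_plus, ee_half. ring.
Qed.

Lemma ee_nat (n : nat) (w : C) : ee (INR n * w) = ee w ^ n.
Proof.
  induction n as [|n IH].
  - simpl. rewrite Cmult_0_l. apply ee_0.
  - rewrite S_INR, RtoC_plus. replace ((INR n + 1) * w) with (w + INR n * w) by ring.
    rewrite ee_plus, IH. reflexivity.
Qed.

Lemma Zind_abs (Q : Z -> Prop) :
  (forall n, Q (Z.of_nat n)) -> (forall n, Q (- Z.of_nat n)%Z) -> forall k, Q k.
Proof.
  intros H1 H2 k. destruct (Z_le_gt_dec 0 k).
  - rewrite <- (Z2Nat.id k) by lia. apply H1.
  - replace k with (- Z.of_nat (Z.to_nat (- k)))%Z by lia. apply H2.
Qed.

Lemma ee_Z (k : Z) : ee (IZR k) = 1.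
Proof.
  assert (H : forall n, ee (INR n) = 1).
  { intros n. rewrite <- (Cmult_1_r (INR n)), ee_nat, ee_1. apply Cpow_1_l. }
  revert k. apply Zind_abs; intros n.
  - now rewrite <- INR_IZR_INZ.
  - rewrite opp_IZR, <- INR_IZR_INZ, RtoC_opp, ee_opp, H. field; nzc.
Qed.

Lemma ee_plus_Z (w : C) (k : Z) : ee (w + IZR k) = ee w.
Proof. rewrite ee_plus, ee_Z. ring. Qed.

Lemma sin_eq_0_Z (x : R) : sin x = 0%R -> exists k : Z, x = (IZR k * PI)%R.
Proof. intros H. now apply sin_eq_0_0. Qed.

(** The modulus forces a real argument x, and then cos(2 pi x) = 1 means sin(pi x) = 0. The location
    of all zeros below, of sines, q-products and theta quotients, rests on this. *)
Lemma ee_eq_1 (w : C) : ee w = 1 -> exists k : Z, w = IZR k.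
Proof.
  destruct w as [x y]. intros H.
  assert (Hy : y = 0%R).
  { assert (Hm : Cmod (ee (x, y)) = 1%R) by (rewrite H; apply Cmod_1).
    rewrite Cmod_ee in Hm. simpl in Hm. rewrite <- exp_0 in Hm.
    apply exp_inv in Hm. pose proof PI_RGT_0. nra. }
  subst y. unfold ee, Cexp in H.
  set (t := 2 * PI * Ci * (x, 0%R)) in H.
  assert (Ht : t = (0, 2 * PI * x)%R)
    by (unfold t; apply injective_projections; simpl; ring).
  rewrite Ht in H. simpl in H. rewrite exp_0 in H. injection H. intros Hs Hc.
  rewrite Rmult_1_l in Hs, Hc.
  replace (2 * PI * x)%R with (2 * (PI * x))%R in Hs, Hc by ring.
  rewrite cos_2a_sin in Hc.
  assert (sin (PI * x) = 0)%R by nra.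
  destruct (sin_eq_0_Z _ H0) as [k Hk]. exists k.
  pose proof PI_RGT_0. unfold RtoC. f_equal.
  apply (Rmult_eq_reg_l PI); lra.
Qed.

(* 2i sin (pi w) *)
Definition Sn (w : C) : C := ee (w / 2) - ee (- (w / 2)).

Lemma Sn_opp (w : C) : Sn (- w) = - Sn w.
Proof.
  unfold Sn. replace (- w / 2) with (- (w / 2)) by (field; nzc).
  replace (- - (w / 2)) with (w / 2) by ring. ring.
Qed.

Lemma Sn_plus_half (w : C) : Sn (w + / 2) = Ci * (ee (w / 2) + ee (- (w / 2))).
Proof.
  unfold Sn. replace ((w + / 2) / 2) with (w / 2 + / 4) by (field; nzc).
  rewrite !ee_opp, ee_plus, ee_quarter. pose proof (ee_neq0 (w / 2)).
  assert (E : / Ci = - Ci).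
  { rewrite <- (Cmult_1_l (- Ci)). replace (RtoC 1) with (/ Ci * Ci) by (field; nzc).
    replace (/ Ci * Ci * - Ci) with (/ Ci * - (Ci * Ci)) by ring.
    rewrite Ci2. ring. }
  replace (/ (ee (w / 2) * Ci)) with (/ ee (w / 2) * / Ci) by (field; nzc).
  rewrite E. ring.
Qed.

Lemma Sn_plus_1 (w : C) : Sn (w + 1) = - Sn w.
Proof.
  unfold Sn. replace ((w + 1) / 2) with (w / 2 + / 2) by (field; nzc).
  rewrite !ee_opp, ee_plus, ee_half. pose proof (ee_neq0 (w / 2)). field; auto.
Qed.

(** The duplication formula of the sine with the cosine written as a shifted sine, so that it can be
    iterated. *)
Lemma Sn_double (y : C) : Sn (2 * y) = - Ci * (Sn y * Sn (y + / 2)).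
Proof.
  rewrite Sn_plus_half. unfold Sn.
  replace (2 * y / 2) with (y / 2 + y / 2) by (field; nzc).
  rewrite !ee_opp, ee_plus. pose proof (ee_neq0 (y / 2)).
  match goal with |- _ = - Ci * (?a * (Ci * ?b)) =>
    replace (- Ci * (a * (Ci * b))) with (- (Ci * Ci) * (a * b)) by ring end.
  rewrite Ci2. field; auto.
Qed.

(** This turns two opposite factors of the dyadic sine product into a difference of squares. *)
Lemma Sn_add_sub (x y : C) :
  Sn (x + y) * Sn (x - y) = Sn x * Sn x - Sn y * Sn y.
Proof.
  unfold Sn. replace ((x + y) / 2) with (x / 2 + y / 2) by (field; nzc).
  replace ((x - y) / 2) with (x / 2 + - (y / 2)) by (field; nzc).
  rewrite !ee_opp, !ee_plus, !ee_opp.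
  pose proof (ee_neq0 (x / 2)). pose proof (ee_neq0 (y / 2)). field; auto.
Qed.

Lemma Sn_eq_ee (w : C) : Sn w = - ee (- (w / 2)) * (1 - ee w).
Proof.
  unfold Sn. replace w with (w / 2 + w / 2) at 4 by (field; nzc).
  rewrite !ee_opp, !ee_plus. pose proof (ee_neq0 (w / 2)). field; auto.
Qed.

Lemma Sn_eq0 (w : C) : Sn w = 0 -> exists k : Z, w = IZR k.
Proof.
  rewrite Sn_eq_ee. intros H. apply ee_eq_1.
  destruct (Ceq_dec (ee w) 1) as [E|E]; auto. exfalso.
  apply (Cmult_neq_0 (- ee (- (w / 2))) (1 - ee w)) in H; auto.
  - intros H'. apply (ee_neq0 (- (w / 2))).
    replace (ee (- (w / 2))) with (- - ee (- (w / 2))) by ring. rewrite H'. ring.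
  - intros H'. apply E. replace (ee w) with (1 - (1 - ee w)) by ring. rewrite H'. ring.
Qed.

(** * The sine product *)

Lemma Ccvg_eq (u : nat -> C) (a b : C) : a = b -> Ccvg u a -> Ccvg u b.
Proof. now intros ->. Qed.

Lemma Sn_linear (x : C) :
  (Cmod (PI * Ci * x) <= / 2)%R ->
  (Cmod (Sn x - 2 * PI * Ci * x) <= 16 * (Cmod (PI * Ci * x) * Cmod (PI * Ci * x)))%R.
Proof.
  intros H. set (h := PI * Ci * x) in *.
  assert (E : Sn x = Cexp h - Cexp (- h)).
  { unfold Sn, ee, h. f_equal; [|f_equal]; f_equal; field; nzc. }
  rewrite E. replace (2 * PI * Ci * x) with (h + h) by (unfold h; ring).
  replace (Cexp h - Cexp (- h) - (h + h)) with
    ((Cexp h - 1 - h) + - (Cexp (- h) - 1 - - h)) by ring.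
  eapply Rle_trans; [apply Cmod_triangle|]. rewrite Cmod_opp.
  pose proof (Cexp_quadratic h H). pose proof (Cexp_quadratic (- h)) as T.
  rewrite Cmod_opp in T. specialize (T H). lra.
Qed.

Lemma is_lim_seq_inv_0 (N : nat -> nat) (c : R) :
  filterlim N eventually eventually -> is_lim_seq (fun k => c * / INR (N k))%R 0%R.
Proof.
  intros H. apply is_lim_seq_0_scal.
  apply (is_lim_seq_subseq (fun n => / INR n)%R); auto.
  replace (Finite 0) with (Rbar_inv p_infty) by reflexivity.
  apply is_lim_seq_inv; [apply is_lim_seq_INR|discriminate].
Qed.

Lemma Sn_scaled_limit (N : nat -> nat) (w : C) :
  (forall k, (0 < N k)%nat) -> filterlim N eventually eventually ->
  Ccvg (fun k => INR (N k) * Sn (w / INR (N k))) (2 * PI * Ci * w).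
Proof.
  intros HN HL. set (c := Cmod (PI * Ci * w)).
  pose proof (Cmod_ge_0 (PI * Ci * w)) as Hc. fold c in Hc.
  destruct (proj1 (is_lim_seq_0_eps _ ltac:(intros n; apply Rmult_le_pos;
    [exact Hc|left; apply Rinv_0_lt_compat, lt_0_INR, HN]))
    (is_lim_seq_inv_0 N c HL) (/ 2)%R ltac:(lra)) as [K HK].
  unfold Ccvg. rewrite (is_lim_seq_incr_n _ K).
  pose proof (proj1 (is_lim_seq_incr_n _ K _) (is_lim_seq_inv_0 N (16 * (c * c)) HL)) as L.
  refine (is_lim_seq_0_le _ _ _ L). intros n. split; [apply Cmod_ge_0|].
  specialize (HK (n + K)%nat ltac:(lia)). set (m := N (n + K)%nat) in *.
  assert (Hm : (0 < INR m)%R) by (apply lt_0_INR, HN).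
  assert (Hm' : RtoC (INR m) <> 0) by (apply RtoC_neq0; lra).
  assert (E : Cmod (PI * Ci * (w / INR m)) = (c * / INR m)%R).
  { replace (PI * Ci * (w / INR m)) with (PI * Ci * w * / INR m) by (field; nzc).
    rewrite Cmod_mult, Cmod_inv, Cmod_R, Rabs_pos_eq by (auto; lra). reflexivity. }
  pose proof (Sn_linear (w / INR m)) as T. rewrite E in T. specialize (T ltac:(lra)).
  replace (INR m * Sn (w / INR m) - 2 * PI * Ci * w) with
    (INR m * (Sn (w / INR m) - 2 * PI * Ci * (w / INR m))) by (field; nzc).
  rewrite Cmod_mult, Cmod_R, Rabs_pos_eq by lra.
  apply Rle_trans with (INR m * (16 * (c * / INR m * (c * / INR m))))%R.
  - apply Rmult_le_compat_l; lra.
  - right. field. lra.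
Qed.

Lemma Cexp_Ci (t : R) : Cexp (Ci * t) = (cos t, sin t).
Proof.
  unfold Cexp; simpl. replace (0 * t - 1 * 0)%R with 0%R by ring.
  replace (0 * 0 + 1 * t)%R with t by ring.
  rewrite exp_0. f_equal; ring.
Qed.

(** A crude form of Jordan's inequality, which keeps the denominators Sn(j/N) of the finite sine
    product at least j/N and so provides the majorant 1/j^2. *)
Lemma Sn_real_lower (x : R) : (0 <= x <= / 2)%R -> (x <= Cmod (Sn x))%R.
Proof.
  intros Hx. pose proof PI_RGT_0 as HP. pose proof PI2_3_2 as HP'. unfold PI2 in HP'.
  assert (E : Sn x = 2 * Ci * sin (PI * x)).
  { unfold Sn, ee.
    replace (2 * PI * Ci * (x / 2)) with (Ci * (PI * x)%R)
      by (rewrite RtoC_mult; field; nzc).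
    replace (2 * PI * Ci * - (x / 2)) with (Ci * (- (PI * x))%R)
      by (rewrite RtoC_opp, RtoC_mult; field; nzc).
    rewrite !Cexp_Ci, cos_neg, sin_neg.
    apply injective_projections; simpl; ring. }
  rewrite E, !Cmod_mult, Cmod_Ci, !Cmod_R, (Rabs_pos_eq 2) by lra.
  enough (x / 2 <= sin (PI * x))%R by (rewrite Rabs_pos_eq; lra).
  set (t := (PI * x)%R).
  assert (Ht : (0 <= t <= PI / 2)%R) by (unfold t; split; nra).
  assert (PI <= 4)%R by apply PI_4.
  (* Since pi >= 3, t/3 exceeds x/2. As t^2 <= 4, the cubic Taylor term takes away at most 2t/3, and
     the terms of degree 5 and 7 are together nonnegative. *)
  apply Rle_trans with (t / 3)%R; [unfold t; nra|].
  pose proof (SIN t ltac:(lra) ltac:(lra)) as [T _].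
  assert (Elb : sin_lb t = (t - t * (t * t) / 6 + t * (t * t) * (t * t) / 120
                 - t * (t * t) * (t * t) * (t * t) / 5040)%R).
  { unfold sin_lb, sin_approx, sin_term. simpl. field. }
  rewrite Elb in T. set (u := (t * t)%R) in *.
  assert (U : (0 <= u <= 4)%R) by (unfold u; nra).
  assert (0 <= t * u <= 4 * t)%R by (split; nra).
  assert (0 <= t * u * u)%R by (apply Rmult_le_pos; lra).
  assert (0 <= t * u * u * u <= 4 * (t * u * u))%R by (split; nra).
  lra.
Qed.

(** Iterated duplication. The constant c is left undetermined here; it is eliminated in
    [sine_product] by comparison with one value of w. *)
Lemma Sn_dyadic (k : nat) :
  exists c : C, c <> 0 /\ forall w,
    Sn w = c * prodn (fun j => Sn ((w + INR j) / INR (2 ^ k))) (2 ^ k).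
Proof.
  induction k as [|k [c [Hc IH]]].
  - exists 1. split; [apply C1_nz|]. intros w. simpl.
    replace ((w + 0) / 1) with w by (field; nzc). ring.
  - set (N := (2 ^ k)%nat) in *.
    assert (HN : RtoC (INR N) <> 0).
    { apply RtoC_neq0, not_0_INR. apply Nat.pow_nonzero. lia. }
    assert (E2 : (2 ^ S k = N + N)%nat) by (simpl; fold N; lia).
    exists (c * (- Ci) ^ N). split.
    { apply Cmult_neq_0; auto. apply Cpow_nz. intros E. apply Ci_nz.
      replace Ci with (- - Ci) by ring. rewrite E. ring. }
    intros w. rewrite IH, E2, prodn_add, <- prodn_const, <- Cmult_assoc.
    f_equal. rewrite <- !prodn_mult. apply prodn_ext. intros j _.
    rewrite !plus_INR, !RtoC_plus.
    assert (HN2 : RtoC (INR N) + RtoC (INR N) <> 0).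
    { replace (RtoC (INR N) + RtoC (INR N)) with (2 * INR N) by ring.
      apply Cmult_neq_0; nzc. }
    replace ((w + INR j) / INR N) with (2 * ((w + INR j) / (INR N + INR N)))
      by (field; nzc).
    rewrite Sn_double. do 3 f_equal. field. nzc.
Qed.

(** With N = 2^(k+1), the two factors in front are the unpaired ones, at 0 and N/2. Each pair is
    divided by Sn(j/N)^2, so that it tends to 1 - w^2/j^2. *)
Definition sine_partial (w : C) (k : nat) : C :=
  Sn (w / INR (2 ^ S k)) * Sn (w / INR (2 ^ S k) + / 2)
  * prodn (fun j => 1 - (Sn (w / INR (2 ^ S k)) / Sn (INR (S j) / INR (2 ^ S k)))
                      * (Sn (w / INR (2 ^ S k)) / Sn (INR (S j) / INR (2 ^ S k))))
      (2 ^ k - 1).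

(* Pairing the factors j and N - j of the previous product. *)
Lemma Sn_paired (k : nat) :
  exists c : C, c <> 0 /\ forall w,
    Sn w = c * sine_partial w k.
Proof.
  destruct (Sn_dyadic (S k)) as [c [Hc IH]]. unfold sine_partial.
  set (N := (2 ^ S k)%nat) in *. set (H := (2 ^ k - 1)%nat).
  assert (EN : (N = S H + S H)%nat).
  { unfold N, H. simpl. pose proof (Nat.pow_nonzero 2 k ltac:(lia)). lia. }
  assert (HN : RtoC (INR N) <> 0).
  { apply RtoC_neq0, not_0_INR. lia. }
  assert (Hs : forall j, (j < H)%nat -> Sn (INR (S j) / INR N) <> 0).
  { intros j Hj. apply Cmod_gt_0. rewrite <- RtoC_div by (apply not_0_INR; lia).
    assert (0 < INR N)%R by (apply lt_0_INR; lia).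
    assert (0 < INR (S j))%R by (apply lt_0_INR; lia).
    apply Rlt_le_trans with (INR (S j) / INR N)%R; [now apply Rdiv_lt_0_compat|].
    apply Sn_real_lower. split; [left; now apply Rdiv_lt_0_compat|].
    apply Rmult_le_reg_r with (INR N); auto. unfold Rdiv.
    rewrite Rmult_assoc, Rinv_l, EN, plus_INR by lra.
    pose proof (le_INR (S j) (S H) ltac:(lia)). lra. }
  (* The test on j makes the factors nonzero at all indices, as [prodn_inv] asks. *)
  exists (c * prodn (fun j => if lt_dec j H then
     Sn (INR (S j) / INR N) * Sn (INR (S j) / INR N) else 1) H).
  split.
  { apply Cmult_neq_0; auto. apply prodn_inv. intros j.
    destruct (lt_dec j H); [|apply C1_nz]. now apply Cmult_neq_0; apply Hs. }
  intros w. rewrite IH.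
  replace (prodn (fun j => Sn ((w + INR j) / INR N)) N)
    with (prodn (fun j => Sn ((w + INR j) / INR N)) (S H + S H))
    by (f_equal; lia).
  rewrite prodn_add, !prodn_S_l.
  rewrite <- !Cmult_assoc. f_equal.
  rewrite Nat.add_0_r.
  replace ((w + INR 0) / INR N) with (w / INR N) by (simpl; field; nzc).
  replace ((w + INR (S H)) / INR N) with (w / INR N + / 2).
  2:{ rewrite EN, plus_INR, RtoC_plus. field.
      replace (RtoC (INR (S H)) + RtoC (INR (S H))) with (2 * INR (S H)) by ring.
      apply Cmult_neq_0; nzc. }
  (* Reversing the second half puts factor N - (j+1) opposite factor j+1; antiperiodicity turns its
     argument into (w - (j+1))/N. *)
  rewrite (prodn_rev (fun i => Sn ((w + INR (S H + S i)) / INR N))).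
  set (a := Sn (w / INR N)). set (b := Sn (w / INR N + / 2)).
  match goal with |- a * (?p * (b * ?q)) = ?r * (a * (b * ?t)) =>
    replace (a * (p * (b * q))) with (a * b * (p * q)) by ring;
    replace (r * (a * (b * t))) with (a * b * (r * t)) by ring end.
  f_equal. rewrite <- !prodn_mult. apply prodn_ext. intros j Hj.
  destruct (lt_dec j H); [|lia]. specialize (Hs j Hj).
  replace (Sn ((w + INR (S H + S (H - 1 - j))) / INR N))
    with (- Sn (w / INR N - INR (S j) / INR N)).
  2:{ rewrite <- Sn_plus_1. f_equal.
      assert (EI : INR (S H + S (H - 1 - j)) = (INR N - INR (S j))%R).
      { rewrite <- minus_INR by lia. f_equal. lia. }
      rewrite EI, RtoC_minus. field. nzc. }
  replace ((w + INR (S j)) / INR N) with (w / INR N + INR (S j) / INR N)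
    by (field; nzc).
  match goal with |- ?x * - ?y = _ => replace (x * - y) with (- (x * y)) by ring end.
  rewrite Sn_add_sub. fold a. field. auto.
Qed.

Lemma Ccvg_shift (K : nat) (u : nat -> C) (l : C) :
  Ccvg (fun n => u (n + K)%nat) l -> Ccvg u l.
Proof. intros H. unfold Ccvg. now rewrite (is_lim_seq_incr_n _ K). Qed.

Lemma filterlim_ge_id (phi : nat -> nat) :
  (forall k, (k <= phi k)%nat) -> filterlim phi eventually eventually.
Proof.
  intros H P [K HK]. exists K. intros n Hn. apply HK. specialize (H n). lia.
Qed.

Lemma pow2_gt (k : nat) : (k < 2 ^ k)%nat.
Proof. apply Nat.pow_gt_lin_r. lia. Qed.

Definition sine_factor (w : C) (j : nat) : C :=
  1 - w * w / (INR (S j) * INR (S j)).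

Lemma sine_factor_summable (w : C) :
  summable (fun j => Cmod (sine_factor w j - 1)).
Proof.
  refine (summable_le _ _ _ (summable_scal (Cmod (w * w)) _ (Cmod_ge_0 _) summable_inv_sq)).
  intros j. split; [apply Cmod_ge_0|]. unfold sine_factor.
  replace (1 - w * w / (INR (S j) * INR (S j)) - 1)
    with (- (w * w * / (INR (S j) * INR (S j)))) by (field; nzc).
  rewrite Cmod_opp, Cmod_mult, Cmod_inv, <- RtoC_mult, Cmod_R, Rabs_pos_eq.
  - lra.
  - pose proof (pos_INR (S j)). nra.
  - apply Cmult_neq_0; nzc.
Qed.

(** The two unpaired factors recombine to i Sn(2w/N), and N i Sn(2w/N) tends to i (2 pi i)(2w) = -4
    pi w. The paired factors are handled by [prodn_tannery] with a majorant B^2/j^2. *)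
Lemma Sn_scaled_product (w l : C) :
  Ccvg (prodn (sine_factor w)) l ->
  Ccvg (fun k => INR (2 ^ S k) * sine_partial w k) (- (4 * PI) * w * l).
Proof.
  intros Hl. unfold sine_partial.
  set (N := fun k => (2 ^ S k)%nat).
  assert (N0 : forall k, (0 < N k)%nat).
  { intros k. pose proof (pow2_gt (S k)). unfold N. lia. }
  assert (NL : filterlim N eventually eventually).
  { apply filterlim_ge_id. intros k. pose proof (pow2_gt (S k)). unfold N. lia. }
  assert (NC : forall k, RtoC (INR (N k)) <> 0).
  { intros k. apply RtoC_neq0, not_0_INR. specialize (N0 k). lia. }
  assert (A : forall v, Ccvg (fun k => INR (N k) * Sn (v / INR (N k))) (2 * PI * Ci * v)).
  { intros v. now apply Sn_scaled_limit. }
  assert (Hs : forall j k, (j < 2 ^ k - 1)%nat ->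
     (INR (S j) <= INR (N k) * Cmod (Sn (INR (S j) / INR (N k))))%R).
  { intros j k Hj. assert (P : (0 < INR (N k))%R) by apply lt_0_INR, N0.
    rewrite <- RtoC_div by lra.
    replace (INR (S j)) with (INR (N k) * (INR (S j) / INR (N k)))%R at 1 by (field; lra).
    apply Rmult_le_compat_l; [lra|]. apply Sn_real_lower.
    pose proof (pos_INR (S j)). split; [apply Rdiv_le_0_compat; lra|].
    apply Rmult_le_reg_r with (INR (N k)); auto. unfold Rdiv.
    rewrite Rmult_assoc, Rinv_l by lra.
    assert (EN : N k = (2 ^ k + 2 ^ k)%nat) by (unfold N; simpl; lia).
    rewrite EN, plus_INR. pose proof (le_INR (S j) (2 ^ k) ltac:(lia)). lra. }
  assert (Hs' : forall j k, (j < 2 ^ k - 1)%nat -> Sn (INR (S j) / INR (N k)) <> 0).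
  { intros j k Hj E. specialize (Hs j k Hj). rewrite E, Cmod_0 in Hs.
    pose proof (lt_0_INR (S j) ltac:(lia)). lra. }
  apply Ccvg_eq with (Ci * (2 * PI * Ci * (2 * w)) * l).
  { replace (Ci * (2 * PI * Ci * (2 * w)) * l) with ((Ci * Ci) * (4 * PI * w * l)) by ring.
    rewrite Ci2. ring. }
  apply Ccvg_ext with (fun k => Ci * (INR (N k) * Sn (2 * w / INR (N k))) *
     prodn (fun j => 1 - (Sn (w / INR (N k)) / Sn (INR (S j) / INR (N k)))
                         * (Sn (w / INR (N k)) / Sn (INR (S j) / INR (N k))))
        (2 ^ k - 1)).
  { intros k. fold (N k). replace (2 * w / INR (N k)) with (2 * (w / INR (N k)))
      by (field; apply NC).
    rewrite Sn_double. set (P := prodn _ _).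
    match goal with |- Ci * (?n * (- Ci * ?s)) * P = _ =>
      replace (Ci * (n * (- Ci * s)) * P) with (- (Ci * Ci) * (n * (s * P))) by ring end.
    rewrite Ci2. ring. }
  apply Ccvg_mult; [apply Ccvg_scal, A|].
  (* The majorant must hold at every index, so the first K indices, where N |Sn(w/N)| may still
     exceed B, are dropped. *)
  destruct (Ccvg_bounded _ _ (A w)) as [K HK].
  set (B := (Cmod (2 * PI * Ci * w) + 1)%R) in *.
  assert (B0 : (0 <= B)%R) by (pose proof (Cmod_ge_0 (2 * PI * Ci * w)); unfold B; lra).
  apply (Ccvg_shift K).
  refine (prodn_tannery _ _ _ (fun k => (2 ^ (k + K) - 1)%nat) l
    (summable_scal (B * B) _ ltac:(nra) summable_inv_sq) _ _ _ Hl).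
  - apply filterlim_ge_id. intros k. pose proof (pow2_gt (k + K)). lia.
  - intros n j Hj. set (k := (n + K)%nat) in *. specialize (HK k ltac:(unfold k; lia)).
    specialize (Hs j k Hj). specialize (Hs' j k Hj).
    rewrite Cmod_mult, Cmod_R, Rabs_pos_eq in HK by apply pos_INR.
    set (m := INR (N k)) in *. assert (Pm : (0 < m)%R) by apply lt_0_INR, N0.
    set (a := Sn (w / m)) in *. set (b := Sn (INR (S j) / m)) in *.
    replace (1 - a / b * (a / b) - 1) with (- (a / b * (a / b))) by ring.
    rewrite Cmod_opp, Cmod_mult, Cmod_div by auto.
    assert (Pj : (0 < INR (S j))%R) by (apply lt_0_INR; lia).
    assert (Q : (0 <= Cmod a / Cmod b <= B / INR (S j))%R).
    { pose proof (Cmod_ge_0 a). apply Cmod_gt_0 in Hs'.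
      split; [apply Rdiv_le_0_compat; auto|].
      replace (Cmod a / Cmod b)%R with ((m * Cmod a) * / (m * Cmod b))%R by (field; lra).
      apply Rmult_le_compat; try nra.
      - left. apply Rinv_0_lt_compat. nra.
      - apply Rinv_le_contravar; auto. }
    replace (B * B * / (INR (S j) * INR (S j)))%R with
      (B / INR (S j) * (B / INR (S j)))%R by (field; lra).
    apply Rmult_le_compat; lra.
  - intros j.
    assert (L : Ccvg (fun k => Sn (w / INR (N k)) / Sn (INR (S j) / INR (N k)))
                     (w / INR (S j))).
    { apply Ccvg_eq with (2 * PI * Ci * w / (2 * PI * Ci * INR (S j))); [field; nzc|].
      apply Ccvg_ext_loc with (S j) (fun k => (INR (N k) * Sn (w / INR (N k)))
         / (INR (N k) * Sn (INR (S j) / INR (N k)))).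
      - intros k Hk. field. split; [|apply NC]. apply Hs'.
        pose proof (pow2_gt k). lia.
      - apply Ccvg_div; auto. repeat apply Cmult_neq_0; nzc. }
    apply (Ccvg_subseq (fun n => (n + K)%nat) (fun k =>
      1 - Sn (w / INR (N k)) / Sn (INR (S j) / INR (N k)) *
         (Sn (w / INR (N k)) / Sn (INR (S j) / INR (N k))))).
    { apply filterlim_ge_id. intros; lia. }
    unfold sine_factor. apply Ccvg_minus; [apply Ccvg_const|].
    replace (w * w / (INR (S j) * INR (S j))) with ((w / INR (S j)) * (w / INR (S j)))
      by (field; nzc).
    now apply Ccvg_mult.
Qed.

(* kappa is 2 pi i, but only its independence of w matters. *)
Lemma sine_product :
  exists kappa : C, kappa <> 0 /\
    forall w, Ccvg (fun M => kappa * w * prodn (sine_factor w) M) (Sn w).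
Proof.
  (* The value at w = 1/2, where the sine does not vanish, eliminates the unknown constants: Sn w /
     Sn(1/2) is a ratio of partial products for every k. *)
  destruct (prodn_cvg _ (sine_factor_summable (/ 2))) as [l0 Hl0].
  set (T := fun w k => INR (2 ^ S k) * sine_partial w k).
  assert (HT : forall k, exists c : C, forall w, Sn w = c * T w k).
  { intros k. destruct (Sn_paired k) as [c [_ Hc]].
    exists (c / INR (2 ^ S k)). intros w. rewrite Hc. unfold T. field.
    apply RtoC_neq0, not_0_INR, Nat.pow_nonzero. lia. }
  assert (S2 : Sn (/ 2) <> 0).
  { replace (/ 2) with (0 + / 2) by ring. rewrite Sn_plus_half.
    replace (0 / 2) with (RtoC 0) by (field; nzc). rewrite ee_opp, ee_0.
    apply Cmult_neq_0; [nzc|]. replace (1 + / 1) with (RtoC 2) by (field; nzc). nzc. }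
  assert (L0 : l0 <> 0).
  { apply (prodn_cvg_neq0 _ _ (sine_factor_summable (/ 2))); auto.
    intros j E. unfold sine_factor in E.
    assert (E2 : RtoC (4 * (INR (S j) * INR (S j)) - 1)%R = 0).
    { rewrite RtoC_minus, !RtoC_mult.
      replace (4 * (INR (S j) * INR (S j)) - 1) with
        (4 * (INR (S j) * INR (S j)) * (1 - / 2 * / 2 / (INR (S j) * INR (S j))))
        by (field; nzc). rewrite E. ring. }
    apply RtoC_inj in E2. pose proof (pos_INR j). rewrite S_INR in E2. nra. }
  pose proof (Sn_scaled_product _ _ Hl0) as HL0. fold (T (/ 2)) in HL0.
  set (t := - (4 * PI) * / 2 * l0) in *.
  assert (t0 : t <> 0).
  { unfold t. replace (- (4 * PI) * / 2 * l0) with ((- (2)) * (PI * l0)) by (field; nzc).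
    repeat apply Cmult_neq_0; nzc. rewrite <- RtoC_opp. nzc. }
  exists (Sn (/ 2) / t * (- (4 * PI))). split.
  { repeat apply Cmult_neq_0; nzc.
    - intros E. apply t0. replace t with (t * (t * / t)) by (field; auto). rewrite E. ring.
    - rewrite <- RtoC_mult, <- RtoC_opp. apply RtoC_neq0. pose proof PI_RGT_0. lra. }
  intros w. destruct (prodn_cvg _ (sine_factor_summable w)) as [l Hl].
  apply Ccvg_eq with (Sn (/ 2) / t * (- (4 * PI)) * w * l); [|now apply Ccvg_scal].
  apply (Ccvg_unique (fun k => Sn (/ 2) / T (/ 2) k * T w k)).
  - apply Ccvg_eq with (Sn (/ 2) / t * (- (4 * PI) * w * l)); [field; nzc|].
    apply Ccvg_mult; [|now apply Sn_scaled_product].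
    apply Ccvg_div; auto. apply Ccvg_const.
  - apply Ccvg_ext with (fun _ => Sn w); [|apply Ccvg_const].
    intros k. destruct (HT k) as [c Hc]. rewrite (Hc w), (Hc (/ 2)).
    field. intros E. apply S2. rewrite (Hc (/ 2)), E. ring.
Qed.

(** * The theta quotient and its quasi-periods *)

Definition qpoch (v t : C) : C := qpoch_inf (ee v) (ee t).

Definition in_lattice (t v : C) : Prop := exists m n : Z, v = IZR m + IZR n * t.

Lemma Cmod_ee_lt_1 (t : C) : (0 < Im t)%R -> (Cmod (ee t) < 1)%R.
Proof.
  intros H. rewrite Cmod_ee, <- exp_0. apply exp_increasing.
  pose proof PI_RGT_0. nra.
Qed.

Lemma qpoch_summable (v t : C) : (0 < Im t)%R ->
  summable (fun n => Cmod (1 - ee v * ee t ^ n - 1)).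
Proof.
  intros H. pose proof (Cmod_ee_lt_1 t H). pose proof (Cmod_ge_0 (ee t)).
  refine (summable_le _ _ _ (summable_scal (Cmod (ee v)) _ (Cmod_ge_0 _)
    (summable_geom (Cmod (ee t)) ltac:(lra)))).
  intros n. split; [apply Cmod_ge_0|].
  replace (1 - ee v * ee t ^ n - 1) with (- (ee v * ee t ^ n)) by ring.
  rewrite Cmod_opp, Cmod_mult, Cmod_pow. lra.
Qed.

Lemma qpoch_cvg (v t : C) : (0 < Im t)%R ->
  Ccvg (prodn (fun n => 1 - ee v * ee t ^ n)) (qpoch v t).
Proof.
  intros H. destruct (prodn_cvg _ (qpoch_summable v t H)) as [l Hl].
  unfold qpoch, qpoch_inf. now rewrite (Cprod_inf_cvg _ _ Hl).
Qed.

Lemma Ccvg_S (u : nat -> C) (l : C) : Ccvg u l -> Ccvg (fun n => u (S n)) l.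
Proof.
  intros H. apply (Ccvg_subseq S u); auto. apply filterlim_ge_id. intros; lia.
Qed.

Lemma qpoch_shift (v t : C) : (0 < Im t)%R -> qpoch v t = (1 - ee v) * qpoch (v + t) t.
Proof.
  intros H. apply (Ccvg_unique (fun n => prodn (fun n => 1 - ee v * ee t ^ n) (S n))).
  - apply (Ccvg_S (prodn _)). now apply qpoch_cvg.
  - eapply Ccvg_ext; [|apply Ccvg_scal, qpoch_cvg; exact H].
    intros n. cbv beta. rewrite prodn_S_l. f_equal; [simpl; ring|].
    apply prodn_ext. intros i _. rewrite ee_plus. simpl. ring.
Qed.

Lemma qpoch_plus_Z (v t : C) (k : Z) : qpoch (v + IZR k) t = qpoch v t.
Proof. unfold qpoch. now rewrite ee_plus_Z. Qed.

Lemma qpoch_tau_plus_Z (v t : C) (k : Z) : qpoch v (t + IZR k) = qpoch v t.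
Proof. unfold qpoch. now rewrite ee_plus_Z. Qed.

Lemma qpoch_eq0 (v t : C) (n : nat) (k : Z) :
  (0 < Im t)%R -> v + INR n * t = IZR k -> qpoch v t = 0.
Proof.
  intros H E. apply (Ccvg_unique _ _ _ (qpoch_cvg v t H)).
  apply Ccvg_ext_loc with (S n) (fun _ => RtoC 0); [|apply Ccvg_const].
  intros i Hi. symmetry. apply prodn_eq0 with n; [lia|].
  rewrite <- ee_nat, <- ee_plus, E, ee_Z. ring.
Qed.

Lemma qpoch_neq0 (v t : C) :
  (0 < Im t)%R -> (forall (n : nat) (k : Z), v + INR n * t <> IZR k) -> qpoch v t <> 0.
Proof.
  intros H Hv. apply (prodn_cvg_neq0 _ _ (qpoch_summable v t H)); [|now apply qpoch_cvg].
  intros n E. destruct (ee_eq_1 (v + INR n * t)) as [k Hk]; [|now apply (Hv n k)].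
  rewrite ee_plus, ee_nat.
  replace (ee v * ee t ^ n) with (1 - (1 - ee v * ee t ^ n)) by ring.
  rewrite E. ring.
Qed.

Lemma qpoch_tau_neq0 (t : C) : (0 < Im t)%R -> qpoch t t <> 0.
Proof.
  intros H. apply qpoch_neq0; auto. intros n k E.
  assert (E2 : Im (t + INR n * t) = 0%R) by (rewrite E; reflexivity).
  destruct t as [x y]. simpl in *. pose proof (pos_INR n). nra.
Qed.

(* The quotient of the odd Jacobi theta function by the cube of eta. *)
Definition theta_quot (v t : C) : C :=
  - ee (- (v / 2)) * (qpoch v t * qpoch (t - v) t) / (qpoch t t * qpoch t t).

Lemma theta_quot_plus_1 (v t : C) : theta_quot (v + 1) t = - theta_quot v t.
Proof.
  unfold theta_quot. rewrite (qpoch_plus_Z v t 1 : qpoch (v + 1) t = _).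
  replace (t - (v + 1)) with ((t - v) + IZR (-1)) by ring.
  rewrite qpoch_plus_Z. replace (- ((v + 1) / 2)) with (- (v / 2) + - / 2) by (field; nzc).
  rewrite ee_plus, (ee_opp (/ 2)), ee_half.
  replace (/ - (1)) with (- (1)) by (field; rewrite <- RtoC_opp; nzc).
  unfold Cdiv. ring.
Qed.

Lemma theta_quot_opp (v t : C) : (0 < Im t)%R -> theta_quot (- v) t = - theta_quot v t.
Proof.
  intros H. unfold theta_quot. rewrite (qpoch_shift v), (qpoch_shift (- v)) by auto.
  replace (t - - v) with (v + t) by ring. replace (- v + t) with (t - v) by ring.
  replace (- (- v / 2)) with (v / 2) by (field; nzc).
  replace (- v) with (- (v / 2) + - (v / 2)) by (field; nzc).
  replace (ee v) with (ee (v / 2 + v / 2)) by (f_equal; field; nzc).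
  rewrite !ee_plus, !ee_opp. pose proof (ee_neq0 (v / 2)).
  pose proof (qpoch_tau_neq0 t H). field. auto.
Qed.

Lemma theta_quot_plus_tau (v t : C) : (0 < Im t)%R ->
  theta_quot (v + t) t = - ee (- v - t / 2) * theta_quot v t.
Proof.
  intros H. unfold theta_quot. rewrite (qpoch_shift v) by auto.
  replace (t - (v + t)) with (- v) by ring. rewrite (qpoch_shift (- v)) by auto.
  replace (- v + t) with (t - v) by ring.
  replace (- ((v + t) / 2)) with (- (v / 2) + - (t / 2)) by (field; nzc).
  replace (- v - t / 2) with (- (v / 2) + - (v / 2) + - (t / 2)) by (field; nzc).
  replace (- v) with (- (v / 2) + - (v / 2)) by (field; nzc).
  replace (ee v) with (ee (v / 2 + v / 2)) by (f_equal; field; nzc).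
  rewrite !ee_plus, !ee_opp. pose proof (ee_neq0 (v / 2)). pose proof (ee_neq0 (t / 2)).
  pose proof (qpoch_tau_neq0 t H). field. auto.
Qed.

Lemma theta_quot_eq0 (v t : C) : (0 < Im t)%R -> in_lattice t v -> theta_quot v t = 0.
Proof.
  intros H [m [n E]]. unfold theta_quot.
  enough (qpoch v t * qpoch (t - v) t = 0) as -> by (unfold Cdiv; ring).
  destruct (Z_le_gt_dec n 0) as [Hn|Hn].
  - rewrite (qpoch_eq0 v t (Z.to_nat (- n)) m); auto; [ring|].
    rewrite INR_IZR_INZ, Z2Nat.id, E, opp_IZR, RtoC_opp by lia. ring.
  - rewrite (qpoch_eq0 (t - v) t (Z.to_nat (n - 1)) (- m)); auto; [ring|].
    rewrite INR_IZR_INZ, Z2Nat.id, E, minus_IZR, RtoC_minus, opp_IZR, RtoC_opp by lia.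
    ring.
Qed.

Lemma theta_quot_neq0 (v t : C) : (0 < Im t)%R -> ~ in_lattice t v -> theta_quot v t <> 0.
Proof.
  intros H Hv. pose proof (qpoch_tau_neq0 t H) as H0. unfold theta_quot.
  pose proof (ee_neq0 (- (v / 2))) as He. set (e := ee (- (v / 2))) in *.
  unfold Cdiv. repeat apply Cmult_neq_0.
  - intros E. apply He. replace e with (- - e) by ring. rewrite E. ring.
  - apply qpoch_neq0; auto. intros n k E. apply Hv. exists k, (- Z.of_nat n)%Z.
    rewrite opp_IZR, <- INR_IZR_INZ, RtoC_opp, <- E. ring.
  - apply qpoch_neq0; auto. intros n k E. apply Hv. exists (- k)%Z, (1 + Z.of_nat n)%Z.
    rewrite opp_IZR, RtoC_opp, <- E, plus_IZR, <- INR_IZR_INZ, RtoC_plus. ring.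
  - intros E. apply (Cmult_neq_0 _ _ H0 H0).
    set (x := qpoch t t * qpoch t t) in *.
    destruct (Ceq_dec x 0) as [|Hx]; auto.
    exfalso. apply C1_nz. rewrite <- (Cinv_r x Hx), E. ring.
Qed.

(** Theta as a product over the rows Z + n t of the lattice: rows n and -n contribute a ratio of
    sines, in which the exponential prefactors from [Sn_eq_ee] cancel. *)
Lemma Sn_ratio_cvg (v t : C) : (0 < Im t)%R ->
  Ccvg (fun N => Sn v * prodn (fun n => Sn (INR (S n) * t + v) * Sn (INR (S n) * t - v)
          / (Sn (INR (S n) * t) * Sn (INR (S n) * t))) N) (theta_quot v t).
Proof.
  intros H. pose proof (qpoch_tau_neq0 t H) as H0.
  unfold theta_quot. apply Ccvg_ext with (fun N => - ee (- (v / 2)) *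
    (prodn (fun n => 1 - ee v * ee t ^ n) (S N) * prodn (fun n => 1 - ee (t - v) * ee t ^ n) N)
    / (prodn (fun n => 1 - ee t * ee t ^ n) N * prodn (fun n => 1 - ee t * ee t ^ n) N)).
  2:{ apply Ccvg_div; [now apply Cmult_neq_0| |apply Ccvg_mult; now apply qpoch_cvg].
      apply Ccvg_scal, Ccvg_mult; [|now apply qpoch_cvg].
      apply (Ccvg_S (prodn _)). now apply qpoch_cvg. }
  assert (Hf : forall n, 1 - ee t * ee t ^ n <> 0).
  { intros n E. apply H0. destruct (ee_eq_1 (t + INR n * t)) as [k Hk].
    - rewrite ee_plus, ee_nat.
      replace (ee t * ee t ^ n) with (1 - (1 - ee t * ee t ^ n)) by ring. rewrite E. ring.
    - now apply (qpoch_eq0 t t n k). }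
  intros N. destruct (prodn_inv _ N Hf) as [I1 I2].
  set (D := prodn (fun n => 1 - ee t * ee t ^ n) N) in *.
  match goal with |- ?x / _ = _ =>
    replace (x / (D * D)) with (x * (/ D * / D)) by (field; auto) end.
  rewrite <- I1.
  rewrite prodn_S_l, Sn_eq_ee.
  replace (1 - ee v * ee t ^ 0) with (1 - ee v) by (simpl; ring).
  rewrite <- !Cmult_assoc. f_equal. f_equal.
  rewrite <- !prodn_mult. apply prodn_ext. intros n _.
  assert (Ew : ee (INR (S n) * t) = ee t * ee t ^ n) by (rewrite ee_nat; reflexivity).
  set (w := INR (S n) * t) in *.
  rewrite !Sn_eq_ee, (ee_plus w v).
  replace (ee (w - v)) with (ee w * / ee v) by (unfold Cminus; now rewrite ee_plus, ee_opp).
  replace (ee (t - v)) with (ee t * / ee v) by (unfold Cminus; now rewrite ee_plus, ee_opp).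
  rewrite Ew.
  replace (- ((w + v) / 2)) with (- (w / 2) + - (v / 2)) by (field; nzc).
  replace (- ((w - v) / 2)) with (- (w / 2) + (v / 2)) by (field; nzc).
  rewrite !ee_plus, !ee_opp.
   pose proof (ee_neq0 (w / 2)). pose proof (ee_neq0 (v / 2)).
  pose proof (ee_neq0 v). simpl Cpow. field. repeat split; auto.
Qed.

Lemma lattice_form_lower (t : C) : (0 < Im t)%R ->
  exists c, (0 < c)%R /\ forall x y : R,
    (c * (x * x + y * y) <= Cmod (x + y * t) * Cmod (x + y * t))%R.
Proof.
  destruct t as [s h]. simpl. intros H.
  (* From x^2 <= 2 (x + y s)^2 + 2 (y s)^2; the remaining (2 s^2 + 1) y^2 is paid for by the
     multiple of (y h)^2. *)
  set (K := (2 + (2 * (s * s) + 1) / (h * h))%R).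
  assert (Q : (0 < (2 * (s * s) + 1) / (h * h))%R) by (apply Rdiv_lt_0_compat; nra).
  exists (/ K)%R. split; [apply Rinv_0_lt_compat; unfold K; lra|]. intros x y.
  replace (Cmod (x + y * (s, h)) * Cmod (x + y * (s, h)))%R
    with ((x + y * s) * (x + y * s) + y * h * (y * h))%R.
  2:{ pose proof (Cmod2_alt (x + y * (s, h))) as E. simpl in E.
      simpl. rewrite <- (Rmult_1_r (Cmod _)) at 2. rewrite E. simpl. ring. }
  apply Rmult_le_reg_l with K; [unfold K; lra|].
  rewrite <- Rmult_assoc, Rinv_r, Rmult_1_l by (unfold K; lra).
  assert (E : (K * ((x + y * s) * (x + y * s) + y * h * (y * h)) =
    2 * ((x + y * s) * (x + y * s)) + 2 * (y * h * (y * h))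
    + (2 * (s * s) + 1) / (h * h) * ((x + y * s) * (x + y * s))
    + (2 * (s * s) + 1) * (y * y))%R) by (unfold K; field; lra).
  rewrite E.
  assert (0 <= (2 * (s * s) + 1) / (h * h) * ((x + y * s) * (x + y * s)))%R
    by (apply Rmult_le_pos; [lra|apply Rle_0_sqr]).
  pose proof (Rle_0_sqr (x + y * s + y * s)) as S1.
  pose proof (Rle_0_sqr (y * h)) as S2. unfold Rsqr in S1, S2.
    lra.
Qed.

(** * Modular inversion of the theta quotient *)

(* The product of 1 - a / w^2 over the two lattice points w = (m+1) +- (n+1) t,
   up to sign. *)
Definition pair_factor (t a : C) (m n : nat) : C :=
  (1 - a / ((INR (S m) + INR (S n) * t) * (INR (S m) + INR (S n) * t)))
  * (1 - a / ((INR (S m) - INR (S n) * t) * (INR (S m) - INR (S n) * t))).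

Lemma lattice_point_eq0 (t : C) (x y : R) :
  (0 < Im t)%R -> x + y * t = 0 -> (x = 0 /\ y = 0)%R.
Proof.
  intros H E. destruct t as [s h]. simpl in H.
  assert (E1 : Re (x + y * (s, h)) = 0%R) by (rewrite E; reflexivity).
  assert (E2 : Im (x + y * (s, h)) = 0%R) by (rewrite E; reflexivity).
  simpl in E1, E2.
  assert (y = 0)%R by nra. subst y. split; lra.
Qed.

Lemma Cmult_integral (a b : C) : a * b = 0 -> a = 0 \/ b = 0.
Proof.
  intros H. destruct (Ceq_dec a 0) as [|Ha]; auto. right.
  destruct (Ceq_dec b 0) as [|Hb]; auto. exfalso. now apply (Cmult_neq_0 a b).
Qed.

Lemma upper_neq0 (t : C) : (0 < Im t)%R -> t <> 0.
Proof. intros H E. subst t. simpl in H. lra. Qed.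

Lemma INR_S_IZR (n : nat) : INR (S n) = IZR (Z.of_nat (S n)).
Proof. apply INR_IZR_INZ. Qed.

(** The sine product at w + u, w - u and w, with w = (n+1) t, evaluates one row. [pair_factor] omits
    the lattice points with a zero coordinate: the column m = 0 is the divisor 1 - u^2/w^2, whose
    product over n is a sine in u/t, and the row n = 0 accounts for Sn u. The row limits are nonzero
    so that quotients of them can be formed. *)
Lemma row_products (kappa t u : C) :
  kappa <> 0 ->
  (forall w, Ccvg (fun M => kappa * w * prodn (sine_factor w) M) (Sn w)) ->
  (0 < Im t)%R -> ~ in_lattice t u ->
  exists R : nat -> C,
    (forall n, Ccvg (prodn (fun m => pair_factor t (u * u) m n)) (R n))
    /\ (forall n, R n <> 0)
    /\ Ccvg (prodn R) (theta_quot u t * (kappa * u) / (t * (Sn u * Sn (u / t)))).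
Proof.
  intros Hk Hs Ht Hu. pose proof (upper_neq0 t Ht) as Ht0.
  assert (Hu' : forall x y : Z, u <> IZR x + IZR y * t).
  { intros x y E. apply Hu. now exists x, y. }
  assert (U0 : u <> 0).
  { intros E. apply (Hu' 0%Z 0%Z). rewrite E. ring. }
  assert (SU : Sn u <> 0).
  { intros E. apply Sn_eq0 in E as [k E]. apply (Hu' k 0%Z). rewrite E. ring. }
  assert (SUt : Sn (u / t) <> 0).
  { intros E. apply Sn_eq0 in E as [k E]. apply (Hu' 0%Z k).
    replace u with (u / t * t) by (field; auto). rewrite E. ring. }
  set (w := fun n : nat => INR (S n) * t).
  assert (W0 : forall n, w n <> 0) by (intros n; apply Cmult_neq_0; nzc).
  assert (Wm : forall n, w n - u <> 0).
  { intros n E. apply (Hu' 0%Z (Z.of_nat (S n))). rewrite <- INR_S_IZR.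
    replace u with (w n - (w n - u)) by ring. rewrite E. unfold w. ring. }
  assert (Wp : forall n, w n + u <> 0).
  { intros n E. apply (Hu' 0%Z (- Z.of_nat (S n))%Z).
    rewrite opp_IZR, <- INR_S_IZR, RtoC_opp.
    replace u with ((w n + u) - w n) by ring. rewrite E. unfold w. ring. }
  assert (Wint : forall n (k : R), w n + k <> 0).
  { intros n k E. destruct (lattice_point_eq0 t k (INR (S n)) Ht) as [_ E'].
    - rewrite <- E. unfold w. ring.
    - now apply (INR_S_neq0 n); rewrite E'. }
  assert (SW : forall n, Sn (w n) <> 0).
  { intros n E. apply Sn_eq0 in E as [k E]. apply (Wint n (- IZR k)%R).
    rewrite E, RtoC_opp. ring. }
  assert (SWm : forall n, Sn (w n - u) <> 0).
  { intros n E. apply Sn_eq0 in E as [k E].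
    apply (Hu' (- k)%Z (Z.of_nat (S n))). rewrite <- INR_S_IZR, opp_IZR, RtoC_opp, <- E.
    unfold w. ring. }
  assert (SWp : forall n, Sn (w n + u) <> 0).
  { intros n E. apply Sn_eq0 in E as [k E].
    apply (Hu' k (- Z.of_nat (S n))%Z). rewrite opp_IZR, <- INR_S_IZR, RtoC_opp, <- E.
    unfold w. ring. }
  assert (B0 : forall n, 1 - u * u / (w n * w n) <> 0).
  { intros n E. apply (Cmult_neq_0 _ _ (Wp n) (Wm n)).
    replace ((w n + u) * (w n - u)) with ((w n * w n) * (1 - u * u / (w n * w n)))
      by (field; auto). rewrite E. ring. }
  assert (SF : forall n m, sine_factor (w n) m <> 0).
  { intros n m E. apply (Cmult_neq_0 _ _ (Wint n (INR (S m))) (Wint n (- INR (S m))%R)).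
    replace ((w n + INR (S m)) * (w n + (- INR (S m))%R)) with
      (- (INR (S m) * INR (S m)) * sine_factor (w n) m); [rewrite E; ring|].
    unfold sine_factor. rewrite RtoC_opp. field. nzc. }
  set (q := fun n => Sn (w n + u) * Sn (w n - u) / (Sn (w n) * Sn (w n))).
  exists (fun n => q n / (1 - u * u / (w n * w n))). split; [|split].
  - intros n.
    apply Ccvg_ext with (fun M =>
      ((kappa * (w n + u) * prodn (sine_factor (w n + u)) M)
       * (kappa * (w n - u) * prodn (sine_factor (w n - u)) M)
       / ((kappa * w n * prodn (sine_factor (w n)) M)
          * (kappa * w n * prodn (sine_factor (w n)) M))) / (1 - u * u / (w n * w n))).
    2:{ apply Ccvg_div; [auto| |apply Ccvg_const].
        apply Ccvg_div; [now apply Cmult_neq_0| |]; apply Ccvg_mult; apply Hs. }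
    intros M. destruct (prodn_inv _ M (SF n)) as [I1 I2].
    set (D := prodn (sine_factor (w n)) M) in *.
    assert (E : prodn (fun m => pair_factor t (u * u) m n) M =
      prodn (sine_factor (w n + u)) M * prodn (sine_factor (w n - u)) M * (/ D * / D)).
    { rewrite <- I1, <- !prodn_mult. apply prodn_ext. intros m _.
      unfold pair_factor.  unfold sine_factor in *. fold (w n).
      pose proof (Wint n (INR (S m))) as P1. pose proof (Wint n (- INR (S m))%R) as P2.
      rewrite RtoC_opp in P2.
      pose proof (INR_S_neq0 m) as P3.
      set (x := w n) in *. set (k := RtoC (INR (S m))) in *.
      assert (P4 : k + x <> 0) by (now rewrite Cplus_comm).
      assert (P5 : k - x <> 0).
      { intros E. apply P2. replace (x + - k) with (- (k - x)) by ring. rewrite E. ring. }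
      assert (P6 : k * k - x * x <> 0).
      { replace (k * k - x * x) with ((k + x) * (k - x)) by ring. now apply Cmult_neq_0. }
      field. repeat split; auto. }
    rewrite E.
    field. repeat split; auto.
    intros E'. apply (Cmult_neq_0 _ _ (Wp n) (Wm n)). rewrite <- E'. ring.
  - intros n. unfold q, Cdiv. repeat apply Cmult_neq_0; auto.
    + intros E. apply (Cmult_neq_0 _ _ (SW n) (SW n)).
      set (x := Sn (w n) * Sn (w n)) in *. destruct (Ceq_dec x 0) as [|Hx]; auto.
      exfalso. apply C1_nz. rewrite <- (Cinv_r x Hx), E. ring.
    + intros E. set (x := 1 - u * u * / (w n * w n)) in *.
      apply C1_nz. rewrite <- (Cinv_r x (B0 n)), E. ring.
  - apply Ccvg_ext with (fun N => (Sn u * prodn q N) * (kappa * u)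
       / (t * (Sn u * (kappa * (u / t) * prodn (sine_factor (u / t)) N)))).
    2:{ apply Ccvg_div; [repeat apply Cmult_neq_0; auto| |].
        - apply Ccvg_mult; [|apply Ccvg_const]. exact (Sn_ratio_cvg u t Ht).
        - apply Ccvg_scal, Ccvg_scal, Hs. }
    intros N.
    change (prodn (fun n => q n / (1 - u * u / (w n * w n))) N)
      with (prodn (fun n => q n * / (1 - u * u / (w n * w n))) N).
    rewrite prodn_mult.
    destruct (prodn_inv _ N B0) as [-> I2].
    replace (prodn (sine_factor (u / t)) N) with (prodn (fun n => 1 - u * u / (w n * w n)) N).
    2:{ apply prodn_ext. intros n _. unfold sine_factor, w. field. split; nzc. }
    field. repeat split; auto.
Qed.

Lemma prodn_limit (x : nat -> nat -> C) (y : nat -> C) (k : nat) :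
  (forall i, Ccvg (fun N => x N i) (y i)) -> Ccvg (fun N => prodn (x N) k) (prodn y k).
Proof.
  intros H. induction k as [|k IH]; simpl; [apply Ccvg_const|].
  now apply Ccvg_mult.
Qed.

(** The majorant 1/(m^2 n^2) makes the partial products over M x N rectangles close to their limit
    in M uniformly in N; iterated limits then agree as in the Moore-Osgood theorem. *)
Lemma double_product_interchange (d : nat -> nat -> C) (B : R) (rho sig : nat -> C)
  (r s : C) :
  (0 <= B)%R ->
  (forall m n, Cmod (d m n - 1)
     <= B * (/ (INR (S m) * INR (S m)) * / (INR (S n) * INR (S n))))%R ->
  (forall n, Ccvg (prodn (fun m => d m n)) (rho n)) -> Ccvg (prodn rho) r ->
  (forall m, Ccvg (prodn (d m)) (sig m)) -> Ccvg (prodn sig) s ->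
  r = s.
Proof.
  intros HB Hd Hrho Hr Hsig Hs.
  pose proof summable_inv_sq as Hq. destruct Hq as [Q0 [Q HQ]].
  set (q := fun i => (/ (INR (S i) * INR (S i)))%R) in *.
  assert (HQ0 : (0 <= Q)%R) by (pose proof (HQ 0%nat); simpl in *; lra).
  set (F := fun M N => prodn (fun m => prodn (d m) N) M).
  assert (row : forall m N, (Cmod (prodn (d m) N - 1) <= exp (B * Q) * (B * Q) * q m)%R
                            /\ (Cmod (prodn (d m) N) <= exp (B * Q * q m))%R).
  { intros m N.
    assert (E : (rsum (fun n => Cmod (d m n - 1)) N <= B * Q * q m)%R).
    { eapply Rle_trans; [apply (rsum_le _ (fun n => (B * q m) * q n)%R)|].
      - intros i _. eapply Rle_trans; [apply Hd|]. unfold q. lra.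
      - rewrite rsum_scal. specialize (HQ N). specialize (Q0 m). fold (q m) in Q0.
        assert (0 <= B * q m)%R by nra. nra. }
    assert (q1 : (q m <= 1)%R).
    { unfold q. rewrite <- Rinv_1. apply Rinv_le_contravar; [lra|].
      rewrite S_INR. pose proof (pos_INR m). nra. }
     fold (q m) in Q0.
    pose proof (rsum_ge0 (fun n => Cmod (d m n - 1)) N ltac:(intros; apply Cmod_ge_0)) as P.
    assert (0 <= B * Q)%R by nra.
    split.
    - eapply Rle_trans; [apply prodn_minus1|]. cbv beta in *.
      rewrite Rmult_assoc.
      apply Rmult_le_compat; auto; [left; apply exp_pos|apply exp_le; nra].
    - eapply Rle_trans; [apply (prodn_Cmod_le _ (fun n => Cmod (d m n - 1)))|].
      + intros i _. apply Cmod_le_minus1. lra.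
      + now apply exp_le. }
  set (K := (exp (B * Q) * (B * Q))%R) in *.
  assert (K0 : (0 <= K)%R).
  { unfold K. apply Rmult_le_pos; [left; apply exp_pos|nra]. }
  assert (FB : forall M N, (Cmod (F M N) <= exp (K * Q))%R).
  { intros M N. eapply Rle_trans; [apply (prodn_Cmod_le _ (fun m => K * q m)%R)|].
    - intros i _. apply Cmod_le_minus1. apply row.
    - apply exp_le. rewrite rsum_scal. apply Rmult_le_compat_l; auto. }
  assert (tail : forall M N k, (Cmod (F (M + k)%nat N - F M N) <=
      exp (K * Q) * (exp (K * Q) * (K * rsum (fun i => q (M + i)%nat) k)))%R).
  { intros M N k. unfold F. rewrite prodn_add. fold (F M N).
    set (v := fun i => prodn (d (M + i)%nat) N).
    replace (F M N * prodn v k - F M N) with (F M N * (prodn v k - 1)) by ring.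
    rewrite Cmod_mult. apply Rmult_le_compat; try apply Cmod_ge_0; auto.
    assert (E : (rsum (fun i => Cmod (v i - 1)) k <= K * rsum (fun i => q (M + i)%nat) k)%R).
    { rewrite <- rsum_scal. apply rsum_le. intros i _. apply row. }
    pose proof (rsum_ge0 (fun i => Cmod (v i - 1)) k ltac:(intros; apply Cmod_ge_0)) as P.
    eapply Rle_trans; [apply prodn_minus1|]. cbv beta in *.
    apply Rmult_le_compat; auto; [left; apply exp_pos|]. apply exp_le.
    eapply Rle_trans; [exact E|]. apply Rmult_le_compat_l; auto.
    specialize (HQ (M + k)%nat). rewrite rsum_add in HQ.
    pose proof (rsum_ge0 q M Q0). lra. }
  assert (approx : forall eps, (0 < eps)%R -> exists M, forall k N,
            (Cmod (F (M + k)%nat N - F M N) <= eps)%R).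
  { intros eps He. set (A := (exp (K * Q) * exp (K * Q) * K)%R).
    assert (A0 : (0 <= A)%R).
    { unfold A. repeat apply Rmult_le_pos; auto; left; apply exp_pos. }
    destruct (summable_tail q (eps / (A + 1))) as [M HM].
    { split; [exact Q0|]. now exists Q. }
    { apply Rdiv_lt_0_compat; lra. }
    exists M. intros k N. eapply Rle_trans; [apply tail|]. specialize (HM k).
    apply Rle_trans with (A * (eps / (A + 1)))%R.
    - replace (exp (K * Q) * (exp (K * Q) * (K * rsum (fun i => q (M + i)%nat) k)))%R
        with (A * rsum (fun i => q (M + i)%nat) k)%R by (unfold A; ring).
      apply Rmult_le_compat_l; lra.
    - apply Rmult_le_reg_r with (A + 1)%R; [lra|]. unfold Rdiv.
      rewrite !Rmult_assoc, Rinv_l by lra. nra. }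
  assert (LN : forall M, Ccvg (F M) (prodn sig M)).
  { intros M. unfold F. apply (prodn_limit (fun N m => prodn (d m) N)). auto. }
  assert (LM : forall N, Ccvg (fun M => F M N) (prodn rho N)).
  { intros N. unfold F.
    apply Ccvg_ext with (fun M => prodn (fun n => prodn (fun m => d m n) M) N).
    { intros M. apply prodn_swap. }
    now apply (prodn_limit (fun M n => prodn (fun m => d m n) M)). }
  apply Ceq_minus, Cmod_eq_0, Rle_antisym; [|apply Cmod_ge_0].
  apply le_epsilon. intros eps He. rewrite Rplus_0_l.
  destruct (approx (eps / 2)%R ltac:(lra)) as [M HM].
  assert (E1 : (Cmod (r - prodn sig M - 0) <= eps / 2)%R).
  { apply (Ccvg_le 0 (fun N => prodn rho N - F M N)).
    - now apply Ccvg_minus.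
    - intros N _. replace (prodn rho N - F M N - 0) with (prodn rho N - F M N) by ring.
      apply (Ccvg_le 0 (fun k => F (M + k)%nat N)); auto.
      apply (Ccvg_subseq (fun k => (M + k)%nat) (fun M => F M N)); auto.
      apply filterlim_ge_id. intros; lia. }
  assert (E2 : (Cmod (s - prodn sig M) <= eps / 2)%R).
  { apply (Ccvg_le 0 (fun k => prodn sig (M + k))).
    - apply (Ccvg_subseq (fun k => (M + k)%nat) (prodn sig)); auto.
      apply filterlim_ge_id. intros; lia.
    - intros k _. replace (prodn sig (M + k) - prodn sig M) with
        (prodn sig (M + k) - prodn sig M - 0) by ring.
      apply (Ccvg_le 0 (fun N => F (M + k)%nat N - F M N)).
      + now apply Ccvg_minus.
      + intros N _. replace (F (M + k)%nat N - F M N - 0) with (F (M + k)%nat N - F M N)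
          by ring. apply HM. }
  replace (r - s) with ((r - prodn sig M - 0) + - (s - prodn sig M)) by ring.
  eapply Rle_trans; [apply Cmod_triangle|]. rewrite Cmod_opp. lra.
Qed.

Lemma finite_max (h : nat -> nat -> R) (N : nat) :
  exists K : R, (0 <= K)%R /\ forall m n, (m < N)%nat -> (n < N)%nat -> (h m n <= K)%R.
Proof.
  assert (R1 : forall (g : nat -> R) k,
    exists K : R, (0 <= K)%R /\ forall i, (i < k)%nat -> (g i <= K)%R).
  { intros g k. induction k as [|k [K [K0 HK]]].
    - exists 0%R. split; [lra|]. intros; lia.
    - exists (Rmax K (g k)). pose proof (Rmax_l K (g k)). pose proof (Rmax_r K (g k)).
      split; [lra|]. intros i Hi. destruct (Nat.eq_dec i k) as [->|]; [lra|].
      specialize (HK i ltac:(lia)). lra. }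
  assert (R2 : forall k, exists K : R, (0 <= K)%R /\ forall m n, (m < k)%nat -> (n < N)%nat -> (h m n <= K)%R).
  { induction k as [|k [K [K0 HK]]].
    - exists 0%R. split; [lra|]. intros; lia.
    - destruct (R1 (h k) N) as [K' [_ HK']].
      exists (Rmax K K'). pose proof (Rmax_l K K'). pose proof (Rmax_r K K').
      split; [lra|]. intros m n Hm Hn. destruct (Nat.eq_dec m k) as [->|].
      + specialize (HK' n Hn). lra.
      + specialize (HK m n ltac:(lia) Hn). lra. }
  apply R2.
Qed.

Lemma Cinv_neq0 (x : C) : x <> 0 -> / x <> 0.
Proof.
  intros H E. apply C1_nz. rewrite <- (Cinv_r x H), E. ring.
Qed.

Lemma Cdiv_neq0 (x y : C) : x <> 0 -> y <> 0 -> x / y <> 0.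
Proof. intros. apply Cmult_neq_0; auto. now apply Cinv_neq0. Qed.

Lemma Copp_neq0 (x : C) : x <> 0 -> - x <> 0.
Proof. intros Hx F. apply Hx. replace x with (- - x) by ring. rewrite F. ring. Qed.

Lemma Cmod_minus_ge (x y : C) : (Cmod x - Cmod y <= Cmod (x - y))%R.
Proof.
  pose proof (Cmod_triangle (x - y) y) as T.
  replace (x - y + y) with x in T by ring. lra.
Qed.

(* (1 - a x)(1 - b x) = 1 - (a + b) x + a b x^2, so the quotient deviates from 1
   only to second order in x = 1 / w^2. *)
Lemma lattice_factor_bound (t a b : C) (e : R) :
  (0 < Im t)%R -> (e * e = 1)%R ->
  (forall m n : nat, let om := INR (S m) + (e * INR (S n))%R * t in om * om <> a + b) ->
  exists B, (0 <= B)%R /\ forall m n : nat,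
    let om := INR (S m) + (e * INR (S n))%R * t in
    (Cmod ((1 - a / (om * om)) * (1 - b / (om * om)) / (1 - (a + b) / (om * om)) - 1)
     <= B * (/ (INR (S m) * INR (S m)) * / (INR (S n) * INR (S n))))%R.
Proof.
  intros Ht He Hgood. destruct (lattice_form_lower t Ht) as [c [Hc Hl]].
  set (om := fun m n => INR (S m) + (e * INR (S n))%R * t) in *.
  set (s0 := a + b) in *.
  assert (P : forall n, (1 <= INR (S n))%R).
  { intros n. rewrite S_INR. pose proof (pos_INR n). lra. }
  assert (Hom : forall m n, (c * (INR (S m) * INR (S m) + INR (S n) * INR (S n))
                 <= Cmod (om m n * om m n))%R).
  { intros m n. rewrite Cmod_mult.
    replace (INR (S n) * INR (S n))%R with (e * INR (S n) * (e * INR (S n)))%R.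
    - apply Hl.
    - replace (e * INR (S n) * (e * INR (S n)))%R with (e * e * (INR (S n) * INR (S n)))%R
        by ring. rewrite He. ring. }
  assert (Om0 : forall m n, om m n * om m n <> 0).
  { intros m n. apply Cmod_gt_0. specialize (Hom m n). pose proof (P m).
    assert (0 < INR (S m) * INR (S m) + INR (S n) * INR (S n))%R by nra. nra. }
  assert (Og : forall m n, om m n * om m n - s0 <> 0).
  { intros m n E. apply (Hgood m n). now apply Ceq_minus. }
  (* If either index is at least N0 then |om^2| >= 2 |s0|, hence |om^2 - s0| >= |om^2|/2. The finite
     square that is left contributes K0, and K = K0 + 2 serves both cases. *)
  destruct (INR_unbounded (2 * Cmod s0 / c)) as [N0 HN0].
  destruct (finite_max (fun m n => Cmod (om m n * om m n) / Cmod (om m n * om m n - s0))%R N0)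
    as [K0 [K0p HK0]].
  set (K := (K0 + 2)%R).
  assert (HK : forall m n, (Cmod (om m n * om m n) <= K * Cmod (om m n * om m n - s0))%R).
  { intros m n. pose proof (Og m n) as G. apply Cmod_gt_0 in G.
    assert (far : (2 * Cmod s0 <= Cmod (om m n * om m n))%R ->
       (Cmod (om m n * om m n) <= K * Cmod (om m n * om m n - s0))%R).
    { intros F. pose proof (Cmod_minus_ge (om m n * om m n) s0). unfold K. nra. }
    assert (HN : (2 * Cmod s0 <= c * INR N0)%R).
    { apply Rmult_le_reg_r with (/ c)%R; [now apply Rinv_0_lt_compat|].
      replace (c * INR N0 * / c)%R with (INR N0) by (field; lra). unfold Rdiv in HN0. lra. }
    pose proof (P m) as Pm. pose proof (P n) as Pn.
    destruct (lt_dec m N0) as [Lm|Lm]; [destruct (lt_dec n N0) as [Ln|Ln]|].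
    - specialize (HK0 m n Lm Ln). cbv beta in HK0.
      apply Rmult_le_reg_r with (/ Cmod (om m n * om m n - s0))%R; [now apply Rinv_0_lt_compat|].
      rewrite (Rmult_assoc K), Rinv_r by lra. unfold K, Rdiv in *. lra.
    - apply far. eapply Rle_trans; [exact HN|]. eapply Rle_trans; [|apply Hom].
      apply Rmult_le_compat_l; [lra|]. pose proof (le_INR N0 (S n) ltac:(lia)). nra.
    - apply far. eapply Rle_trans; [exact HN|]. eapply Rle_trans; [|apply Hom].
      apply Rmult_le_compat_l; [lra|]. pose proof (le_INR N0 (S m) ltac:(lia)). nra. }
  pose proof (Cmod_ge_0 (a * b)) as Hab.
  assert (Kp : (0 < K)%R) by (unfold K; lra).
  exists (Cmod (a * b) * (K * / (c * c)))%R. split.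
  { repeat apply Rmult_le_pos; try lra. left. apply Rinv_0_lt_compat. nra. }
  intros m n. fold (om m n). cbv zeta.
  replace ((1 - a / (om m n * om m n)) * (1 - b / (om m n * om m n))
     / (1 - s0 / (om m n * om m n)) - 1)
    with (a * b * / ((om m n * om m n) * (om m n * om m n - s0))).
  2:{ unfold s0. specialize (Og m n). specialize (Om0 m n). unfold s0 in Og.
      set (x := om m n * om m n) in *.
      field. repeat split; auto. }
  rewrite (Cmod_mult (a * b)), Cmod_inv, (Cmod_mult (om m n * om m n))
    by (apply Cmult_neq_0; auto).
  rewrite Rmult_assoc. apply Rmult_le_compat_l; auto.
  specialize (Hom m n). specialize (HK m n). specialize (Og m n). specialize (Om0 m n).
  apply Cmod_gt_0 in Og. apply Cmod_gt_0 in Om0.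
  set (x := Cmod (om m n * om m n)) in *.
  pose proof (P m) as Pm. pose proof (P n) as Pn.
  set (M := INR (S m)) in *. set (N := INR (S n)) in *.
  replace (K * / (c * c) * (/ (M * M) * / (N * N)))%R with
    (/ (c * c * (M * M) * (N * N) * / K))%R.
  2:{ field. repeat split; lra. }
  apply Rinv_le_contravar.
  - repeat apply Rmult_lt_0_compat; try lra. now apply Rinv_0_lt_compat.
  - apply Rle_trans with (x * (x * / K))%R.
    + rewrite <- (Rmult_assoc x). apply Rmult_le_compat_r; [left; now apply Rinv_0_lt_compat|].
      (* M^2 + N^2 >= M N, so the decay |om|^(-4) splits into 1/M^2 times 1/N^2. *)
      assert (0 <= c * (M * N))%R by (repeat apply Rmult_le_pos; lra).
      assert (0 <= c * ((M - N) * (M - N)))%R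
        by (apply Rmult_le_pos; [lra|apply Rle_0_sqr]).
      assert (c * (M * N) <= x)%R by lra.
      replace (c * c * (M * M) * (N * N))%R with (c * (M * N) * (c * (M * N)))%R by ring.
      apply Rmult_le_compat; auto.
    + apply Rmult_le_compat_l; [lra|].
      apply Rmult_le_reg_r with K; auto. rewrite Rmult_assoc, Rinv_l by lra. lra.
Qed.

Lemma pair_factor_quotient_bound (t a b : C) :
  (0 < Im t)%R ->
  (forall x y : Z, (IZR x + IZR y * t) * (IZR x + IZR y * t) <> a + b) ->
  exists B, (0 <= B)%R /\ forall m n : nat,
    (Cmod (pair_factor t a m n * pair_factor t b m n / pair_factor t (a + b) m n - 1)
     <= B * (/ (INR (S m) * INR (S m)) * / (INR (S n) * INR (S n))))%R.
Proof.
  intros Ht Hg.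
  destruct (lattice_factor_bound t a b 1 Ht) as [B1 [B1p H1]]; [ring| |].
  { intros m n. cbv zeta. rewrite Rmult_1_l, !INR_S_IZR. apply Hg. }
  destruct (lattice_factor_bound t a b (-1) Ht) as [B2 [B2p H2]]; [ring| |].
  { intros m n. cbv zeta.
    replace (-1 * INR (S n))%R with (- INR (S n))%R by ring.
    rewrite !INR_S_IZR, <- opp_IZR. apply Hg. }
  (* From g1 g2 - 1 = (g1 - 1) g2 + (g2 - 1), with |g2| <= 1 + B2. *)
  exists (B1 * (1 + B2) + B2)%R. split; [nra|]. intros m n.
  specialize (H1 m n). specialize (H2 m n). cbv zeta in H1, H2.
  assert (P : forall n, (1 <= INR (S n))%R).
  { intros k. rewrite S_INR. pose proof (pos_INR k). lra. }
  pose proof (P m) as Pm. pose proof (P n) as Pn.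
  assert (q1 : forall x, (1 <= x)%R -> (0 < / (x * x) <= 1)%R).
  { intros x Hx. split; [apply Rinv_0_lt_compat; nra|].
    rewrite <- Rinv_1. apply Rinv_le_contravar; [lra|nra]. }
  pose proof (q1 _ Pm) as Qm. pose proof (q1 _ Pn) as Qn.
  set (q := (/ (INR (S m) * INR (S m)) * / (INR (S n) * INR (S n)))%R) in *.
  assert (Q : (0 <= q <= 1)%R) by (unfold q; split; nra).
  rewrite Rmult_1_l in H1. unfold pair_factor.
  replace ((-1 * INR (S n))%R * t) with (- (INR (S n) * t)) in H2
    by (rewrite RtoC_mult; ring).
  assert (N1 : forall e : R, (e * e = 1)%R -> INR (S m) + e * INR (S n) * t <> 0).
  { intros e He E. destruct (lattice_point_eq0 t (INR (S m)) (e * INR (S n)) Ht) as [E' _].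
    - rewrite RtoC_mult. exact E.
    - lra. }
  pose proof (N1 1%R ltac:(ring)) as Np. pose proof (N1 (-1)%R ltac:(ring)) as Nm.
  pose proof (Hg (Z.of_nat (S m)) (Z.of_nat (S n))) as Gp.
  pose proof (Hg (Z.of_nat (S m)) (- Z.of_nat (S n))%Z) as Gm.
  rewrite opp_IZR, RtoC_opp, <- !INR_S_IZR in Gm. rewrite <- !INR_S_IZR in Gp.
  set (x := INR (S m) + INR (S n) * t) in *.
  assert (Ex : x = INR (S m) + 1 * INR (S n) * t) by (unfold x; ring).
  rewrite <- Ex in Np.
  set (y := INR (S m) - INR (S n) * t) in *.
  assert (Ey : y = INR (S m) + (-1)%R * INR (S n) * t) by (unfold y; ring).
  rewrite <- Ey in Nm.
  change (INR (S m) + - (INR (S n) * t)) with y in H2.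
  replace (INR (S m) + - INR (S n) * t) with y in Gm by (unfold y; ring).
  set (g1 := (1 - a / (x * x)) * (1 - b / (x * x)) / (1 - (a + b) / (x * x))) in *.
  set (g2 := (1 - a / (y * y)) * (1 - b / (y * y)) / (1 - (a + b) / (y * y))) in *.
  match goal with |- (Cmod ?z <= _)%R =>
    replace z with ((g1 - 1) * g2 + (g2 - 1)) end.
  2:{ unfold g1, g2. field.
      assert (Q1 : x * x - (a + b) <> 0) by (intros E; apply Gp; now apply Ceq_minus).
      assert (Q2 : y * y - (a + b) <> 0) by (intros E; apply Gm; now apply Ceq_minus).
      repeat split; auto. }
  eapply Rle_trans; [apply Cmod_triangle|]. rewrite Cmod_mult.
  assert (G2 : (Cmod g2 <= 1 + B2)%R).
  { apply Cmod_le_minus1. nra. }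
  pose proof (Cmod_ge_0 (g1 - 1)).
  nra.
Qed.

Lemma Im_neg_inv (t : C) : (0 < Im t)%R -> (0 < Im (- / t))%R.
Proof.
  destruct t as [x y]. simpl. intros H.
  replace (- (- y / (x * (x * 1) + y * (y * 1))))%R with (y / (x * x + y * y))%R
    by (field; nra).
  apply Rdiv_lt_0_compat; nra.
Qed.

Local Opaque theta_quot Sn.

(** This is R(u) R(v) = R(w) of the overview, cleared of denominators. Multiplication by t carries
    the lattice of -1/t to that of t with rows and columns exchanged, so the row products for t and
    for -1/t are the two iterated limits of one doubly indexed product [d]. *)
Lemma inversion_ratio_mult (t u v w : C) :
  (0 < Im t)%R -> ~ in_lattice t u -> ~ in_lattice t v -> ~ in_lattice t w -> w * w = u * u + v * v ->
  theta_quot (u / t) (- / t) * theta_quot (v / t) (- / t) * theta_quot w t * t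
  = theta_quot u t * theta_quot v t * theta_quot (w / t) (- / t).
Proof.
  intros Ht Hu Hv Hw E. destruct sine_product as [kap [Hk Hs]].
  pose proof (Im_neg_inv t Ht) as Ht'. pose proof (upper_neq0 t Ht) as T0.
  assert (dual : forall u, ~ in_lattice t u -> ~ in_lattice (- / t) (u / t)).
  { intros x Hx [m [n En]]. apply Hx. exists (- n)%Z, m.
    rewrite opp_IZR, RtoC_opp. replace x with (x / t * t) by (field; auto).
    rewrite En. field. auto. }
  destruct (row_products kap t u Hk Hs Ht Hu) as [Ru [Ru1 [Ru0 Ru2]]].
  destruct (row_products kap t v Hk Hs Ht Hv) as [Rv [Rv1 [Rv0 Rv2]]].
  destruct (row_products kap t w Hk Hs Ht Hw) as [Rw [Rw1 [Rw0 Rw2]]].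
  destruct (row_products kap _ _ Hk Hs Ht' (dual u Hu)) as [Su [Su1 [Su0 Su2]]].
  destruct (row_products kap _ _ Hk Hs Ht' (dual v Hv)) as [Sv [Sv1 [Sv0 Sv2]]].
  destruct (row_products kap _ _ Hk Hs Ht' (dual w Hw)) as [Sw [Sw1 [Sw0 Sw2]]].
  assert (Hg : forall x y : Z, (IZR x + IZR y * t) * (IZR x + IZR y * t) <> u * u + v * v).
  { intros x y Exy. rewrite <- E in Exy.
    assert (F : (IZR x + IZR y * t - w) * (IZR x + IZR y * t + w) = 0).
    { replace ((IZR x + IZR y * t - w) * (IZR x + IZR y * t + w)) with
       ((IZR x + IZR y * t) * (IZR x + IZR y * t) - w * w) by ring. rewrite Exy. ring. }
    apply Hw. apply Cmult_integral in F as [F|F].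
    - exists x, y. symmetry. now apply Ceq_minus.
    - exists (- x)%Z, (- y)%Z. rewrite !opp_IZR, !RtoC_opp.
      replace w with ((IZR x + IZR y * t + w) - (IZR x + IZR y * t)) by ring.
      rewrite F. ring. }
  destruct (pair_factor_quotient_bound t (u * u) (v * v) Ht Hg) as [B [B0 HB]].
  rewrite <- E in HB.
  assert (nz : forall x, ~ in_lattice t x -> Sn x <> 0 /\ Sn (x / t) <> 0 /\ x <> 0).
  { intros x Hx. repeat split.
    - intros F. apply Sn_eq0 in F as [k F]. apply Hx. exists k, 0%Z. rewrite F. ring.
    - intros F. apply Sn_eq0 in F as [k F]. apply Hx. exists 0%Z, k.
      replace x with (x / t * t) by (field; auto). rewrite F. ring.
    - intros F. apply Hx. exists 0%Z, 0%Z. rewrite F. ring. }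
  destruct (nz u Hu) as [U1 [U2 U3]]. destruct (nz v Hv) as [V1 [V2 V3]].
  destruct (nz w Hw) as [W1 [W2 W3]].
  pose proof (theta_quot_neq0 w t Ht Hw) as Pw. pose proof (theta_quot_neq0 _ _ Ht' (dual w Hw)) as Pw'.
  assert (simp : forall x, x / t / (- / t) = - x) by (intros; field; auto).
  rewrite simp, Sn_opp in Su2, Sv2, Sw2.
  assert (sym : forall x m n, pair_factor t (x * x) m n = pair_factor (- / t) (x / t * (x / t)) n m).
  { intros x m n. unfold pair_factor. rewrite Cmult_comm. f_equal; f_equal.
    all: set (M := RtoC (INR (S m))); set (N := RtoC (INR (S n))).
    - replace (N + M * - / t) with ((N * t - M) * / t) by (field; auto).
      assert (F : M - N * t <> 0).
      { intros F. destruct (lattice_point_eq0 t (INR (S m)) (- INR (S n)) Ht) as [F' _].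
        - rewrite <- F, RtoC_opp. unfold M, N. ring.
        - now apply (INR_S_neq0 m); rewrite F'. }
      assert (F2 : N * t - M <> 0).
      { replace (N * t - M) with (- (M - N * t)) by ring. now apply Copp_neq0. }
      field. repeat split; auto.
    - replace (N - M * - / t) with ((M + N * t) * / t) by (field; auto).
      assert (F : M + N * t <> 0).
      { intros F. destruct (lattice_point_eq0 t (INR (S m)) (INR (S n)) Ht F) as [F' _].
        now apply (INR_S_neq0 m); rewrite F'. }
      field. repeat split; auto. }
  assert (Hquot : forall x y z : nat -> C, forall la lb lc : C,
    (forall i, z i <> 0) -> lc <> 0 ->
    Ccvg (prodn x) la -> Ccvg (prodn y) lb -> Ccvg (prodn z) lc ->
    Ccvg (prodn (fun i => x i * y i / z i)) (la * lb / lc)).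
  { intros x y z la lb lc Hz Hc Hx Hy Hz'.
    apply Ccvg_ext with (fun n => prodn x n * prodn y n / prodn z n).
    - intros n. unfold Cdiv. destruct (prodn_inv z n Hz) as [I1 _].
      now rewrite !prodn_mult, I1.
    - apply Ccvg_div; auto. now apply Ccvg_mult. }
  assert (cz : forall m n, pair_factor t (w * w) m n <> 0).
  { intros m n F. apply (Rw0 n). apply (Ccvg_unique _ _ _ (Rw1 n)).
    apply Ccvg_ext_loc with (S m) (fun _ => RtoC 0); [|apply Ccvg_const].
    intros i Hi. symmetry. apply prodn_eq0 with m; auto. }
  set (d := fun m n => pair_factor t (u * u) m n * pair_factor t (v * v) m n / pair_factor t (w * w) m n).
  assert (Efin : theta_quot u t * (kap * u) / (t * (Sn u * Sn (u / t)))
     * (theta_quot v t * (kap * v) / (t * (Sn v * Sn (v / t))))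
     / (theta_quot w t * (kap * w) / (t * (Sn w * Sn (w / t)))) =
     theta_quot (u / t) (- / t) * (kap * (u / t)) / (- / t * (Sn (u / t) * - Sn u))
     * (theta_quot (v / t) (- / t) * (kap * (v / t)) / (- / t * (Sn (v / t) * - Sn v)))
     / (theta_quot (w / t) (- / t) * (kap * (w / t)) / (- / t * (Sn (w / t) * - Sn w)))).
  { refine (double_product_interchange d B (fun n => Ru n * Rv n / Rw n)
      (fun m => Su m * Sv m / Sw m) _ _ B0 HB _ _ _ _).
    - intros n. unfold d. apply (Hquot (fun m => pair_factor t (u * u) m n)
        (fun m => pair_factor t (v * v) m n) (fun m => pair_factor t (w * w) m n)); auto.
    - apply Hquot; auto.
      apply Cdiv_neq0; repeat apply Cmult_neq_0; auto.
    - intros m. unfold d.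
      apply (Hquot (pair_factor t (u * u) m) (pair_factor t (v * v) m) (pair_factor t (w * w) m)); auto.
      + apply Ccvg_ext with (2 := Su1 m). intros k. apply prodn_ext. intros. symmetry. apply sym.
      + apply Ccvg_ext with (2 := Sv1 m). intros k. apply prodn_ext. intros. symmetry. apply sym.
      + apply Ccvg_ext with (2 := Sw1 m). intros k. apply prodn_ext. intros. symmetry. apply sym.
    - apply Hquot; auto.
      apply Cdiv_neq0; repeat apply Cmult_neq_0; auto using Cinv_neq0, Copp_neq0. }
  set (pu := theta_quot u t) in *. set (pv := theta_quot v t) in *. set (pw := theta_quot w t) in *.
  set (qu := theta_quot (u / t) (- / t)) in *. set (qv := theta_quot (v / t) (- / t)) in *.
  set (qw := theta_quot (w / t) (- / t)) in *.
  set (su := Sn u) in *. set (sv := Sn v) in *. set (sw := Sn w) in *.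
  set (su' := Sn (u / t)) in *. set (sv' := Sn (v / t)) in *. set (sw' := Sn (w / t)) in *.
  (* The elementary factors of both sides: the same sines occur in either order of
     multiplication. *)
  set (Z := kap * u * v * sw * sw' / (w * su * su' * sv * sv')).
  assert (Z0 : Z <> 0).
  { apply Cdiv_neq0; repeat apply Cmult_neq_0; auto. }
  assert (E1 : Z * (pu * pv / (pw * t)) = Z * (qu * qv / qw)).
  { etransitivity; [|etransitivity; [exact Efin|]]; unfold Z; field; repeat split; auto. }
  assert (E2 : pu * pv / (pw * t) = qu * qv / qw).
  { replace (pu * pv / (pw * t)) with (/ Z * (Z * (pu * pv / (pw * t))))
      by (field; auto).
    rewrite E1. field. auto. }
  replace (qu * qv * pw * t) with (qu * qv / qw * (qw * pw * t)) by (field; auto).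
  rewrite <- E2. field. auto.
Qed.

Local Opaque ee qpoch.

(** Since (v+1)/t + (-1/t) = v/t, the period 1 of one lattice becomes the quasi-period of the other.
    The signs of the two shifts cancel and leave e(((v+1)^2 - v^2)/(2t)). *)
Lemma theta_quot_ratio_plus_1 (v t : C) : (0 < Im t)%R ->
  theta_quot ((v + 1) / t) (- / t) * theta_quot v t
  = ee ((2 * v + 1) / (2 * t)) * (theta_quot (v / t) (- / t) * theta_quot (v + 1) t).
Proof.
  intros Ht. pose proof (upper_neq0 t Ht) as T0. rewrite theta_quot_plus_1.
  pose proof (theta_quot_plus_tau ((v + 1) / t) (- / t) (Im_neg_inv t Ht)) as E.
  replace ((v + 1) / t + - / t) with (v / t) in E by (field; auto).
  rewrite E.
  replace (- ((v + 1) / t) - - / t / 2) with (- ((2 * v + 1) / (2 * t)))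
    by (field; nzc).
  rewrite ee_opp. field. apply ee_neq0.
Qed.

Lemma theta_quot_ratio_plus_nat (v t : C) (k : nat) : (0 < Im t)%R -> ~ in_lattice t v ->
  theta_quot ((v + INR k) / t) (- / t) * theta_quot v t
  = ee ((2 * INR k * v + INR k * INR k) / (2 * t)) * (theta_quot (v / t) (- / t) * theta_quot (v + INR k) t).
Proof.
  intros Ht Hv. pose proof (upper_neq0 t Ht) as T0.
  induction k as [|k IH].
  - simpl INR. replace (v + 0) with v by ring.
    replace ((2 * 0 * v + 0 * 0) / (2 * t)) with (RtoC 0) by (field; nzc).
    rewrite ee_0. ring.
  - rewrite S_INR, RtoC_plus. set (K := RtoC (INR k)) in *.
    replace (v + (K + 1)) with ((v + K) + 1) by ring.
    pose proof (theta_quot_ratio_plus_1 (v + K) t Ht) as E.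
    assert (N1 : theta_quot (v + K) t <> 0).
    { apply theta_quot_neq0; auto. intros [m [n En]]. apply Hv. exists (m - Z.of_nat k)%Z, n.
      rewrite minus_IZR, RtoC_minus, <- INR_IZR_INZ.
      replace v with (v + K - K) by ring. rewrite En. unfold K. ring. }
    set (A := theta_quot ((v + K + 1) / t) (- / t)) in *. set (B := theta_quot (v + K) t) in *.
    set (D := theta_quot (v + K + 1) t) in *. set (F := theta_quot ((v + K) / t) (- / t)) in *.
    set (G := theta_quot v t) in *.
    replace ((2 * (K + 1) * v + (K + 1) * (K + 1)) / (2 * t)) with
      ((2 * (v + K) + 1) / (2 * t) + (2 * K * v + K * K) / (2 * t))
      by (field; nzc).
    rewrite ee_plus. set (e1 := ee ((2 * (v + K) + 1) / (2 * t))) in *.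
    replace (A * G) with (A * B * G / B) by (field; auto). rewrite E.
    replace (e1 * (F * D) * G / B) with (e1 * D * (F * G) / B) by (field; auto).
    rewrite IH. field. auto.
Qed.

Lemma theta_quot_inversion (u t : C) : (0 < Im t)%R ->
  theta_quot (u / t) (- / t) = ee (u * u / (2 * t)) / t * theta_quot u t.
Proof.
  intros Ht. pose proof (upper_neq0 t Ht) as T0.
  (* At lattice points no ratio can be formed, but both sides vanish. *)
  destruct (Classical_Prop.classic (in_lattice t u)) as [Hu|Hu].
  { rewrite (theta_quot_eq0 u t Ht Hu), theta_quot_eq0; [ring|now apply Im_neg_inv|].
    destruct Hu as [m [n En]]. exists n, (- m)%Z.
    rewrite opp_IZR, RtoC_opp, En. field. auto. }
  assert (U0 : u <> 0).
  { intros E. apply Hu. exists 0%Z, 0%Z. rewrite E. ring. }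
  destruct (lattice_form_lower t Ht) as [c [Hc Hl]].
  set (a2 := Cmod (u * u)).
  destruct (INR_unbounded (a2 * a2 / c)) as [k0 Hk0]. set (k := S k0).
  assert (Hk : (1 <= INR k)%R) by (unfold k; rewrite S_INR; pose proof (pos_INR k0); lra).
  assert (Hk' : (a2 * a2 < c * INR k)%R).
  { assert (a2 * a2 / c < INR k)%R by (unfold k; rewrite S_INR; lra).
    apply Rmult_lt_compat_l with (r := c) in H; auto.
    replace (c * (a2 * a2 / c))%R with (a2 * a2)%R in H by (field; lra). exact H. }
  set (K := RtoC (INR k)). assert (K0 : K <> 0) by (apply RtoC_neq0; lra).
  (* u^2 / k is too close to 0 to lie in the lattice. *)
  assert (Hs : ~ in_lattice t (u * u / K)).
  { intros [m [n En]]. pose proof (Hl (IZR m) (IZR n)) as B. rewrite <- En in B.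
    rewrite <- Cmod_mult in B.
    replace (u * u / K * (u * u / K)) with ((u * u) * (u * u) * / (K * K)) in B
      by (field; auto).
    rewrite !(Cmod_mult (_ * _)), Cmod_inv, (Cmod_mult K) in B by now apply Cmult_neq_0.
    fold a2 in B. unfold K in B. rewrite Cmod_R, Rabs_pos_eq in B by lra.
    assert (B' : (c * (IZR m * IZR m + IZR n * IZR n) * (INR k * INR k) <= a2 * a2)%R).
    { apply Rmult_le_compat_r with (r := (INR k * INR k)%R) in B; [|nra].
      rewrite Rmult_assoc, (Rmult_assoc (a2 * a2)), Rinv_l, Rmult_1_r in B by nra. lra. }
    assert (D : (IZR m * IZR m + IZR n * IZR n < 1)%R).
    { apply Rnot_le_lt. intros Hge.
      assert (c * 1 * (INR k * INR k)
         <= c * (IZR m * IZR m + IZR n * IZR n) * (INR k * INR k))%R.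
      { apply Rmult_le_compat_r; [nra|]. apply Rmult_le_compat_l; lra. }
      nra. }
    rewrite <- !mult_IZR, <- plus_IZR in D. apply lt_IZR in D.
    assert (m = 0%Z) by nia. assert (n = 0%Z) by nia. subst m n.
    apply (Cdiv_neq0 (u * u) K); auto; [now apply Cmult_neq_0|]. rewrite En. ring. }
  (* The solution of (v + K)^2 = u^2 + v^2. If v or v + K were in the lattice, so would be 2 v + K =
     u^2/K. *)
  set (v := (u * u / K - K) / 2).
  assert (Hv : ~ in_lattice t v).
  { intros [m [n En]]. apply Hs. exists (2 * m + Z.of_nat k)%Z, (2 * n)%Z.
    rewrite plus_IZR, !mult_IZR, <- INR_IZR_INZ, RtoC_plus, !RtoC_mult. fold K.
    replace (u * u / K) with (2 * v + K) by (unfold v; field; nzc).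
    rewrite En. ring. }
  assert (Hw : ~ in_lattice t (v + K)).
  { intros [m [n En]]. apply Hv. exists (m - Z.of_nat k)%Z, n.
    rewrite minus_IZR, RtoC_minus, <- INR_IZR_INZ. fold K.
    replace v with (v + K - K) by ring. rewrite En. ring. }
  assert (E : (v + K) * (v + K) = u * u + v * v).
  { unfold v. field; nzc. }
  pose proof (inversion_ratio_mult t u v (v + K) Ht Hu Hv Hw E) as R1.
  pose proof (theta_quot_ratio_plus_nat v t k Ht Hv) as R2. fold K in R2.
  replace ((2 * K * v + K * K) / (2 * t)) with (u * u / (2 * t)) in R2.
  2:{ f_equal. unfold v. field; nzc. }
   pose proof (theta_quot_neq0 _ t Ht Hw) as Nw.
  assert (Nv' : theta_quot (v / t) (- / t) <> 0).
  { apply theta_quot_neq0; [now apply Im_neg_inv|]. intros [m [n En]]. apply Hv.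
    exists (- n)%Z, m. rewrite opp_IZR, RtoC_opp.
    replace v with (v / t * t) by (field; auto). rewrite En. field. auto. }
  set (x := theta_quot (u / t) (- / t)) in *. set (y := theta_quot u t) in *.
  set (pv := theta_quot v t) in *. set (qv := theta_quot (v / t) (- / t)) in *.
  set (pw := theta_quot (v + K) t) in *. set (qw := theta_quot ((v + K) / t) (- / t)) in *.
  replace x with (x * qv * pw * t / (qv * pw * t)) by (field; auto).
  rewrite R1. replace (y * pv * qw) with (y * (qw * pv)) by ring. rewrite R2.
  field. auto.
Qed.

(** * Klein forms and the discriminant *)

Local Transparent theta_quot qpoch.

Lemma theta_quot_tau_plus_Z (v t : C) (k : Z) : theta_quot v (t + IZR k) = theta_quot v t.
Proof.
  unfold theta_quot. rewrite !qpoch_tau_plus_Z, qpoch_plus_Z.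
  replace (t + IZR k - v) with ((t - v) + IZR k) by ring. now rewrite qpoch_plus_Z.
Qed.

Local Opaque theta_quot qpoch.

(* The Klein form of characteristic (r, s), up to the factor 2 pi i. *)
Definition klein (r s : R) (t : C) : C := ee (r * (r * t + s) / 2) * theta_quot (r * t + s) t.

Lemma klein_tau_plus_Z (r s : R) (t : C) (k : Z) :
  klein r s (t + IZR k) = klein r (s + IZR k * r) t.
Proof.
  unfold klein. rewrite theta_quot_tau_plus_Z, RtoC_plus, RtoC_mult.
  replace (r * (t + IZR k) + s) with (r * t + (s + IZR k * r)) by ring. reflexivity.
Qed.

(** The prefactor of [klein] exists for this purpose: it absorbs e(u^2/(2t)), so that inversion
    merely multiplies the row vector (r, s) by a matrix. *)
Lemma klein_inversion (r s : R) (t : C) : (0 < Im t)%R ->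
  klein r s (- / t) = / t * klein s (- r) t.
Proof.
  intros Ht. pose proof (upper_neq0 t Ht) as T0. unfold klein. rewrite RtoC_opp.
  replace (r * - / t + s) with ((s * t + - r) / t) by (field; auto).
  rewrite theta_quot_inversion by auto. set (v := s * t + - r).
  replace (s * v / 2) with (r * (v / t) / 2 + v * v / (2 * t)).
  - rewrite ee_plus. field; auto.
  - unfold v. field; nzc.
Qed.

Lemma klein_opp (r s : R) (t : C) : (0 < Im t)%R -> klein (- r) (- s) t = - klein r s t.
Proof.
  intros Ht. unfold klein. rewrite !RtoC_opp.
  replace (- r * t + - s) with (- (r * t + s)) by ring. rewrite theta_quot_opp by auto.
  replace (- r * - (r * t + s) / 2) with (r * (r * t + s) / 2) by (field; nzc). ring.
Qed.

(** The step is an equivalence, so one computation serves both directions away from 0. *)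
Lemma Z_shift_ind (Q : Z -> Prop) :
  Q 0%Z -> (forall k, Q k <-> Q (k + 1)%Z) -> forall k, Q k.
Proof.
  intros H0 H1. apply Zind_abs; induction n as [|n IH]; auto.
  - rewrite Nat2Z.inj_succ. apply (proj1 (H1 _)), IH.
  - apply (proj2 (H1 _)). replace (- Z.of_nat (S n) + 1)%Z with (- Z.of_nat n)%Z by lia. exact IH.
Qed.

Lemma ee_half_mult (x : C) : ee (x + / 2) = - ee x.
Proof. rewrite ee_plus, ee_half. ring. Qed.

Lemma klein_s_plus_1 (r s : R) (t : C) : klein r (s + 1) t = ee ((r + 1) / 2) * klein r s t.
Proof.
  unfold klein. rewrite RtoC_plus.
  replace (r * t + (s + 1)) with ((r * t + s) + 1) by ring. rewrite theta_quot_plus_1.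
  replace ((r + 1) / 2) with (r / 2 + / 2) by (field; nzc).
  rewrite ee_half_mult.
  replace (r * (r * t + s + 1) / 2) with (r * (r * t + s) / 2 + r / 2) by (field; nzc).
  rewrite ee_plus. ring.
Qed.

Lemma klein_r_plus_1 (r s : R) (t : C) : (0 < Im t)%R ->
  klein (r + 1) s t = ee ((1 - s) / 2) * klein r s t.
Proof.
  intros Ht. unfold klein. rewrite RtoC_plus.
  replace ((r + 1) * t + s) with ((r * t + s) + t) by ring.
  rewrite theta_quot_plus_tau by auto. set (v := r * t + s).
  replace ((1 - s) / 2) with (- (s / 2) + / 2) by (field; nzc).
  rewrite ee_half_mult.
  enough (E : ee ((r + 1) * (v + t) / 2) * ee (- v - t / 2)
              = ee (- (s / 2)) * ee (r * v / 2)).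
  { transitivity (- (ee ((r + 1) * (v + t) / 2) * ee (- v - t / 2)) * theta_quot v t); [ring|].
    rewrite E. ring. }
  rewrite <- !ee_plus. f_equal. unfold v. field; nzc.
Qed.

Lemma klein_s_plus_Z (r s : R) (t : C) (k : Z) :
  klein r (s + IZR k) t = ee (IZR k * (r + 1) / 2) * klein r s t.
Proof.
  revert k. apply Z_shift_ind.
  - rewrite Rplus_0_r. replace (0 * (r + 1) / 2) with (RtoC 0) by (field; nzc).
    rewrite ee_0. ring.
  - intros k. rewrite plus_IZR, RtoC_plus, <- Rplus_assoc, klein_s_plus_1.
    replace ((IZR k + 1) * (r + 1) / 2) with ((r + 1) / 2 + IZR k * (r + 1) / 2)
      by (field; nzc).
    rewrite ee_plus. pose proof (ee_neq0 ((r + 1) / 2)) as N.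
    set (e := ee ((r + 1) / 2)) in *. rewrite <- Cmult_assoc. split; intros H.
    + now rewrite H.
    + set (x := klein r (s + IZR k) t) in *.
      replace x with (/ e * (e * x)) by (field; auto). rewrite H. field; auto.
Qed.

Lemma klein_r_plus_Z (r s : R) (t : C) (k : Z) : (0 < Im t)%R ->
  klein (r + IZR k) s t = ee (IZR k * (1 - s) / 2) * klein r s t.
Proof.
  intros Ht. revert k. apply Z_shift_ind.
  - rewrite Rplus_0_r. replace (0 * (1 - s) / 2) with (RtoC 0) by (field; nzc).
    rewrite ee_0. ring.
  - intros k. rewrite plus_IZR, RtoC_plus, <- Rplus_assoc, klein_r_plus_1 by auto.
    replace ((IZR k + 1) * (1 - s) / 2) with ((1 - s) / 2 + IZR k * (1 - s) / 2)
      by (field; nzc).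
    rewrite ee_plus. pose proof (ee_neq0 ((1 - s) / 2)) as N.
    set (e := ee ((1 - s) / 2)) in *. rewrite <- Cmult_assoc. split; intros H.
    + now rewrite H.
    + set (x := klein (r + IZR k) s t) in *.
      replace x with (/ e * (e * x)) by (field; auto). rewrite H. field; auto.
Qed.

Lemma Im_moebius (a b c d : Z) (t : C) : IZR c * t + IZR d <> 0 ->
  Im ((IZR a * t + IZR b) / (IZR c * t + IZR d))
  = (IZR (a * d - b * c) * Im t / (Cmod (IZR c * t + IZR d) ^ 2))%R.
Proof.
  intros H. apply Cmod_gt_0 in H. rewrite Cmod2_alt.
  assert (N : (Re (IZR c * t + IZR d) ^ 2 + Im (IZR c * t + IZR d) ^ 2 <> 0)%R).
  { rewrite <- Cmod2_alt. apply pow_nonzero. lra. }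
  rewrite minus_IZR, !mult_IZR. destruct t as [x y]. simpl in *. field.
  intros E. apply N. etransitivity; [|exact E]. ring.
Qed.

Lemma denominator_neq0 (a b c d : Z) (t : C) :
  (0 < Im t)%R -> (a * d - b * c <> 0)%Z -> IZR c * t + IZR d <> 0.
Proof.
  intros Ht Hd E. destruct (lattice_point_eq0 t (IZR d) (IZR c) Ht) as [E1 E2].
  - rewrite <- E. ring.
  - apply eq_IZR in E1, E2. subst. lia.
Qed.

Lemma moebius_upper (a b c d : Z) (t : C) :
  (0 < Im t)%R -> (0 < a * d - b * c)%Z ->
  (0 < Im ((IZR a * t + IZR b) / (IZR c * t + IZR d)))%R.
Proof.
  intros Ht Hd. assert (N : IZR c * t + IZR d <> 0)
    by (apply (denominator_neq0 a b c d); auto; lia).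
  rewrite Im_moebius by auto. apply IZR_lt in Hd. apply Cmod_gt_0 in N.
  apply Rdiv_lt_0_compat; [nra|apply pow_lt; lra].
Qed.

(* Passing from (a, b; c, d) to (k a - c, k b - d; a, b) is left multiplication
   by T^k S. *)
Lemma SL2_ind (Q : Z -> Z -> Z -> Z -> Prop) :
  (forall k, Q 1 k 0 1)%Z -> (forall k, Q (-1) k 0 (-1))%Z ->
  (forall k a b c d, a * d - b * c = 1 -> Q a b c d -> Q (k * a - c) (k * b - d) a b)%Z ->
  (forall a b c d, a * d - b * c = 1 -> Q a b c d)%Z.
Proof.
  intros H1 H2 H3.
  enough (G : forall n c, (Z.abs_nat c < n)%nat ->
     forall a b d, (a * d - b * c = 1)%Z -> Q a b c d).
  { intros a b c d. apply (G (S (Z.abs_nat c))). lia. }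
  induction n as [|n IH]; intros c Hc a b d Hd; [lia|].
  destruct (Z.eq_dec c 0) as [->|Nc].
  - assert (E : (a * d = 1)%Z) by lia.
    destruct (Z.mul_eq_1 a d E) as [->| ->].
    + assert (d = 1)%Z by lia. subst. apply H1.
    + assert (d = -1)%Z by lia. subst. apply H2.
  (* Euclid's algorithm on the first column: the matrix is T^k S times the one with rows (c, d) and
     (-r, k d - b), whose lower left entry is smaller in absolute value. *)
  - pose proof (Z.div_mod a c Nc) as E.
    pose proof (Z.mod_bound_or a c Nc) as Hm.
    set (k := (a / c)%Z) in *. set (r := (a mod c)%Z) in *.
    replace a with (k * c - - r)%Z by lia.
    replace b with (k * d - (k * d - b))%Z by lia.
    assert (Hd' : (c * (k * d - b) - d * - r = 1)%Z) by nia.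
    apply H3; auto. apply IH; auto. lia.
Qed.

Lemma SL2_step_eq (k a b c d : Z) (t : C) :
  (0 < Im t)%R -> (a * d - b * c = 1)%Z ->
  (IZR (k * a - c) * t + IZR (k * b - d)) / (IZR a * t + IZR b)
  = - / ((IZR a * t + IZR b) / (IZR c * t + IZR d)) + IZR k.
Proof.
  intros Ht Hd.
  assert (N1 : IZR c * t + IZR d <> 0) by (apply (denominator_neq0 a b c d); auto; lia).
  assert (N2 : IZR a * t + IZR b <> 0) by (apply (denominator_neq0 (-c) (-d) a b); auto; lia).
  rewrite !minus_IZR, !mult_IZR, !RtoC_minus, !RtoC_mult. field; auto.
Qed.

(** Translation and inversion both act on (r, s) as on a row vector, without any root of unity, so
    the rule composes along [SL2_ind]. *)
Lemma klein_SL2 (a b c d : Z) (r s : R) (t : C) :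
  (a * d - b * c = 1)%Z -> (0 < Im t)%R ->
  klein r s ((IZR a * t + IZR b) / (IZR c * t + IZR d))
  = / (IZR c * t + IZR d) * klein (r * IZR a + s * IZR c) (r * IZR b + s * IZR d) t.
Proof.
  intros Hd Ht. revert r s.
  apply (SL2_ind (fun a b c d => forall r s : R,
   klein r s ((IZR a * t + IZR b) / (IZR c * t + IZR d))
   = / (IZR c * t + IZR d) * klein (r * IZR a + s * IZR c) (r * IZR b + s * IZR d) t)); auto;
   clear a b c d Hd.
  - intros k r s. replace ((1 * t + IZR k) / (0 * t + 1)) with (t + IZR k) by (field; nzc).
    rewrite klein_tau_plus_Z.
    replace (r * 1 + s * 0)%R with r by ring.
    replace (r * IZR k + s * 1)%R with (s + IZR k * r)%R by ring.
    replace (0 * t + 1) with (RtoC 1) by ring. field; nzc.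
  - intros k r s.
    replace (((-1) * t + IZR k) / (0 * t + (-1))) with (t + IZR (- k)).
    2:{ rewrite opp_IZR, RtoC_opp. field; nzc. }
    rewrite klein_tau_plus_Z.
    replace (r * (-1) + s * 0)%R with (- r)%R by ring.
    replace (r * IZR k + s * (-1))%R with (- (s + IZR (- k) * r))%R
      by (rewrite opp_IZR; ring).
    rewrite klein_opp by auto.
    replace (0 * t + (-1)) with (- RtoC 1) by ring. field; rewrite <- RtoC_opp; nzc.
  - intros k a b c d Hd IH r s.
    rewrite (SL2_step_eq k a b c d t Ht Hd), klein_tau_plus_Z.
    rewrite klein_inversion by (apply moebius_upper; auto; lia).
    rewrite IH.
    assert (N1 : IZR c * t + IZR d <> 0) by (apply (denominator_neq0 a b c d); auto; lia).
    assert (N2 : IZR a * t + IZR b <> 0) by (apply (denominator_neq0 (-c) (-d) a b); auto; lia).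
    rewrite !minus_IZR, !mult_IZR.
    replace ((s + IZR k * r) * IZR a + - r * IZR c)%R
      with (r * (IZR k * IZR a - IZR c) + s * IZR a)%R by ring.
    replace ((s + IZR k * r) * IZR b + - r * IZR d)%R
      with (r * (IZR k * IZR b - IZR d) + s * IZR b)%R by ring.
    field; auto.
Qed.

(* eta^24 *)
Definition Delta (t : C) : C := ee t * qpoch t t ^ 24.

(** Euler's identity between partitions into odd and into distinct parts. After multiplication by
    (q; q), the factors of index n combine to (1 - q^(2n+1))(1 - q^(2n+2)), so n of them make up the
    first 2n factors of (q; q) itself. *)
Lemma euler_odd_distinct (t : C) : (0 < Im t)%R ->
  qpoch (t / 2) t * qpoch (t / 2 + / 2) t * qpoch (t + / 2) t = 1.
Proof.
  intros Ht. pose proof (qpoch_tau_neq0 t Ht) as N.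
  assert (E : qpoch t t * (qpoch (t / 2) t * qpoch (t / 2 + / 2) t * qpoch (t + / 2) t) = qpoch t t).
  { apply (Ccvg_unique (fun n => prodn (fun n => 1 - ee t * ee t ^ n) (n + n))).
    - eapply Ccvg_ext; [|repeat apply Ccvg_mult; apply qpoch_cvg; exact Ht].
      intros n. cbv beta. rewrite !ee_half_mult.
      assert (Eh : ee (t / 2) * ee (t / 2) = ee t).
      { rewrite <- ee_plus. f_equal. field; nzc. }
       rewrite <- Eh.
      induction n as [|n IH]; [simpl; ring|].
      replace (S n + S n)%nat with (S (S (n + n))) by lia. cbn [prodn].
      rewrite <- IH. cbn [Cpow]. rewrite !Cpow_mult_l, Cpow_add_r.
        ring.
    - apply (Ccvg_subseq (fun n => (n + n)%nat) (prodn (fun n => 1 - ee t * ee t ^ n))).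
      + apply filterlim_ge_id. intros; lia.
      + now apply qpoch_cvg. }
  set (x := _ * qpoch (t + / 2) t) in *.
  replace x with (/ qpoch t t * (qpoch t t * x)) by (field; auto). rewrite E. field; auto.
Qed.

Local Transparent theta_quot.
(** Each of the three Klein forms is elementary times the square of one of Euler's three products
    over (q; q)^2, so the numerators multiply to 1 and eta^(-6) remains. The 2 in the constant is 1
    - e(1/2), split off from the form with r = 0. *)
Lemma klein_half_product :
  exists c0 : C, c0 <> 0 /\ forall t, (0 < Im t)%R ->
    klein (/ 2) 0 t * klein 0 (/ 2) t * klein (/ 2) (/ 2) t * (ee (t / 4) * qpoch t t ^ 6) = c0.
Proof.
  exists (- (2) * (ee (/ 8) * ee (- / 4) * ee (- / 4))). split.
  { repeat apply Cmult_neq_0; try apply ee_neq0. rewrite <- RtoC_opp. nzc. }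
  intros t Ht. pose proof (qpoch_tau_neq0 t Ht) as N. unfold klein, theta_quot.
  rewrite !RtoC_inv by lra.
  replace (/ 2 * t + 0) with (t / 2) by (field; nzc).
  replace (0 * t + / 2) with (/ 2) by (field; nzc).
  replace (/ 2 * t + / 2) with (t / 2 + / 2) by (field; nzc).
  replace (t - t / 2) with (t / 2) by (field; nzc).
  replace (t - (t / 2 + / 2)) with ((t / 2 + / 2) + IZR (-1)) by (field; nzc).
  replace (t - / 2) with ((t + / 2) + IZR (-1)) by (field; nzc).
  rewrite !qpoch_plus_Z, (qpoch_shift (/ 2)) by auto.
  replace (/ 2 + t) with (t + / 2) by ring.
  rewrite ee_half. pose proof (euler_odd_distinct t Ht) as E.
   set (a := qpoch (t / 2) t) in *.
  set (b := qpoch (t / 2 + / 2) t) in *. set (c := qpoch (t + / 2) t) in *.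
  set (e1 := ee (/ 2 * (t / 2) / 2)). set (e2 := ee (- (t / 2 / 2))).
  set (e3 := ee (0 * / 2 / 2)). set (e4 := ee (- (/ 2 / 2))).
  set (e5 := ee (/ 2 * (t / 2 + / 2) / 2)). set (e6 := ee (- ((t / 2 + / 2) / 2))).
  set (e7 := ee (t / 4)).
  transitivity (- (2) * (e1 * e2 * e3 * e4 * e5 * e6 * e7) * ((a * b * c) * (a * b * c))).
  { field; auto. }
  rewrite E. replace (e1 * e2 * e3 * e4 * e5 * e6 * e7) with (ee (/ 8) * ee (- / 4) * ee (- / 4)).
  { ring. }
  unfold e1, e2, e3, e4, e5, e6, e7. rewrite <- !ee_plus. f_equal. field; nzc.
Qed.
Local Opaque theta_quot.

Lemma Delta_neq0 (t : C) : (0 < Im t)%R -> Delta t <> 0.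
Proof.
  intros Ht. apply Cmult_neq_0; [apply ee_neq0|]. apply Cpow_nz. now apply qpoch_tau_neq0.
Qed.

Lemma Delta_tau_plus_Z (t : C) (k : Z) : Delta (t + IZR k) = Delta t.
Proof. unfold Delta. now rewrite ee_plus_Z, qpoch_tau_plus_Z, qpoch_plus_Z. Qed.

Lemma Delta_klein_half :
  exists c0 : C, c0 <> 0 /\ forall t, (0 < Im t)%R ->
    (klein (/ 2) 0 t * klein 0 (/ 2) t * klein (/ 2) (/ 2) t) ^ 4 * Delta t = c0.
Proof.
  destruct klein_half_product as [c0 [N0 H]]. exists (c0 ^ 4). split; [now apply Cpow_nz|].
  intros t Ht. rewrite <- (H t Ht). set (W := _ * klein (/ 2) (/ 2) t).
  rewrite Cpow_mult_l. f_equal. unfold Delta.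
  rewrite Cpow_mult_l, <- Cpow_mult_r, <- ee_nat. simpl (6 * 4)%nat. f_equal. f_equal.
  simpl. rewrite !RtoC_plus. field; nzc.
Qed.

(** Inversion permutes the three points of order two up to signs and integer shifts. The fourth
    power removes the resulting roots of unity, and the three factors 1/t become t^(-12). *)
Lemma Delta_inversion (t : C) : (0 < Im t)%R -> Delta (- / t) = t ^ 12 * Delta t.
Proof.
  intros Ht. pose proof (upper_neq0 t Ht) as T0.
  destruct Delta_klein_half as [c0 [N0 H]].
  pose proof (H t Ht) as E1. pose proof (H _ (Im_neg_inv t Ht)) as E2.
  assert (Ea : klein 0 (- / 2) t = - klein 0 (/ 2) t).
  { rewrite <- klein_opp by auto. f_equal. ring. }
  assert (Eb : klein (/ 2) (/ 2) t = ee (3 / 4) * klein (/ 2) (- / 2) t).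
  { replace (/ 2)%R with (- / 2 + 1)%R at 2 by field. rewrite klein_s_plus_1.
    f_equal. f_equal. rewrite RtoC_inv by lra. field; nzc. }
  rewrite !klein_inversion, Ropp_0, Ea in E2 by auto.
  set (x := klein (/ 2) 0 t) in *. set (y := klein 0 (/ 2) t) in *.
  set (z' := klein (/ 2) (- / 2) t) in *. rewrite Eb in E1.
  assert (E3 : ee (3 / 4) ^ 4 = 1).
  { rewrite <- ee_nat. replace (INR 4 * (3 / 4)) with (RtoC (IZR 3)).
    - apply ee_Z.
    - simpl. rewrite !RtoC_plus. field; nzc. }
  assert (E4 : (x * y * z') ^ 4 * Delta t = c0).
  { rewrite <- E1. replace (x * y * (ee (3 / 4) * z')) with (ee (3 / 4) * (x * y * z')) by ring.
    rewrite (Cpow_mult_l (ee (3 / 4))), E3. ring. }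
  assert (N : (x * y * z') ^ 4 <> 0).
  { intros F. apply N0. rewrite <- E4, F. ring. }
  set (w := (x * y * z') ^ 4) in *.
  assert (E5 : / t ^ 12 * w * Delta (- / t) = c0).
  { rewrite <- E2. unfold w. field; auto. }
  replace (Delta (- / t)) with (t ^ 12 * / w * (/ t ^ 12 * w * Delta (- / t))).
  - rewrite E5, <- E4. field; auto.
  -  field; auto.
Qed.

Lemma Delta_SL2 (a b c d : Z) (t : C) :
  (a * d - b * c = 1)%Z -> (0 < Im t)%R ->
  Delta ((IZR a * t + IZR b) / (IZR c * t + IZR d)) = (IZR c * t + IZR d) ^ 12 * Delta t.
Proof.
  intros Hd Ht.
  apply (SL2_ind (fun a b c d =>
   Delta ((IZR a * t + IZR b) / (IZR c * t + IZR d)) = (IZR c * t + IZR d) ^ 12 * Delta t)); auto;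
   clear a b c d Hd.
  - intros k. replace ((1 * t + IZR k) / (0 * t + 1)) with (t + IZR k) by (field; nzc).
    rewrite Delta_tau_plus_Z. ring.
  - intros k.
    replace (((-1) * t + IZR k) / (0 * t + (-1))) with (t + IZR (- k)).
    2:{ rewrite opp_IZR, RtoC_opp. field; nzc. }
    rewrite Delta_tau_plus_Z. ring.
  - intros k a b c d Hd IH.
    rewrite (SL2_step_eq k a b c d t Ht Hd), Delta_tau_plus_Z.
    rewrite Delta_inversion by (apply moebius_upper; auto; lia).
    rewrite IH.
    assert (N1 : IZR c * t + IZR d <> 0) by (apply (denominator_neq0 a b c d); auto; lia).
    rewrite Cmult_assoc, <- Cpow_mult_l. f_equal. f_equal. field; auto.
Qed.

(** * The product j in terms of Klein forms *)

Local Opaque klein Delta.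

(** * Integral powers *)

Lemma Cpowz_nat (a : C) (n : nat) : Cpowz a (Z.of_nat n) = a ^ n.
Proof.
  destruct n as [|n]; [reflexivity|]. simpl Z.of_nat. unfold Cpowz.
  now rewrite SuccNat2Pos.id_succ.
Qed.

Lemma Cpowz_opp_nat (a : C) (n : nat) : Cpowz a (- Z.of_nat n) = / a ^ n.
Proof.
  destruct n as [|n]; [simpl; field; nzc|]. simpl Z.of_nat. simpl Z.opp. unfold Cpowz.
  now rewrite SuccNat2Pos.id_succ.
Qed.

Lemma Cpowz_succ (a : C) (k : Z) : a <> 0 -> Cpowz a (k + 1) = Cpowz a k * a.
Proof.
  intros Ha. revert k. apply Zind_abs; intros n.
  - replace (Z.of_nat n + 1)%Z with (Z.of_nat (S n)) by lia.
    rewrite !Cpowz_nat. simpl. ring.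
  - destruct n as [|n]; [simpl; ring|].
    replace (- Z.of_nat (S n) + 1)%Z with (- Z.of_nat n)%Z by lia.
    rewrite !Cpowz_opp_nat. simpl. pose proof (Cpow_nz a n Ha). field; auto.
Qed.

Lemma Cmult_cancel_r (a x y : C) : a <> 0 -> x = y <-> x * a = y * a.
Proof.
  intros Ha. split; intros H; [now rewrite H|].
  replace x with (x * a / a) by (field; auto). rewrite H. field; auto.
Qed.

Lemma Cpowz_add (a : C) (k l : Z) : a <> 0 -> Cpowz a (k + l) = Cpowz a k * Cpowz a l.
Proof.
  intros Ha. revert l. apply Z_shift_ind.
  - rewrite Z.add_0_r. simpl. ring.
  - intros l. rewrite Z.add_assoc, !Cpowz_succ, Cmult_assoc by auto.
    now apply Cmult_cancel_r.
Qed.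

Lemma Cpowz_mult_l (a b : C) (k : Z) : a <> 0 -> b <> 0 ->
  Cpowz (a * b) k = Cpowz a k * Cpowz b k.
Proof.
  intros Ha Hb. pose proof (Cmult_neq_0 a b Ha Hb) as Hab.
  revert k. apply Z_shift_ind; [simpl; ring|].
  intros k. rewrite !Cpowz_succ by auto.
  replace (Cpowz a k * a * (Cpowz b k * b)) with (Cpowz a k * Cpowz b k * (a * b)) by ring.
  now apply Cmult_cancel_r.
Qed.

Lemma Cpowz_pow (a : C) (n : nat) (k : Z) : a <> 0 ->
  Cpowz (a ^ n) k = Cpowz a (Z.of_nat n * k).
Proof.
  intros Ha. pose proof (Cpow_nz a n Ha) as Hn. revert k. apply Z_shift_ind.
  - rewrite Z.mul_0_r. reflexivity.
  - intros k. rewrite Cpowz_succ, Z.mul_add_distr_l, Z.mul_1_r, Cpowz_add, Cpowz_nat by auto.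
    now apply Cmult_cancel_r.
Qed.

Lemma Cpowz_inv (a : C) (k : Z) : a <> 0 -> Cpowz (/ a) k = Cpowz a (- k).
Proof.
  intros Ha. pose proof (Cinv_neq0 a Ha) as Hi. revert k. apply Z_shift_ind; [reflexivity|].
  intros k. rewrite Cpowz_succ by auto.
  replace (- k)%Z with (- (k + 1) + 1)%Z by lia. rewrite Cpowz_succ by auto.
  rewrite (Cmult_cancel_r (/ a) (Cpowz (/ a) k)) by auto.
  replace (Cpowz a (- (k + 1)) * a * / a) with (Cpowz a (- (k + 1))) by (field; auto).
  reflexivity.
Qed.

Lemma Cpowz_ee (w : C) (k : Z) : Cpowz (ee w) k = ee (IZR k * w).
Proof.
  pose proof (ee_neq0 w) as N. revert k. apply Z_shift_ind.
  - rewrite Cmult_0_l, ee_0. reflexivity.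
  - intros k. rewrite Cpowz_succ, plus_IZR, RtoC_plus by auto.
    replace ((IZR k + 1) * w) with (IZR k * w + w) by ring. rewrite ee_plus.
    now apply Cmult_cancel_r.
Qed.

Fixpoint zsum (u : nat -> Z) (n : nat) : Z :=
  match n with O => 0%Z | S k => (zsum u k + u k)%Z end.

Lemma zsum_S_l (u : nat -> Z) (n : nat) : zsum u (S n) = (u O + zsum (fun i => u (S i)) n)%Z.
Proof. induction n as [|n IH]; simpl in *; lia. Qed.

Lemma zsum_ext (u v : nat -> Z) (n : nat) : (forall i, u i = v i) -> zsum u n = zsum v n.
Proof. intros H. induction n as [|n IH]; simpl; auto. now rewrite IH, H. Qed.

Lemma Zsum_zsum (u : nat -> Z) (k n : nat) :
  Zsum (map u (seq k n)) = zsum (fun i => u (k + i)%nat) n.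
Proof.
  revert k. induction n as [|n IH]; intros k; auto.
  rewrite zsum_S_l. simpl. rewrite IH, Nat.add_0_r. f_equal.
  apply zsum_ext. intros i. f_equal. lia.
Qed.

Lemma prodn_Cpowz_const (a : C) (m : nat -> Z) (n : nat) : a <> 0 ->
  prodn (fun i => Cpowz a (m i)) n = Cpowz a (zsum m n).
Proof.
  intros Ha. induction n as [|n IH]; simpl; auto. now rewrite IH, Cpowz_add.
Qed.

Lemma qpow_ee (r : R) (z : C) : qpow r z = ee (r * z).
Proof. Transparent ee. unfold qpow, ee. Opaque ee. f_equal. ring. Qed.

Lemma eta_qpoch (t : C) : (0 < Im t)%R -> eta t = ee (t / 24) * qpoch t t.
Proof.
  intros Ht. unfold eta. rewrite !qpow_ee.
  replace ((1 / 24)%R * t) with (t / 24) by (rewrite RtoC_div by lra; field; nzc).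
  now rewrite Cmult_1_l.
Qed.

Lemma eta_neq0 (t : C) : (0 < Im t)%R -> eta t <> 0.
Proof.
  intros Ht. rewrite eta_qpoch by auto. apply Cmult_neq_0; [apply ee_neq0|].
  now apply qpoch_tau_neq0.
Qed.

Lemma eta_pow_24 (t : C) : (0 < Im t)%R -> eta t ^ 24 = Delta t.
Proof.
  intros Ht. rewrite eta_qpoch, Cpow_mult_l, <- ee_nat by auto.
  Transparent Delta. unfold Delta. Opaque Delta. f_equal. f_equal.
  rewrite INR_IZR_INZ. simpl Z.of_nat. field; nzc.
Qed.

Lemma Im_scal_pos (x : R) (z : C) : (0 < x)%R -> (0 < Im z)%R -> (0 < Im (x * z))%R.
Proof. intros Hx Hz. rewrite im_scal_l. nra. Qed.

Lemma f_klein (N rho : Z) (z : C) : (0 < N)%Z -> upper_half_plane z ->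
  Defs.f N rho z = eta (IZR N * z) ^ 3 * - klein (IZR rho / IZR N) 0 (IZR N * z).
Proof.
  unfold upper_half_plane. intros HN Hz. apply IZR_lt in HN as HN'.
  pose proof (Im_scal_pos _ _ HN' Hz) as Ht. set (t := IZR N * z) in *.
  assert (N0 : RtoC (IZR N) <> 0) by (apply RtoC_neq0; lra).
  pose proof (qpoch_tau_neq0 t Ht) as G0.
  rewrite eta_qpoch by auto. unfold Defs.f. rewrite !qpow_ee. fold t.
  Transparent qpoch klein theta_quot. unfold klein, theta_quot.
  replace ((IZR rho / IZR N)%R * t + 0%R) with (IZR rho * z)
    by (rewrite RtoC_div by lra; unfold t; field; auto).
  change (qpoch_inf (ee (IZR rho * z)) (ee t)) with (qpoch (IZR rho * z) t).
  change (qpoch_inf (ee (IZR (N - rho) * z)) (ee t)) with (qpoch (IZR (N - rho) * z) t).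
  change (qpoch_inf (ee t) (ee t)) with (qpoch t t). Opaque qpoch klein theta_quot.
  replace (IZR (N - rho) * z) with (t - IZR rho * z)
    by (rewrite minus_IZR, RtoC_minus; unfold t; ring).
  (* The exponent is N/8 + rho^2/(2N) - rho/2: three copies of t/24 for eta^3, then the prefactors
     of the Klein form and of the theta quotient. *)
  replace (((IZR N - 2 * IZR rho) ^ 2 / (8 * IZR N))%R * z) with
    (t / 24 + t / 24 + t / 24 + (IZR rho / IZR N)%R * (IZR rho * z) / 2
     + - (IZR rho * z / 2)).
  - rewrite !ee_plus.  field; auto.
  - rewrite !RtoC_div, RtoC_mult, RtoC_pow by lra. rewrite RtoC_minus, RtoC_mult.
    unfold t. field; nzc.
Qed.

Lemma klein_neq0 (r s : R) (t : C) : (0 < Im t)%R ->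
  ~ ((exists a, r = IZR a) /\ (exists b, s = IZR b)) -> klein r s t <> 0.
Proof.
  intros Ht Hrs. Transparent klein. unfold klein. Opaque klein.
  apply Cmult_neq_0; [apply ee_neq0|]. apply theta_quot_neq0; auto.
  intros [m [n E]]. apply Hrs.
  destruct (lattice_point_eq0 t (s - IZR m) (r - IZR n) Ht) as [E1 E2].
  - rewrite !RtoC_minus. replace (s - IZR m + (r - IZR n) * t) with
      ((r * t + s) - (IZR m + IZR n * t)) by ring. rewrite E. ring.
  - split; [exists n|exists m]; lra.
Qed.

(** [Delta] to the power T has weight 12 T and each Klein form weight -1, so this says that the
    product has weight 1. *)
Definition weight_vector (T : Z) (h : nat) (n : nat -> Z) : Prop :=
  (12 * T - zsum (fun i => n (S i)) h = 1)%Z.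

(** The pair (a, b) is the first row of the matrix applied so far, giving the characteristics
    (k/p)(a, b); the row (1, 0) belongs to j itself. The second row affects only the automorphy
    factor. *)
Definition klein_product (p h : nat) (n : nat -> Z) (T a b : Z) (t : C) : C :=
  Cpowz (Delta t) T * prodn (fun i => Cpowz (- klein (INR (S i) / INR p * IZR a)
                                            (INR (S i) / INR p * IZR b) t) (n (S i))) h.

Section Transformation.
Context (p : nat) (n : nat -> Z) (T : Z).
Context (hp : prime (Z.of_nat p)) (hp3 : (3 < p)%nat).
Let h := ((p - 1) / 2)%nat.

Lemma index_bound (i : nat) : (i < h)%nat -> (S i < p)%nat.
Proof.
  unfold h. intros Hi. pose proof (Nat.div_mod_eq (p - 1) 2). lia.
Qed.

Lemma rational_not_integer (k : nat) (x : Z) :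
  (0 < k < p)%nat -> ~ (Z.of_nat p | x)%Z ->
  forall y : Z, (INR k / INR p * IZR x)%R <> IZR y.
Proof.
  intros Hk Hx y E. assert (P : (0 < INR p)%R) by (apply lt_0_INR; lia).
  assert (E2 : (INR k * IZR x = INR p * IZR y)%R) by (rewrite <- E; field; lra).
  rewrite !INR_IZR_INZ, <- !mult_IZR in E2. apply eq_IZR in E2.
  assert (D : (Z.of_nat p | Z.of_nat k * x)%Z) by (exists y; lia).
  apply prime_mult in D as [D|D]; auto.
  apply Z.divide_pos_le in D; lia.
Qed.

(** The rules for [Cpowz] are stated for nonzero bases. The characteristic (k/p)(a, b) is not
    integral because p divides neither k nor both entries of a primitive row. *)
Lemma klein_factor_neq0 (i : nat) (a b : Z) (t : C) : (0 < Im t)%R -> (i < h)%nat ->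
  (exists c d, a * d - b * c = 1)%Z \/ (~ (Z.of_nat p | a) \/ ~ (Z.of_nat p | b))%Z ->
  - klein (INR (S i) / INR p * IZR a) (INR (S i) / INR p * IZR b) t <> 0.
Proof.
  intros Ht Hi Hab. apply Copp_neq0, klein_neq0; auto. apply index_bound in Hi.
  assert (Hab' : (~ (Z.of_nat p | a) \/ ~ (Z.of_nat p | b))%Z).
  { destruct Hab as [[c [d E]]|]; auto.
    destruct (Zdivide_dec (Z.of_nat p) a) as [Da|]; auto.
    destruct (Zdivide_dec (Z.of_nat p) b) as [Db|]; auto.
    exfalso. assert (D : (Z.of_nat p | 1)%Z).
    { rewrite <- E. apply Z.divide_sub_r; now apply Z.divide_mul_l. }
    apply Z.divide_pos_le in D; lia. }
  intros [[x Ex] [y Ey]]. destruct Hab' as [H|H].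
  - now apply (rational_not_integer (S i) a ltac:(lia) H x).
  - now apply (rational_not_integer (S i) b ltac:(lia) H y).
Qed.

Lemma j_klein_product (z : C) :
  (n 0%nat + 3 * zsum (fun i => n (S i)) h = 24 * T)%Z ->
  upper_half_plane z -> j p n z = klein_product p h n T 1 0 (INR p * z).
Proof.
  intros H3 Hz. unfold upper_half_plane in Hz.
  assert (P : (0 < INR p)%R) by (apply lt_0_INR; lia).
  pose proof (Im_scal_pos _ _ P Hz) as Ht.
  unfold j, klein_product. fold h. rewrite prodn_Cprod. set (t := INR p * z) in *.
  pose proof (eta_neq0 t Ht) as E0.
  rewrite (prodn_ext _ (fun i => Cpowz (eta t ^ 3) (n (S i)) *
     Cpowz (- klein (INR (S i) / INR p * 1) (INR (S i) / INR p * 0) t) (n (S i)))).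
  - rewrite prodn_mult, prodn_Cpowz_const, Cpowz_pow, Cmult_assoc by (auto; now apply Cpow_nz).
    f_equal. rewrite <- Cpowz_add by auto.
    rewrite <- eta_pow_24, Cpowz_pow by auto. f_equal. lia.
  - intros i Hi. simpl (1 + i)%nat.
    rewrite f_klein by (auto; lia). rewrite <- !INR_IZR_INZ. fold t.
    rewrite Rmult_1_r, Rmult_0_r. apply Cpowz_mult_l; [now apply Cpow_nz|].
    pose proof (klein_factor_neq0 i 1 0 t Ht Hi ltac:(left; now exists 0%Z, 1%Z)) as N.
    now rewrite Rmult_1_r, Rmult_0_r in N.
Qed.

Lemma klein_product_SL2 (a b c d : Z) (t : C) :
  weight_vector T h n -> (0 < Im t)%R -> (a * d - b * c = 1)%Z ->
  klein_product p h n T 1 0 ((IZR a * t + IZR b) / (IZR c * t + IZR d))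
  = (IZR c * t + IZR d) * klein_product p h n T a b t.
Proof.
  intros Hw Ht Hd. unfold klein_product.
  assert (N0 : IZR c * t + IZR d <> 0) by (apply (denominator_neq0 a b c d); auto; lia).
  pose proof (Delta_neq0 t Ht) as D0.
  set (w := IZR c * t + IZR d) in *.
  rewrite (prodn_ext _ (fun i => Cpowz (/ w) (n (S i)) *
     Cpowz (- klein (INR (S i) / INR p * IZR a) (INR (S i) / INR p * IZR b) t) (n (S i)))).
  - rewrite prodn_mult, prodn_Cpowz_const, Cpowz_inv by (auto; now apply Cinv_neq0).
    unfold w at 1. rewrite Delta_SL2 by auto. fold w.
    rewrite Cpowz_mult_l, Cpowz_pow by (auto; now apply Cpow_nz).
    set (P := prodn _ _). set (s := zsum _ _) in *.
    transitivity (Cpowz w (Z.of_nat 12 * T + - s) * (Cpowz (Delta t) T * P)).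
    + rewrite Cpowz_add by auto. ring.
    + f_equal. unfold weight_vector in Hw. fold s in Hw.
      replace (Z.of_nat 12 * T + - s)%Z with (Z.of_nat 1) by lia.
      rewrite Cpowz_nat. simpl. ring.
  - intros i Hi. unfold w at 1. rewrite klein_SL2 by auto. fold w.
    rewrite !Rmult_1_r, !Rmult_0_r, !Rmult_0_l, !Rplus_0_r.
    set (x := klein _ _ t). replace (- (/ w * x)) with (/ w * - x) by ring.
    apply Cpowz_mult_l; [now apply Cinv_neq0|]. apply klein_factor_neq0; auto.
    left. now exists c, d.
Qed.

End Transformation.

Lemma slash_1_SL2 (F : C -> C) (A : mat2) (z : C) : SL2Z A ->
  slash 1 F A z = / (IZR (mc A) * z + IZR (md A)) * F (moebius A z).
Proof.
  unfold SL2Z, slash. intros ->. unfold Rpower. rewrite ln_1, Rmult_0_r, exp_0.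
  replace (Cpowz _ (- (1))) with (/ (IZR (mc A) * z + IZR (md A))); [ring|].
  simpl. now rewrite Cmult_1_r.
Qed.

Lemma csum_linear (al be : C) (m : nat -> Z) (x y : nat -> Z) (k : nat) :
  csum (fun i => IZR (m i) * (al * IZR (x i) + be * IZR (y i))) k
  = al * IZR (zsum (fun i => x i * m i)%Z k) + be * IZR (zsum (fun i => y i * m i)%Z k).
Proof.
  induction k as [|k IH]; simpl; [ring|].
  rewrite IH, !plus_IZR, !mult_IZR, !RtoC_plus, !RtoC_mult. ring.
Qed.

Lemma prodn_Cpowz_ee (w : nat -> C) (m : nat -> Z) (k : nat) :
  prodn (fun i => Cpowz (ee (w i)) (m i)) k = ee (csum (fun i => IZR (m i) * w i) k).
Proof.
  induction k as [|k IH]; simpl; [now rewrite ee_0|].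
  now rewrite IH, ee_plus, Cpowz_ee.
Qed.

Lemma zsum_parity (m : nat -> Z) (k : nat) :
  (2 | zsum (fun i => Z.of_nat (S i) ^ 2 * m (S i)) k
       - zsum (fun i => Z.of_nat (S i) * m (S i)) k)%Z.
Proof.
  induction k as [|k [q IH]]; [now exists 0%Z|]. cbn [zsum].
  assert (E : exists e, (Z.of_nat (S k) ^ 2 - Z.of_nat (S k) = 2 * e)%Z).
  { destruct (Z.Even_or_Odd (Z.of_nat (S k))) as [[e He]|[e He]]; rewrite He.
    - exists (2 * e * e - e)%Z. ring.
    - exists (2 * e * e + e)%Z. ring. }
  destruct E as [e He]. exists (q + e * m (S k))%Z. nia.
Qed.

(* The sign (-1)^(...) produced by the Klein forms is trivial because a and b
   cannot both be even. *)
Lemma sign_parity (p a b d c a1 s1 s2 m t0 : Z) :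
  (a * d - b * c = 1 -> a = 1 + p * a1 -> Z.Odd p -> (2 | s2 - s1) ->
   s2 - 2 * m = p * t0 -> exists q, s1 * (a1 + b) - s2 * a1 * b + t0 * b = 2 * q)%Z.
Proof.
  intros Hd Ha [p' Hp] [e He] Hs.
  assert (A : exists f, (a1 * (1 + b) = 2 * f)%Z).
  { destruct (Z.Even_or_Odd a1) as [[x Hx]|[x Hx]].
    - exists (x * (1 + b))%Z. rewrite Hx. ring.
    - destruct (Z.Even_or_Odd b) as [[y Hy]|[y Hy]].
      + exfalso. subst. assert (H2 : exists w, (1 = 2 * w)%Z).
        { exists ((1 + p' + x + 2 * p' * x) * d - y * c)%Z. lia. }
        destruct H2 as [w Hw]. lia.
      + exists (a1 * (1 + y))%Z. rewrite Hy. ring. }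
  destruct A as [f Hf].
  (* s2 = t0 + 2 (p' t0 + m), s1 = s2 - 2 e *)
  exists (t0 * f - t0 * a1 * b + t0 * b + (p' * t0 + m) * (a1 + b - a1 * b)
          - e * (a1 + b))%Z.
  assert (E1 : (s2 = t0 + 2 * (p' * t0 + m))%Z) by (subst p; lia).
  assert (E2 : (s1 = s2 - 2 * e)%Z) by lia.
  rewrite E2, E1.
  replace (2 * (t0 * f - t0 * a1 * b + t0 * b + (p' * t0 + m) * (a1 + b - a1 * b)
          - e * (a1 + b)))%Z with
   (t0 * (2 * f) + 2 * (- t0 * a1 * b + t0 * b + (p' * t0 + m) * (a1 + b - a1 * b)
          - e * (a1 + b)))%Z by ring.
  rewrite <- Hf. ring.
Qed.

Lemma klein_product_Gamma1 (p : nat) (n : nat -> Z) (T m a b c d a1 : Z) (t : C) :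
  let h := ((p - 1) / 2)%nat in
  prime (Z.of_nat p) -> (3 < p)%nat -> (0 < Im t)%R ->
  (Z.of_nat p | zsum (fun i => Z.of_nat (S i) ^ 2 * n (S i)) h - 2 * m)%Z ->
  (a * d - b * c = 1)%Z -> (a = 1 + Z.of_nat p * a1)%Z ->
  klein_product p h n T a (Z.of_nat p * b) t
  = ee (IZR b * IZR m / INR p) * klein_product p h n T 1 0 t.
Proof.
  intros h hp hp3 Ht [t0 H2] Hd Ha.
  assert (P0 : (INR p <> 0)%R) by (apply not_0_INR; lia).
  unfold klein_product.
  (* From (k/p)(1, 0) to (k/p)(a, p b) the shifts are k a1 in r and k b in s; their multipliers
     combine to e(al k + be k^2). *)
  set (al := (IZR a1 + IZR b) / 2).
  set (be := (IZR b / INR p - IZR a1 * IZR b) / 2).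
  rewrite (prodn_ext _ (fun i =>
     Cpowz (ee (al * IZR (Z.of_nat (S i)) + be * IZR (Z.of_nat (S i) ^ 2))) (n (S i))
     * Cpowz (- klein (INR (S i) / INR p * 1) (INR (S i) / INR p * 0) t) (n (S i)))).
  - rewrite prodn_mult, prodn_Cpowz_ee, csum_linear.
    set (s1 := zsum (fun i => Z.of_nat (S i) * n (S i))%Z h).
    set (s2 := zsum (fun i => Z.of_nat (S i) ^ 2 * n (S i))%Z h) in *.
    assert (Hodd : Z.Odd (Z.of_nat p)).
    { destruct (Z.Even_or_Odd (Z.of_nat p)) as [[x Hx]|]; auto. exfalso.
      destruct (prime_divisors _ hp 2 ltac:(exists x; lia)); lia. }
    destruct (sign_parity (Z.of_nat p) a b d c a1 s1 s2 m t0) as [q Hq]; auto; [|lia|].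
    { apply zsum_parity. }
    (* Condition (2), s2 = 2 m + p t0, splits off b m/p; the rest is half of the integer that
       [sign_parity] shows to be even. *)
    replace (al * IZR s1 + be * IZR s2) with (IZR b * IZR m / INR p + IZR q).
    + rewrite ee_plus_Z. ring.
    + apply (f_equal IZR) in Hq. apply (f_equal IZR) in H2.
      rewrite !plus_IZR, minus_IZR, !mult_IZR, plus_IZR in Hq.
      rewrite minus_IZR, !mult_IZR, <- INR_IZR_INZ in H2.
      apply (f_equal RtoC) in Hq. apply (f_equal RtoC) in H2.
      rewrite !RtoC_plus, RtoC_minus, !RtoC_mult, RtoC_plus in Hq.
      rewrite RtoC_minus, !RtoC_mult in H2.
      unfold al, be.
      replace (RtoC (IZR q)) with (2 * IZR q / 2) by (field; nzc). rewrite <- Hq.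
      replace (RtoC (IZR s2)) with (IZR s2 - 2 * IZR m + 2 * IZR m) by ring.
      rewrite H2. field; nzc.
  - intros i Hi. set (k := INR (S i)).
    assert (Nk : - klein (k / INR p * 1) (k / INR p * 0) t <> 0).
    { apply (klein_factor_neq0 p hp hp3 i 1 0 t Ht Hi). left. now exists 0%Z, 1%Z. }
    rewrite <- Cpowz_mult_l by (auto; apply ee_neq0). f_equal.
    replace (k / INR p * IZR a)%R with (k / INR p * 1 + IZR (Z.of_nat (S i) * a1))%R.
    2:{ rewrite Ha, plus_IZR, !mult_IZR, <- !INR_IZR_INZ. fold k. field; auto. }
    replace (k / INR p * IZR (Z.of_nat p * b))%R
      with (k / INR p * 0 + IZR (Z.of_nat (S i) * b))%R.
    2:{ rewrite !mult_IZR, <- !INR_IZR_INZ. fold k. field; auto. }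
    rewrite klein_r_plus_Z, klein_s_plus_Z by auto.
    set (x := klein (k / INR p * 1) (k / INR p * 0) t).
    match goal with |- - (ee ?u * (ee ?v * x)) = _ =>
      replace (- (ee u * (ee v * x))) with (ee u * ee v * - x) by ring end.
    f_equal. rewrite <- ee_plus. f_equal.
    rewrite Z.pow_2_r, !mult_IZR, <- !INR_IZR_INZ. fold k.
    rewrite ?Rmult_0_r, ?Rmult_1_r, ?Rplus_0_l.
    rewrite ?RtoC_plus, !RtoC_mult, RtoC_div by auto.
    rewrite ?Rmult_0_r. unfold al, be. field; nzc.
Qed.

Lemma slash_j_Gamma1 (p : nat) (m : Z) (n : nat -> Z) (T : Z) (A : mat2) (z : C) :
  let h := ((p - 1) / 2)%nat in
  prime (Z.of_nat p) -> (3 < p)%nat ->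
  (n 0%nat + 3 * zsum (fun i => n (S i)) h = 24 * T)%Z ->
  weight_vector T h n ->
  (Z.of_nat p | zsum (fun i => Z.of_nat (S i) ^ 2 * n (S i)) h - 2 * m)%Z ->
  Gamma1 (Z.of_nat p) A -> upper_half_plane z ->
  slash 1 (j p n) A z = ee (IZR (mb A) * IZR m / INR p) * j p n z.
Proof.
  intros h hp hp3 H3 Hw H2 [HS [[a1 Ha] [[c1 Hc] Hd]]] Hz.
  rewrite slash_1_SL2 by auto. destruct A as [a b c d]. unfold SL2Z, det2, moebius in *.
  simpl in *. unfold upper_half_plane in Hz.
  assert (P : (0 < INR p)%R) by (apply lt_0_INR; lia).
  pose proof (Im_scal_pos _ _ P Hz) as Ht.
  assert (N0 : IZR c * z + IZR d <> 0) by (apply (denominator_neq0 a b c d); auto; lia).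
  rewrite !(j_klein_product p n T hp hp3) by
    (auto; unfold upper_half_plane; apply moebius_upper; auto; lia).
  fold h.
  (* Conjugation by z -> p z turns the matrix into one with rows (a, p b) and (c/p, d), integral
     because p divides c. *)
  replace (INR p * ((IZR a * z + IZR b) / (IZR c * z + IZR d))) with
    ((IZR a * (INR p * z) + IZR (Z.of_nat p * b)) / (IZR c1 * (INR p * z) + IZR d)).
  2:{ rewrite Hc, !mult_IZR, <- INR_IZR_INZ, !RtoC_mult. field.
      rewrite Hc, mult_IZR, <- INR_IZR_INZ, RtoC_mult in N0.
      intros E. apply N0. rewrite <- E. ring. }
  rewrite (klein_product_SL2 p n T hp hp3) by (auto; nia). fold h.
  rewrite (klein_product_Gamma1 p n T m a b c d a1) by (auto; lia). fold h.
  replace (IZR c1 * (INR p * z) + IZR d) with (IZR c * z + IZR d).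
  2:{ rewrite Hc, mult_IZR, <- INR_IZR_INZ, RtoC_mult. ring. }
  field; auto.
Qed.

(** * Power series on the unit disc *)

(** Absolute convergence on every smaller disc, in the form that Cauchy products and termwise
    differentiation consume. *)
Definition ps_bounded (a : nat -> C) : Prop :=
  forall r, (0 <= r < 1)%R -> exists B, forall n, (rsum (fun i => Cmod (a i) * r ^ i) n <= B)%R.

Definition has_ps (a : nat -> C) (g : C -> C) : Prop :=
  ps_bounded a /\
  forall t, (Cmod t < 1)%R -> Ccvg (csum (fun i => a i * t ^ i)) (g t).

Definition PS (g : C -> C) : Prop := exists a, has_ps a g.

Definition conv (a b : nat -> C) (i : nat) : C := csum (fun k => a k * b (i - k)%nat) (S i).

Lemma csum_triangle (x y : nat -> C) (n : nat) :
  csum (fun i => csum (fun k => x k * y (i - k)%nat) (S i)) n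
  = csum (fun k => x k * csum y (n - k)) n.
Proof.
  induction n as [|n IH]; auto.
  change (csum ?u (S n)) with (csum u n + u n) at 1. cbv beta. rewrite IH.
  replace (csum (fun k => x k * csum y (S n - k)) (S n)) with
    (csum (fun k => x k * csum y (n - k) + x k * y (n - k)%nat) (S n)).
  2:{ apply csum_ext. intros k Hk. replace (S n - k)%nat with (S (n - k)) by lia.
      simpl. ring. }
  rewrite csum_plus. f_equal. simpl. rewrite Nat.sub_diag. simpl. ring.
Qed.

Lemma rsum_plus (u v : nat -> R) (n : nat) :
  rsum (fun i => u i + v i)%R n = (rsum u n + rsum v n)%R.
Proof. induction n as [|n IH]; simpl; [ring|]. rewrite IH. ring. Qed.

Lemma rsum_triangle (x y : nat -> R) (n : nat) :
  rsum (fun i => rsum (fun k => x k * y (i - k)%nat)%R (S i)) n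
  = rsum (fun k => x k * rsum y (n - k))%R n.
Proof.
  induction n as [|n IH]; auto.
  change (rsum ?u (S n)) with (rsum u n + u n)%R at 1. cbv beta. rewrite IH.
  replace (rsum (fun k => x k * rsum y (S n - k))%R (S n)) with
    (rsum (fun k => x k * rsum y (n - k) + x k * y (n - k)%nat)%R (S n)).
  2:{ apply rsum_ext. intros k Hk. replace (S n - k)%nat with (S (n - k)) by lia.
      simpl. ring. }
  rewrite rsum_plus. f_equal. simpl. rewrite Nat.sub_diag. simpl. ring.
Qed.

Lemma conv_rsum_le (a b : nat -> C) (r : R) (n : nat) : (0 <= r)%R ->
  (rsum (fun i => Cmod (conv a b i) * r ^ i) n
   <= rsum (fun i => Cmod (a i) * r ^ i) n * rsum (fun i => Cmod (b i) * r ^ i) n)%R.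
Proof.
  intros Hr. set (x := fun i => (Cmod (a i) * r ^ i)%R). set (y := fun i => (Cmod (b i) * r ^ i)%R).
  assert (X0 : forall i, (0 <= x i)%R) by (intros; apply Rmult_le_pos; [apply Cmod_ge_0|now apply pow_le]).
  assert (Y0 : forall i, (0 <= y i)%R) by (intros; apply Rmult_le_pos; [apply Cmod_ge_0|now apply pow_le]).
  eapply Rle_trans; [apply (rsum_le _ (fun i => rsum (fun k => x k * y (i - k)%nat)%R (S i)))|].
  - intros i _. unfold conv. rewrite Rmult_comm.
    eapply Rle_trans; [apply Rmult_le_compat_l; [now apply pow_le|apply Cmod_csum]|].
    rewrite <- rsum_scal. apply rsum_le. intros k Hk. unfold x, y. rewrite Cmod_mult.
    right. replace i with (k + (i - k))%nat at 1 by lia. rewrite pow_add. ring.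
  - rewrite rsum_triangle. rewrite Rmult_comm, <- rsum_scal. apply rsum_le. intros k Hk.
    rewrite Rmult_comm. apply Rmult_le_compat_r; auto. apply rsum_mono; auto; lia.
Qed.

(** A partial sum of the Cauchy product is a sum of the a_i t^i, each times a partial sum of the
    other series of length n - i. These are bounded by B, and dominated convergence applies. *)
Lemma has_ps_mult (a b : nat -> C) (g k : C -> C) :
  has_ps a g -> has_ps b k -> has_ps (conv a b) (fun t => g t * k t).
Proof.
  intros [Ba Ha] [Bb Hb]. split.
  - intros r Hr. destruct (Ba r Hr) as [A HA]. destruct (Bb r Hr) as [B HB].
    exists (A * B)%R. intros n. eapply Rle_trans; [apply conv_rsum_le; lra|].
    apply Rmult_le_compat; auto; apply rsum_ge0; intros i;
      (apply Rmult_le_pos; [apply Cmod_ge_0|apply pow_le; lra]).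
  - intros t Ht. pose proof (Cmod_ge_0 t).
    destruct (Ba (Cmod t)) as [A HA]; [lra|]. destruct (Bb (Cmod t)) as [B HB]; [lra|].
    assert (B0 : (0 <= B)%R) by (specialize (HB 0%nat); simpl in HB; lra).
    apply Ccvg_ext with (fun n =>
      csum (fun i => a i * t ^ i * csum (fun l => b l * t ^ l) (n - i)) n).
    { intros n. rewrite <- csum_triangle. apply csum_ext. intros i Hi. unfold conv.
      rewrite Cmult_comm, <- csum_scal. apply csum_ext. intros l Hl.
      replace i with (l + (i - l))%nat at 3 by lia. rewrite Cpow_add_r. ring. }
    apply (csum_tannery _ (fun i => a i * t ^ i * k t)
      (fun i => B * (Cmod (a i) * Cmod t ^ i))%R (fun n => n)).
    + apply summable_scal; auto. split.
      * intros i. apply Rmult_le_pos; [apply Cmod_ge_0|apply pow_le; lra].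
      * now exists A.
    + apply filterlim_id.
    + intros n i Hi. rewrite !Cmod_mult, Cmod_pow, Rmult_comm.
      apply Rmult_le_compat_r.
      * apply Rmult_le_pos; [apply Cmod_ge_0|apply pow_le; lra].
      * eapply Rle_trans; [apply Cmod_csum|].
        eapply Rle_trans; [|apply (HB (n - i)%nat)].
        apply rsum_le. intros l _. rewrite Cmod_mult, Cmod_pow. lra.
    + intros i. apply Ccvg_scal.
      apply (Ccvg_subseq (fun n => (n - i)%nat) (csum (fun l => b l * t ^ l))); auto.
      intros P [M HM]. exists (M + i)%nat. intros n Hn. apply HM. lia.
    + apply Ccvg_ext with (fun n => k t * csum (fun i => a i * t ^ i) n).
      * intros n. rewrite <- csum_scal. apply csum_ext. intros. ring.
      * rewrite Cmult_comm. now apply Ccvg_scal, Ha.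
Qed.

Lemma PS_mult (g k : C -> C) : PS g -> PS k -> PS (fun t => g t * k t).
Proof. intros [a Ha] [b Hb]. exists (conv a b). now apply has_ps_mult. Qed.

Lemma has_ps_const (c : C) : has_ps (fun i => if Nat.eq_dec i 0 then c else 0) (fun _ => c).
Proof.
  split.
  - intros r Hr. exists (Cmod c). intros [|n]; [simpl; apply Cmod_ge_0|].
    induction n as [|n IH]; [simpl; lra|].
    change (rsum ?u (S (S n))) with (rsum u (S n) + u (S n))%R. cbv beta.
    destruct (Nat.eq_dec (S n) 0); [lia|]. rewrite Cmod_0. lra.
  - intros t Ht. apply Ccvg_ext_loc with 1%nat (fun _ => c); [|apply Ccvg_const].
    intros n Hn. destruct n as [|n]; [lia|]. clear Hn.
    induction n as [|n IH]; [simpl; ring|].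
    change (csum ?u (S (S n))) with (csum u (S n) + u (S n)). cbv beta.
    rewrite <- IH. destruct (Nat.eq_dec (S n) 0); [lia|]. ring.
Qed.

(** Common to 1 - c t^e and to its geometric inverse when |c| <= 1 and n < e, so that q-products and
    their reciprocals are treated alike. *)
Definition unit_coefs (n : nat) (u : nat -> C) : Prop :=
  u 0%nat = 1 /\ (forall i, (0 < i <= n)%nat -> u i = 0) /\ (forall i, (Cmod (u i) <= 1)%R).

Lemma unit_coefs_rsum (n : nat) (u : nat -> C) (r : R) (m : nat) :
  unit_coefs n u -> (0 <= r < 1)%R ->
  (rsum (fun i => Cmod (u i) * r ^ i) m <= 1 + r ^ S n / (1 - r))%R.
Proof.
  intros [U0 [U1 U2]] Hr.
  eapply Rle_trans; [apply (rsum_mono _ m (S n + m))|].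
  { intros i. apply Rmult_le_pos; [apply Cmod_ge_0|apply pow_le; lra]. }
  { lia. }
  rewrite rsum_add. apply Rplus_le_compat.
  -  assert (G : forall k, (k <= n)%nat -> (rsum (fun i => Cmod (u i) * r ^ i) (S k) <= 1)%R).
    { induction k as [|k IH]; intros Hk; [simpl; rewrite U0, Cmod_1; lra|].
      change (rsum ?u (S (S k))) with (rsum u (S k) + u (S k))%R. cbv beta.
      rewrite U1, Cmod_0 by lia. specialize (IH ltac:(lia)). lra. }
    now apply G.
  - eapply Rle_trans; [apply (rsum_le _ (fun i => r ^ S n * r ^ i)%R)|].
    + intros i _. rewrite pow_add. rewrite <- (Rmult_1_l (r ^ S n * r ^ i)) at 2.
      apply Rmult_le_compat_r; auto. apply Rmult_le_pos; apply pow_le; lra.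
    + rewrite rsum_scal. apply Rmult_le_compat_l; [apply pow_le; lra|].
      now apply rsum_geom_le.
Qed.

(* The coefficients of the partial products stabilise, because the n-th factor
   is 1 + O(t^(n+1)). *)
Lemma PS_prod_inf (u : nat -> nat -> C) (h : nat -> C -> C) (g : C -> C) :
  (forall n, unit_coefs n (u n)) -> (forall n, has_ps (u n) (h n)) ->
  (forall t, (Cmod t < 1)%R -> Ccvg (prodn (fun n => h n t)) (g t)) -> PS g.
Proof.
  intros Hu Hh Hg.
  set (A := nat_rect (fun _ => nat -> C) (fun i => if Nat.eq_dec i 0 then RtoC 1 else RtoC 0)
              (fun n An => conv An (u n))).
  assert (AS : forall n, A (S n) = conv (A n) (u n)) by reflexivity.
  assert (Hps : forall n, has_ps (A n) (fun t => prodn (fun n => h n t) n)).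
  { induction n as [|n IH]; [apply has_ps_const|]. rewrite AS. now apply has_ps_mult. }
  assert (stab1 : forall n i, (i <= n)%nat -> A (S n) i = A n i).
  { intros n i Hi. rewrite AS. unfold conv. destruct (Hu n) as [U0 [U1 _]]. simpl.
    rewrite Nat.sub_diag, U0, csum_0; [ring|]. intros k Hk. rewrite U1 by lia. ring. }
  assert (stab : forall n k, A (n + k)%nat n = A n n).
  { intros n k. induction k as [|k IH]; [now rewrite Nat.add_0_r|].
    rewrite Nat.add_succ_r, stab1 by lia. exact IH. }
  assert (stab' : forall n i, (i <= n)%nat -> A n i = A i i).
  { intros n i Hi. replace n with (i + (n - i))%nat by lia. apply stab. }
  (* The sum of |a_i| r^i is submultiplicative, so every partial product is bounded by the product
     of the 1 + r^(k+1)/(1-r), uniformly in n. *)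
  assert (bnd : forall r, (0 <= r < 1)%R -> exists K, (0 <= K)%R /\ forall n m,
     (rsum (fun i => Cmod (A n i) * r ^ i) m <= K)%R).
  { intros r Hr. exists (exp (/ (1 - r) * / (1 - r))). split; [left; apply exp_pos|].
    intros n m.
    assert (P : (0 < / (1 - r))%R) by (apply Rinv_0_lt_compat; lra).
    apply Rle_trans with (exp (rsum (fun k => / (1 - r) * r ^ k)%R n)).
    - revert m. induction n as [|n IH]; intros m.
      + simpl rsum at 2. rewrite exp_0. destruct m as [|m]; [simpl; lra|].
        induction m as [|m IHm]; [simpl; rewrite Cmod_1; lra|].
        change (rsum ?u (S (S m))) with (rsum u (S m) + u (S m))%R. cbv beta.
        simpl A at 2. rewrite Cmod_0. lra.
      + rewrite AS. eapply Rle_trans; [apply conv_rsum_le; lra|].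
        simpl rsum at 3. rewrite exp_plus.
        apply Rmult_le_compat; auto.
        * apply rsum_ge0. intros. apply Rmult_le_pos; [apply Cmod_ge_0|apply pow_le; lra].
        * apply rsum_ge0. intros. apply Rmult_le_pos; [apply Cmod_ge_0|apply pow_le; lra].
        * eapply Rle_trans; [apply (unit_coefs_rsum n); auto|].
          eapply Rle_trans; [|apply exp_ineq1_le]. apply Rplus_le_compat_l.
          unfold Rdiv. rewrite Rmult_comm. apply Rmult_le_compat_l; [lra|].
          simpl. rewrite <- (Rmult_1_l (r ^ n)) at 2. apply Rmult_le_compat_r; [|lra].
          apply pow_le; lra.
    - apply exp_le. rewrite rsum_scal. apply Rmult_le_compat_l; [lra|].
      now apply rsum_geom_le. }
  exists (fun i => A i i). split.
  - intros r Hr. destruct (bnd r Hr) as [K [_ HK]]. exists K. intros n.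
    rewrite (rsum_ext _ (fun i => Cmod (A n i) * r ^ i)%R); auto.
    intros i Hi. now rewrite (stab' n i) by lia.
  - intros t Ht. pose proof (Cmod_ge_0 t) as Ht0.
    (* A radius strictly between |t| and 1: the bound at r makes the terms at t decay like q^i with
       q = |t|/r, uniformly in n. *)
    set (r := ((1 + Cmod t) / 2)%R). assert (Hr : (0 <= r < 1)%R) by (unfold r; lra).
    assert (Htr : (Cmod t < r)%R) by (unfold r; lra).
    destruct (bnd r Hr) as [K [K0 HK]].
    set (q := (Cmod t / r)%R).
    assert (Hq : (0 <= q < 1)%R).
    { unfold q. split; [apply Rdiv_le_0_compat; lra|].
      apply Rmult_lt_reg_r with r; [lra|]. unfold Rdiv. rewrite Rmult_assoc, Rinv_l; lra. }
    assert (HA : forall n i, (Cmod (A n i * t ^ i) <= K * q ^ i)%R).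
    { intros n i. rewrite Cmod_mult, Cmod_pow.
      assert (E : (Cmod (A n i) * r ^ i <= K)%R).
      { specialize (HK n (S i)). simpl in HK.
        pose proof (rsum_ge0 (fun i => Cmod (A n i) * r ^ i)%R i) as P.
        assert (forall i, (0 <= Cmod (A n i) * r ^ i)%R).
        { intros. apply Rmult_le_pos; [apply Cmod_ge_0|apply pow_le; lra]. }
        specialize (P H). lra. }
      replace (Cmod t) with (r * q)%R by (unfold q; field; lra).
      rewrite Rpow_mult_distr, <- Rmult_assoc. apply Rmult_le_compat_r; auto.
      apply pow_le; lra. }
    assert (tail : forall n I, (Cmod (prodn (fun n => h n t) n - csum (fun i => A n i * t ^ i)%C I)
                <= K / (1 - q) * q ^ I)%R).
    { intros n I. destruct (Hps n) as [_ Hn]. specialize (Hn t Ht).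
      apply (Ccvg_le I _ _ _ _ Hn). intros m Hm.
      replace m with (I + (m - I))%nat by lia. rewrite csum_add.
      set (s := csum _ I). set (s' := csum _ (m - I)).
      replace (s + s' - s) with s' by ring. unfold s'.
      eapply Rle_trans; [apply Cmod_csum|].
      eapply Rle_trans; [apply (rsum_le _ (fun i => K * q ^ I * q ^ i)%R)|].
      - intros i _. eapply Rle_trans; [apply HA|]. rewrite pow_add. lra.
      - rewrite rsum_scal. replace (K / (1 - q) * q ^ I)%R with (K * q ^ I * / (1 - q))%R
          by (field; lra).
        apply Rmult_le_compat_l; [apply Rmult_le_pos; auto; apply pow_le; lra|].
        now apply rsum_geom_le. }
    assert (lim : forall I, (Cmod (csum (fun i => A i i * t ^ i)%C I - g t)
                             <= K / (1 - q) * q ^ I)%R).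
    { intros I. rewrite <- Cmod_opp.
      replace (- (csum (fun i => A i i * t ^ i) I - g t)) with
        (g t - csum (fun i => A i i * t ^ i) I) by ring.
      apply (Ccvg_le I _ _ _ _ (Hg t Ht)). intros n Hn.
      rewrite (csum_ext _ (fun i => A n i * t ^ i)); [apply tail|].
      intros i Hi. now rewrite (stab' n i) by lia. }
    apply is_lim_seq_0_le with (fun I => K / (1 - q) * q ^ I)%R.
    + intros I. split; [apply Cmod_ge_0|apply lim].
    + apply is_lim_seq_0_scal. apply is_lim_seq_geom. rewrite Rabs_pos_eq; lra.
Qed.

Definition binomial_coefs (c : C) (e i : nat) : C :=
  if Nat.eq_dec i 0 then 1 else if Nat.eq_dec i e then - c else 0.

Lemma has_ps_binomial (c : C) (n e : nat) :
  (n < e)%nat -> (Cmod c <= 1)%R ->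
  unit_coefs n (binomial_coefs c e) /\
  has_ps (binomial_coefs c e) (fun t => 1 - c * t ^ e).
Proof.
  intros He Hc.
  assert (U : unit_coefs n (binomial_coefs c e)).
  { unfold binomial_coefs. split; [reflexivity|split].
    - intros i Hi. destruct (Nat.eq_dec i 0); [lia|]. destruct (Nat.eq_dec i e); [lia|auto].
    - intros i. destruct (Nat.eq_dec i 0); [rewrite Cmod_1; lra|].
      destruct (Nat.eq_dec i e); [rewrite Cmod_opp; lra|rewrite Cmod_0; lra]. }
  split; auto. split.
  - intros r Hr. exists (1 + r ^ S n / (1 - r))%R. intros m. now apply unit_coefs_rsum.
  - intros t _. apply Ccvg_ext_loc with (S e) (fun _ => 1 - c * t ^ e); [|apply Ccvg_const].
    assert (L : forall m, (m < e)%nat -> csum (fun i => binomial_coefs c e i * t ^ i) (S m) = 1).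
    { induction m as [|m IH]; intros Hm; [simpl; unfold binomial_coefs; simpl; ring|].
      change (csum ?u (S (S m))) with (csum u (S m) + u (S m)). cbv beta.
      rewrite IH by lia. unfold binomial_coefs.
      destruct (Nat.eq_dec (S m) 0); [lia|]. destruct (Nat.eq_dec (S m) e); [lia|]. ring. }
    intros m Hm. replace m with (S e + (m - S e))%nat by lia. rewrite csum_add.
    rewrite (csum_0 (fun i => _ (S e + i)%nat * _)).
    + change (csum ?u (S e)) with (csum u e + u e). cbv beta.
      destruct e as [|e]; [lia|]. rewrite L by lia. unfold binomial_coefs.
      destruct (Nat.eq_dec (S e) 0); [lia|]. destruct (Nat.eq_dec (S e) (S e)); [ring|lia].
    + intros i _. unfold binomial_coefs. destruct (Nat.eq_dec (S e + i) 0); [lia|].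
      destruct (Nat.eq_dec (S e + i) e); [lia|]. ring.
Qed.

Definition geometric_coefs (c : C) (e i : nat) : C :=
  if Nat.eq_dec (i mod e) 0 then c ^ (i / e) else 0.

Lemma Cmod_pow_le_1 (c : C) (n : nat) : (Cmod c <= 1)%R -> (Cmod (c ^ n) <= 1)%R.
Proof.
  intros H. rewrite Cmod_pow, <- (pow1 n). apply pow_incr. split; auto. apply Cmod_ge_0.
Qed.

(** Absolute convergence comes first from the bound on the coefficients, so the sum may be computed
    along multiples of e, where it is a finite geometric sum. *)
Lemma has_ps_geometric (c : C) (n e : nat) :
  (n < e)%nat -> (Cmod c <= 1)%R ->
  unit_coefs n (geometric_coefs c e) /\
  has_ps (geometric_coefs c e) (fun t => / (1 - c * t ^ e)).
Proof.
  intros He Hc.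
  assert (U : unit_coefs n (geometric_coefs c e)).
  { unfold geometric_coefs. split; [|split].
    - rewrite Nat.Div0.mod_0_l, Nat.Div0.div_0_l. reflexivity.
    - intros i Hi. rewrite Nat.mod_small by lia. destruct (Nat.eq_dec i 0); [lia|auto].
    - intros i. destruct (Nat.eq_dec (i mod e) 0); [|rewrite Cmod_0; lra].
      now apply Cmod_pow_le_1. }
  split; auto. split.
  - intros r Hr. exists (1 + r ^ S n / (1 - r))%R. intros m. now apply unit_coefs_rsum.
  - intros t Ht. set (w := c * t ^ e). pose proof (Cmod_ge_0 t).
    assert (Hw : (Cmod w < 1)%R).
    { unfold w. rewrite Cmod_mult, Cmod_pow.
      apply Rle_lt_trans with (1 * Cmod t ^ e)%R.
      - apply Rmult_le_compat_r; auto. apply pow_le; lra.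
      - rewrite Rmult_1_l. apply pow_lt_1_compat; [lra|lia]. }
    assert (W0 : 1 - w <> 0).
    { intros E. assert (w = 1) by (replace w with (1 - (1 - w)) by ring; rewrite E; ring).
      rewrite H0, Cmod_1 in Hw. lra. }
    destruct (csum_abs_cvg (fun i => geometric_coefs c e i * t ^ i)) as [l Hl].
    { split; [intros; apply Cmod_ge_0|]. exists (1 + Cmod t ^ S n / (1 - Cmod t))%R.
      intros m. rewrite (rsum_ext _ (fun i => Cmod (geometric_coefs c e i) * Cmod t ^ i)%R).
      - apply unit_coefs_rsum; auto; lra.
      - intros i _. now rewrite Cmod_mult, Cmod_pow. }
    replace (/ (1 - w)) with l; auto.
    assert (Hsub : Ccvg (fun k => csum (fun i => geometric_coefs c e i * t ^ i) (k * e)) l).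
    { apply (Ccvg_subseq (fun k => (k * e)%nat) (csum _)); auto.
      apply filterlim_ge_id. intros; nia. }
    apply (Ccvg_unique _ _ _ Hsub).
    apply Ccvg_ext with (fun k => (1 - w ^ k) * / (1 - w)).
    + intros k. induction k as [|k IH]; [simpl; ring|].
      replace (S k * e)%nat with (k * e + e)%nat by lia. rewrite csum_add, <- IH.
      destruct e as [|e]; [lia|].
      replace (csum (fun i => geometric_coefs c (S e) (k * S e + i) * t ^ (k * S e + i)) (S e))
        with (w ^ k).
      * simpl. field; auto.
      * set (F := fun i => geometric_coefs c (S e) (k * S e + i) * t ^ (k * S e + i)).
        change (csum F (S e)) with (csum F (1 + e)). unfold F.
        rewrite csum_add, (csum_0 (fun i => _ (_ + (1 + i))%nat * _)).
        -- simpl csum. unfold geometric_coefs. rewrite Nat.add_0_r, Nat.Div0.mod_mul, Nat.div_mul by lia.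
           simpl Nat.eq_dec. cbv iota. unfold w. rewrite Cpow_mult_l, <- Cpow_mult_r.
           rewrite (Nat.mul_comm k). destruct (Nat.eq_dec 0 0); [ring|lia].
        -- intros i Hi. unfold geometric_coefs.
           replace (k * S e + (1 + i))%nat with ((1 + i) + k * S e)%nat by lia.
           rewrite Nat.Div0.mod_add, Nat.mod_small by lia.
           destruct (Nat.eq_dec (1 + i) 0); [lia|]. ring.
    + apply Ccvg_eq with ((1 - 0) * / (1 - w)); [ring|].
      apply Ccvg_mult; [|apply Ccvg_const]. apply Ccvg_minus; [apply Ccvg_const|].
      apply is_lim_seq_ext with (fun k => (Cmod w ^ k)%R).
      * intros k. replace (w ^ k - 0) with (w ^ k) by ring. now rewrite Cmod_pow.
      * apply is_lim_seq_geom. rewrite Rabs_pos_eq; auto. apply Cmod_ge_0.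
Qed.

(** * Expansions in powers of e(z/p) *)

(** The monomial carries a possible pole, and the power series lives on the whole unit disc. The
    same data therefore give the expansion at the cusp and holomorphy on the upper half plane. *)
Definition laurent (p : nat) (F : C -> C) : Prop :=
  exists (v : Z) (g : C -> C), PS g /\ forall z, (0 < Im z)%R ->
    F z = ee (IZR v * z / INR p) * g (ee (z / INR p)).

(** Closed under all integral powers: the reciprocal has its expansion by definition, which avoids
    inverting power series. *)
Definition laurent_unit (p : nat) (F : C -> C) : Prop :=
  laurent p F /\ laurent p (fun z => / F z) /\ forall z, (0 < Im z)%R -> F z <> 0.

Lemma laurent_ext (p : nat) (F G : C -> C) :
  (forall z, (0 < Im z)%R -> F z = G z) -> laurent p F -> laurent p G.
Proof.
  intros H [v [g [Hg HF]]]. exists v, g. split; auto. intros z Hz. rewrite <- H; auto.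
Qed.

Lemma laurent_unit_ext (p : nat) (F G : C -> C) :
  (forall z, (0 < Im z)%R -> F z = G z) -> laurent_unit p F -> laurent_unit p G.
Proof.
  intros H [H1 [H2 H3]]. split; [|split].
  - now apply laurent_ext with F.
  - apply laurent_ext with (fun z => / F z); auto. intros z Hz. now rewrite H.
  - intros z Hz. rewrite <- H; auto.
Qed.

Lemma laurent_mult (p : nat) (F G : C -> C) : (0 < p)%nat ->
  laurent p F -> laurent p G -> laurent p (fun z => F z * G z).
Proof.
  intros Hp [v [g [Hg HF]]] [w [k [Hk HG]]].
  assert (P0 : RtoC (INR p) <> 0) by (apply INR_C_neq0; lia).
  exists (v + w)%Z, (fun t => g t * k t). split; [now apply PS_mult|].
  intros z Hz. rewrite HF, HG, plus_IZR, RtoC_plus by auto.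
  replace ((IZR v + IZR w) * z / INR p) with (IZR v * z / INR p + IZR w * z / INR p)
    by (field; auto).
  rewrite ee_plus. ring.
Qed.

Lemma laurent_unit_mult (p : nat) (F G : C -> C) : (0 < p)%nat ->
  laurent_unit p F -> laurent_unit p G -> laurent_unit p (fun z => F z * G z).
Proof.
  intros Hp [F1 [F2 F3]] [G1 [G2 G3]]. split; [|split].
  - now apply laurent_mult.
  - apply laurent_ext with (fun z => / F z * / G z); [|now apply laurent_mult].
    intros z Hz.   field; auto.
  - intros z Hz. apply Cmult_neq_0; auto.
Qed.

Lemma laurent_unit_inv (p : nat) (F : C -> C) :
  laurent_unit p F -> laurent_unit p (fun z => / F z).
Proof.
  intros [F1 [F2 F3]]. split; [|split]; auto.
  - apply laurent_ext with F; auto. intros z Hz. specialize (F3 z Hz). field; nzc.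
  - intros z Hz. now apply Cinv_neq0, F3.
Qed.

Lemma laurent_monomial (p : nat) (v : Z) (c : C) :
  laurent p (fun z => c * ee (IZR v * z / INR p)).
Proof.
  exists v, (fun _ => c). split; [eexists; apply has_ps_const|].
  intros z Hz. ring.
Qed.

Lemma laurent_unit_monomial (p : nat) (v : Z) (c : C) : (0 < p)%nat -> c <> 0 ->
  laurent_unit p (fun z => c * ee (IZR v * z / INR p)).
Proof.
  intros Hp Hc.
  assert (P0 : RtoC (INR p) <> 0) by (apply INR_C_neq0; lia).
  split; [apply laurent_monomial|split].
  - apply laurent_ext with (fun z => / c * ee (IZR (- v) * z / INR p));
      [|apply laurent_monomial].
    intros z Hz. rewrite opp_IZR, RtoC_opp.
    replace (- IZR v * z / INR p) with (- (IZR v * z / INR p)) by (field; auto).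
    rewrite ee_opp. pose proof (ee_neq0 (IZR v * z / INR p)). field; auto.
  - intros z Hz. apply Cmult_neq_0; auto. apply ee_neq0.
Qed.

Lemma laurent_unit_const (p : nat) (c : C) : (0 < p)%nat -> c <> 0 ->
  laurent_unit p (fun _ => c).
Proof.
  intros Hp Hc.
  assert (P0 : RtoC (INR p) <> 0) by (apply INR_C_neq0; lia).
  apply laurent_unit_ext with (fun z => c * ee (IZR 0 * z / INR p));
    [|now apply laurent_unit_monomial].
  intros z _. replace (0 * z / INR p) with (RtoC 0) by (field; auto).
  rewrite ee_0. ring.
Qed.

Lemma laurent_unit_div (p : nat) (F G : C -> C) : (0 < p)%nat ->
  laurent_unit p F -> laurent_unit p G -> laurent_unit p (fun z => F z / G z).
Proof.
  intros Hp HF HG. apply laurent_unit_mult; auto. now apply laurent_unit_inv.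
Qed.

Lemma laurent_unit_pow (p : nat) (F : C -> C) (k : nat) : (0 < p)%nat ->
  laurent_unit p F -> laurent_unit p (fun z => F z ^ k).
Proof.
  intros Hp HF. induction k as [|k IH].
  - apply (laurent_unit_const p 1); auto. apply C1_nz.
  - apply laurent_unit_ext with (fun z => F z * F z ^ k); [reflexivity|].
    now apply laurent_unit_mult.
Qed.

Lemma laurent_unit_Cpowz (p : nat) (F : C -> C) (k : Z) : (0 < p)%nat ->
  laurent_unit p F -> laurent_unit p (fun z => Cpowz (F z) k).
Proof.
  intros Hp HF. revert k. apply Zind_abs; intros n.
  - apply laurent_unit_ext with (fun z => F z ^ n); [|now apply laurent_unit_pow].
    intros z _. now rewrite Cpowz_nat.
  - apply laurent_unit_ext with (fun z => / F z ^ n).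
    + intros z _. now rewrite Cpowz_opp_nat.
    + apply laurent_unit_inv. now apply laurent_unit_pow.
Qed.

Lemma laurent_unit_prodn (p : nat) (F : nat -> C -> C) (k : nat) : (0 < p)%nat ->
  (forall i, (i < k)%nat -> laurent_unit p (F i)) ->
  laurent_unit p (fun z => prodn (fun i => F i z) k).
Proof.
  intros Hp HF. induction k as [|k IH].
  - apply (laurent_unit_const p 1); auto. apply C1_nz.
  - apply (laurent_unit_mult p (fun z => prodn (fun i => F i z) k) (F k)); auto.
Qed.

(** A q-product (V; q) in the local parameter t = e(z/p), where e(V) = c t^x and q = w t^L. As x and
    L are at least 1, the exponent x + n L exceeds n, which is what [PS_prod_inf] asks of the n-th
    factor. *)
Lemma PS_qproduct (c w : C) (x L : nat) :
  (Cmod c <= 1)%R -> (Cmod w <= 1)%R -> (1 <= x)%nat -> (1 <= L)%nat ->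
  let g := fun t => Cprod_inf (fun n => 1 - c * w ^ n * t ^ (x + n * L)) in
  PS g /\ PS (fun t => / g t) /\
  forall t, (Cmod t < 1)%R ->
    Ccvg (prodn (fun n => 1 - c * w ^ n * t ^ (x + n * L))) (g t) /\ g t <> 0.
Proof.
  intros Hc Hw Hx HL g.
  assert (Hcw : forall n, (Cmod (c * w ^ n) <= 1)%R).
  { intros n. rewrite Cmod_mult. rewrite <- (Rmult_1_l 1).
    apply Rmult_le_compat; try apply Cmod_ge_0; auto. now apply Cmod_pow_le_1. }
  assert (He : forall n, (n < x + n * L)%nat) by (intros; nia).
  assert (Hs : forall t, (Cmod t < 1)%R ->
     summable (fun n => Cmod (1 - c * w ^ n * t ^ (x + n * L) - 1))).
  { intros t Ht. pose proof (Cmod_ge_0 t).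
    refine (summable_le _ _ _ (summable_geom (Cmod t) ltac:(lra))).
    intros n. split; [apply Cmod_ge_0|].
    replace (1 - c * w ^ n * t ^ (x + n * L) - 1) with (- (c * w ^ n * t ^ (x + n * L))) by ring.
    rewrite Cmod_opp, (Cmod_mult (c * w ^ n)), Cmod_pow.
    apply Rle_trans with (1 * Cmod t ^ (x + n * L))%R.
    - apply Rmult_le_compat_r; [apply pow_le; lra|apply Hcw].
    - rewrite Rmult_1_l. replace (x + n * L)%nat with (n + (x + n * L - n))%nat
        by (specialize (He n); lia).
      rewrite pow_add. rewrite <- (Rmult_1_r (Cmod t ^ n)) at 2.
      apply Rmult_le_compat_l; [apply pow_le; lra|].
      rewrite <- (pow1 (x + n * L - n)). apply pow_incr. lra. }
  assert (Hn0 : forall t, (Cmod t < 1)%R -> forall n, 1 - c * w ^ n * t ^ (x + n * L) <> 0).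
  { intros t Ht n E. pose proof (Cmod_ge_0 t).
    assert (E1 : c * w ^ n * t ^ (x + n * L) = 1).
    { replace (c * w ^ n * t ^ (x + n * L)) with (1 - (1 - c * w ^ n * t ^ (x + n * L))) by ring.
      rewrite E. ring. }
    apply (f_equal Cmod) in E1. rewrite (Cmod_mult (c * w ^ n)), Cmod_pow, Cmod_1 in E1.
    assert (Cmod t ^ (x + n * L) < 1)%R by (apply pow_lt_1_compat; [lra|lia]).
    pose proof (pow_le (Cmod t) (x + n * L) H). specialize (Hcw n).
     nra. }
  assert (Hcv : forall t, (Cmod t < 1)%R ->
    Ccvg (prodn (fun n => 1 - c * w ^ n * t ^ (x + n * L))) (g t)).
  { intros t Ht. destruct (prodn_cvg _ (Hs t Ht)) as [l Hl]. unfold g.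
    now rewrite (Cprod_inf_cvg _ _ Hl). }
  assert (Hg0 : forall t, (Cmod t < 1)%R -> g t <> 0).
  { intros t Ht. apply (prodn_cvg_neq0 _ _ (Hs t Ht)); auto. }
  split; [|split; [|intros; split; auto]].
  - apply (PS_prod_inf (fun n => binomial_coefs (c * w ^ n) (x + n * L))
      (fun n t => 1 - c * w ^ n * t ^ (x + n * L))); auto; intros n.
    + exact (proj1 (has_ps_binomial _ n _ (He n) (Hcw n))).
    + exact (proj2 (has_ps_binomial _ n _ (He n) (Hcw n))).
  - apply (PS_prod_inf (fun n => geometric_coefs (c * w ^ n) (x + n * L))
      (fun n t => / (1 - c * w ^ n * t ^ (x + n * L)))).
    + intros n. exact (proj1 (has_ps_geometric _ n _ (He n) (Hcw n))).
    + intros n. exact (proj2 (has_ps_geometric _ n _ (He n) (Hcw n))).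
    + intros t Ht. apply Ccvg_ext with
        (fun N => / prodn (fun n => 1 - c * w ^ n * t ^ (x + n * L)) N).
      * intros N. symmetry. apply prodn_inv. auto.
      * apply Ccvg_inv; auto.
Qed.

Lemma local_parameter_lt_1 (p : nat) (z : C) :
  (0 < p)%nat -> (0 < Im z)%R -> (Cmod (ee (z / INR p)) < 1)%R.
Proof.
  intros Hp Hz. pose proof (INR_C_neq0 p Hp). apply Cmod_ee_lt_1.
  replace (z / INR p) with ((/ INR p)%R * z)
    by (rewrite RtoC_inv by (apply not_0_INR; lia); field; auto).
  apply Im_scal_pos; auto. now apply Rinv_0_lt_compat, lt_0_INR.
Qed.

Lemma laurent_unit_qpoch (p : nat) (c w : C) (x L : nat) (V tau : C -> C) : (0 < p)%nat ->
  (Cmod c <= 1)%R -> (Cmod w <= 1)%R -> (1 <= x)%nat -> (1 <= L)%nat ->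
  (forall z, (0 < Im z)%R -> (0 < Im (tau z))%R /\
     ee (V z) = c * ee (z / INR p) ^ x /\ ee (tau z) = w * ee (z / INR p) ^ L) ->
  laurent_unit p (fun z => qpoch (V z) (tau z)).
Proof.
  intros Hp Hc Hw Hx HL H.
  assert (P0 : RtoC (INR p) <> 0) by (apply INR_C_neq0; lia).
  destruct (PS_qproduct c w x L Hc Hw Hx HL) as [G1 [G2 G3]]. cbv zeta in *.
  set (g := fun t => Cprod_inf _) in *.
  assert (HT := fun z => local_parameter_lt_1 p z Hp).
  assert (HG : forall z, (0 < Im z)%R -> g (ee (z / INR p)) = qpoch (V z) (tau z)).
  { intros z Hz. destruct (H z Hz) as [Ht [E1 E2]]. destruct (G3 _ (HT z Hz)) as [Gc _].
    apply (Ccvg_unique _ _ _ Gc). eapply Ccvg_ext; [|now apply qpoch_cvg].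
    intros n. apply prodn_ext. intros i _. rewrite E1, E2, Cpow_add_r, Cpow_mult_l.
    rewrite (Nat.mul_comm i L), Cpow_mult_r. ring. }
  assert (Z0 : forall z : C, ee (IZR 0 * z / INR p) = 1).
  { intros z. replace (0 * z / INR p) with (RtoC 0) by (field; auto). apply ee_0. }
  split; [|split].
  - exists 0%Z, g. split; auto. intros z Hz. rewrite Z0, HG; auto. ring.
  - exists 0%Z, (fun t => / g t). split; auto. intros z Hz. rewrite Z0, HG; auto. ring.
  - intros z Hz. rewrite <- HG by auto. now apply G3, HT.
Qed.

Lemma Cmod_ee_real (x : R) : Cmod (ee x) = 1%R.
Proof.
  rewrite Cmod_ee, im_RtoC, Rmult_0_r, Ropp_0. apply exp_0.
Qed.

(* Here t = (L z + be) / p, so that e^(2 pi i t) is a root of unity times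
   e^(2 pi i z / p)^L. *)
Definition tau_of (p L : nat) (be : R) (z : C) : C := (INR L * z + be) / INR p.

Lemma tau_of_upper (p L : nat) (be : R) (z : C) :
  (0 < p)%nat -> (0 < L)%nat -> (0 < Im z)%R -> (0 < Im (tau_of p L be z))%R.
Proof.
  intros Hp HL Hz. apply lt_0_INR in Hp, HL. unfold tau_of.
  replace ((INR L * z + be) / INR p) with ((/ INR p)%R * (INR L * z + be)).
  - apply Im_scal_pos; [now apply Rinv_0_lt_compat|]. destruct z; simpl in *. nra.
  - rewrite RtoC_inv by lra. field. nzc.
Qed.

Lemma ee_tau_of (p L : nat) (be : R) (z : C) : (0 < p)%nat ->
  ee (tau_of p L be z) = ee (be / INR p)%R * ee (z / INR p) ^ L.
Proof.
  intros Hp. assert (P0 : INR p <> 0%R) by (apply not_0_INR; lia).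
  rewrite <- ee_nat, <- ee_plus. f_equal. unfold tau_of. rewrite RtoC_div by auto.
  field. now apply RtoC_neq0.
Qed.

Lemma laurent_unit_qpoch_tau (p L : nat) (be : R) : (0 < p)%nat -> (0 < L)%nat ->
  laurent_unit p (fun z => qpoch (tau_of p L be z) (tau_of p L be z)).
Proof.
  intros Hp HL.
  apply (laurent_unit_qpoch p (ee (be / INR p)%R) (ee (be / INR p)%R) L L); auto;
    try (rewrite Cmod_ee_real; lra).
  intros z Hz. split; [now apply tau_of_upper|]. split; now apply ee_tau_of.
Qed.

Lemma laurent_unit_Delta (p L : nat) (be : R) : (0 < p)%nat -> (0 < L)%nat ->
  laurent_unit p (fun z => Delta (tau_of p L be z)).
Proof.
  intros Hp HL. assert (P0 : RtoC (INR p) <> 0) by (apply INR_C_neq0; lia).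
  apply laurent_unit_ext with (fun z =>
    (ee (be / INR p)%R * ee (IZR (Z.of_nat L) * z / INR p))
    * qpoch (tau_of p L be z) (tau_of p L be z) ^ 24).
  - intros z Hz. Transparent Delta. unfold Delta. Opaque Delta. f_equal.
    rewrite ee_tau_of, <- ee_nat, <- INR_IZR_INZ by auto. f_equal. f_equal. field; auto.
  - apply laurent_unit_mult; auto.
    + apply laurent_unit_monomial; auto. apply ee_neq0.
    + apply laurent_unit_pow; auto. now apply laurent_unit_qpoch_tau.
Qed.

(** With V = r tau + s, the bounds on x make the exponents x and L - x of e(V) and e(tau - V)
    positive. The prefactors combine to e((r-1) V/2), of order (r-1) x/2 in e(z/p); the last
    hypothesis makes this an integer v. *)
Lemma laurent_unit_klein_pos (p L x : nat) (be r s : R) (v : Z) :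
  (0 < p)%nat -> (0 < x < L)%nat ->
  (r * INR L = INR x)%R -> ((r - 1) * INR x = 2 * IZR v)%R ->
  laurent_unit p (fun z => klein r s (tau_of p L be z)).
Proof.
  intros Hp Hx Hr Hv. assert (P0 : RtoC (INR p) <> 0) by (apply INR_C_neq0; lia).
  assert (P0' : INR p <> 0%R) by (apply not_0_INR; lia).
  set (tau := tau_of p L be).
  assert (EV : forall z, r * tau z + s = INR x * z / INR p + (r * be / INR p + s)%R).
  { intros z. unfold tau, tau_of. rewrite <- Hr.
    rewrite RtoC_plus, RtoC_div, !RtoC_mult by auto. field; auto. }
  apply laurent_unit_ext with (fun z =>
    (- ee ((r - 1) / 2 * (r * be / INR p + s)%R) * ee (IZR v * z / INR p))
    * (qpoch (r * tau z + s) (tau z) * qpoch (tau z - (r * tau z + s)) (tau z))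
    / (qpoch (tau z) (tau z) * qpoch (tau z) (tau z))).
  { intros z Hz. Transparent klein theta_quot. unfold klein, theta_quot. Opaque klein theta_quot.
    fold tau. set (g := qpoch (tau z) (tau z)).
    set (ab := qpoch (r * tau z + s) (tau z) * qpoch (tau z - (r * tau z + s)) (tau z)).
    assert (E : ee ((r - 1) / 2 * (r * be / INR p + s)%R) * ee (IZR v * z / INR p)
       = ee (r * (r * tau z + s) / 2) * ee (- ((r * tau z + s) / 2))).
    { rewrite <- !ee_plus. f_equal. rewrite EV.
      replace (RtoC (IZR v)) with (((r - 1) * INR x)%R / 2)
        by (rewrite Hv, RtoC_mult; field; nzc).
      rewrite RtoC_mult, RtoC_minus. field; nzc. }
    set (e1 := ee ((r - 1) / 2 * _)) in *. set (e2 := ee (IZR v * z / INR p)) in *.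
    transitivity (- (e1 * e2) * ab / (g * g)); [unfold Cdiv; ring|].
    rewrite E. unfold Cdiv. ring. }
  assert (Ht : forall z, (0 < Im z)%R -> (0 < Im (tau z))%R)
    by (intros; apply tau_of_upper; auto; lia).
  assert (Hm : forall y : R, (Cmod (ee y) <= 1)%R) by (intros; rewrite Cmod_ee_real; lra).
  apply laurent_unit_div; auto; [apply laurent_unit_mult; auto; [|apply laurent_unit_mult; auto]
    |apply laurent_unit_mult; auto].
  - apply laurent_unit_monomial; auto. apply Copp_neq0, ee_neq0.
  - apply (laurent_unit_qpoch p (ee (r * be / INR p + s)%R) (ee (be / INR p)%R) x L); auto; try lia.
    intros z Hz. split; auto. split; [|now apply ee_tau_of].
    rewrite EV, ee_plus, <- ee_nat, Cmult_comm. f_equal. f_equal. field; auto.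
  - apply (laurent_unit_qpoch p (ee (be / INR p - (r * be / INR p + s))%R) (ee (be / INR p)%R)
      (L - x) L); auto; try lia.
    intros z Hz. split; auto. split; [|now apply ee_tau_of].
    rewrite EV, <- ee_nat, <- ee_plus. f_equal. unfold tau, tau_of.
    rewrite minus_INR, !RtoC_minus, (RtoC_div be) by (auto; lia). field; auto.
  - apply laurent_unit_qpoch_tau; auto; lia.
  - apply laurent_unit_qpoch_tau; auto; lia.
Qed.

(** For r = 0 the first factor of the q-product is the constant 1 - e(s). It is split off by
    [qpoch_shift], and it is nonzero because s is not an integer. *)
Lemma laurent_unit_klein_0 (p L : nat) (be s : R) :
  (0 < p)%nat -> (0 < L)%nat -> (forall k : Z, s <> IZR k) ->
  laurent_unit p (fun z => klein 0 s (tau_of p L be z)).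
Proof.
  intros Hp HL Hs.
  set (tau := tau_of p L be).
  assert (Ht : forall z, (0 < Im z)%R -> (0 < Im (tau z))%R)
    by (intros; apply tau_of_upper; auto; lia).
  assert (Hm : forall y : R, (Cmod (ee y) <= 1)%R) by (intros; rewrite Cmod_ee_real; lra).
  apply laurent_unit_ext with (fun z => (- ee (- (s / 2)) * (1 - ee s))
    * (qpoch (s + tau z) (tau z) * qpoch (tau z - s) (tau z))
    / (qpoch (tau z) (tau z) * qpoch (tau z) (tau z))).
  { intros z Hz. Transparent klein theta_quot. unfold klein, theta_quot. Opaque klein theta_quot. fold tau.
    replace (0 * tau z + s) with (RtoC s) by ring.
    replace (0 * s / 2) with (RtoC 0) by (field; nzc).
    rewrite ee_0, (qpoch_shift s) by auto. unfold Cdiv. ring. }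
  apply laurent_unit_div; auto; [apply laurent_unit_mult; auto; [|apply laurent_unit_mult; auto]
    |apply laurent_unit_mult; auto].
  - apply laurent_unit_const; auto. apply Cmult_neq_0; [apply Copp_neq0, ee_neq0|].
    intros E. destruct (ee_eq_1 s) as [k Hk].
    + replace (ee s) with (1 - (1 - ee s)) by ring. rewrite E. ring.
    + apply (Hs k). now apply RtoC_inj.
  - apply (laurent_unit_qpoch p (ee (s + be / INR p)%R) (ee (be / INR p)%R) L L); auto.
    intros z Hz. split; auto. split; [|now apply ee_tau_of].
    unfold tau. rewrite ee_plus, ee_tau_of, RtoC_plus, ee_plus by auto. ring.
  - apply (laurent_unit_qpoch p (ee (be / INR p - s)%R) (ee (be / INR p)%R) L L); auto.
    intros z Hz. split; auto. split; [|now apply ee_tau_of].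
    unfold Cminus. rewrite RtoC_minus. unfold tau, Cminus.
    rewrite !ee_plus, ee_tau_of by auto. ring.
  - now apply laurent_unit_qpoch_tau.
  - now apply laurent_unit_qpoch_tau.
Qed.

(** * Holomorphy *)

Lemma is_series_Ccvg (u : nat -> C) (l : C) :
  Ccvg (csum u) l -> @is_series C_AbsRing C_NormedModule u l.
Proof.
  intros H. apply (filterlim_locally_ball_norm (K := C_AbsRing) (U := C_NormedModule)).
  intros [eps He]. apply Ccvg_S in H.
  destruct (proj1 (Ccvg_eps _ _) H eps He) as [N HN]. exists N. intros n Hn.
  (* [sum_n] includes the term of index n, whence the shift by one. *)
  assert (E : @sum_n C_AbelianMonoid u n = csum u (S n)).
  { clear. induction n as [|n IH].
    - rewrite sum_O. simpl. ring.
    - rewrite sum_Sn, IH. reflexivity. }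
  specialize (HN n Hn). rewrite <- E in HN. exact HN.
Qed.

Lemma laurent_meromorphic (p : nat) (F : C -> C) : (0 < p)%nat ->
  laurent p F -> meromorphic_at_infinity (Z.of_nat p) F.
Proof.
  intros Hp [v [g [[a [Ba Ha]] HF]]].
  assert (P0 : INR p <> 0%R) by (apply not_0_INR; lia).
  assert (P0' : RtoC (INR p) <> 0) by now apply RtoC_neq0.
  exists v, a. intros z Hz. apply is_series_Ccvg.
  pose proof (local_parameter_lt_1 p z Hp Hz) as HT.
  rewrite HF by auto.
  eapply Ccvg_ext; [|apply Ccvg_scal, (Ha _ HT)].
  intros n. cbv beta. rewrite <- csum_scal. apply csum_ext. intros i _.
  rewrite qpow_ee, <- ee_nat, <- INR_IZR_INZ.
  replace ((IZR (v + Z.of_nat i) / INR p)%R * z) with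
    (IZR v * z / INR p + INR i * (z / INR p)).
  - rewrite ee_plus. ring.
  - rewrite plus_IZR, <- INR_IZR_INZ, RtoC_div, RtoC_plus by auto. field; auto.
Qed.

(* F(z + h) = F(z) + l h + O(h^2) *)
Definition quad_derive (F : C -> C) (z l : C) : Prop :=
  exists del K, (0 < del)%R /\ (0 <= K)%R /\ forall h, (Cmod h < del)%R ->
    (Cmod (F (z + h)%C - F z - l * h) <= K * (Cmod h * Cmod h))%R.

Lemma quad_derive_is_derive (F : C -> C) (z l : C) :
  quad_derive F z l -> @is_derive C_AbsRing (AbsRing_NormedModule C_AbsRing) F z l.
Proof.
  intros [del [K [Hd [HK H]]]]. split; [apply is_linear_scal_l|].
  intros x Hx.
  pose proof (@is_filter_lim_locally_unique C_AbsRing (AbsRing_NormedModule C_AbsRing)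
    z x Hx) as Ex. subst x.
  intros [eps He].
  (* K + 1 rather than K, since K may be 0. *)
  assert (Hm : (0 < Rmin del (eps / (K + 1)))%R).
  { apply Rmin_pos; auto. apply Rdiv_lt_0_compat; lra. }
  exists (mkposreal _ Hm).
  enough (G : forall y : C, (Cmod (y - z) < Rmin del (eps / (K + 1)))%R ->
    (Cmod (F y - F z - (y - z) * l) <= eps * Cmod (y - z))%R) by exact G.
  intros y Hy.
  pose proof (Rmin_l del (eps / (K + 1))). pose proof (Rmin_r del (eps / (K + 1))).
  specialize (H (y - z) ltac:(lra)). replace (z + (y - z)) with y in H by ring.
  replace (F y - F z - (y - z) * l) with (F y - F z - l * (y - z)) by ring.
  eapply Rle_trans; [exact H|]. rewrite <- Rmult_assoc.
  pose proof (Cmod_ge_0 (y - z)) as P. apply Rmult_le_compat_r; auto.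
  assert (Cmod (y - z) * (K + 1) <= eps)%R.
  { apply Rle_trans with (eps / (K + 1) * (K + 1))%R.
    - apply Rmult_le_compat_r; lra.
    - right. field. lra. }
  nra.
Qed.

Lemma quad_derive_ee (c z : C) : exists l, quad_derive (fun w => ee (c * w)) z l.
Proof.
  set (m := 2 * PI * Ci * c). pose proof (Cmod_ge_0 m) as Hm.
  exists (ee (c * z) * m), (/ (2 * (Cmod m + 1)))%R, (Cmod (ee (c * z)) * (8 * (Cmod m * Cmod m)))%R.
  pose proof (Cmod_ge_0 (ee (c * z))).
  split; [apply Rinv_0_lt_compat; lra|]. split; [apply Rmult_le_pos; nra|].
  intros h Hh. rewrite Cmult_plus_distr_l, ee_plus.
  replace (ee (c * z) * ee (c * h) - ee (c * z) - ee (c * z) * m * h) with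
    (ee (c * z) * (ee (c * h) - 1 - m * h)) by ring.
  rewrite Cmod_mult, Rmult_assoc. apply Rmult_le_compat_l; auto.
  assert (E : ee (c * h) = Cexp (m * h)).
  { Transparent ee. unfold ee, m. Opaque ee. f_equal. ring. }
  rewrite E. pose proof (Cexp_quadratic (m * h)) as T. rewrite (Cmod_mult m h) in T.
  assert (B : (Cmod m * Cmod h <= / 2)%R).
  { pose proof (Cmod_ge_0 h). apply Rle_trans with ((Cmod m + 1) * Cmod h)%R; [nra|].
    apply Rle_trans with ((Cmod m + 1) * / (2 * (Cmod m + 1)))%R.
    - apply Rmult_le_compat_l; lra.
    - right. field. lra. }
   nra.
Qed.

(** Each of the first i powers of s is at least s^i, so i s^i is at most their sum. *)
Lemma INR_geom_bound (s : R) (i : nat) : (0 <= s < 1)%R -> (INR i * s ^ i <= / (1 - s))%R.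
Proof.
  intros Hs. eapply Rle_trans; [|apply (rsum_geom_le s i Hs)].
  replace (INR i * s ^ i)%R with (rsum (fun _ => s ^ i)%R i).
  - apply rsum_le. intros k Hk. replace i with (k + (i - k))%nat by lia.
    rewrite pow_add. rewrite <- (Rmult_1_r (s ^ k)) at 2.
    apply Rmult_le_compat_l; [apply pow_le; lra|].
    rewrite <- (pow1 (i - k)). apply pow_incr. lra.
  - generalize (s ^ i)%R. intros x. induction i as [|i IH]; [simpl; ring|].
    simpl rsum. rewrite IH, S_INR. ring.
Qed.

(** The remainders satisfy D_(i+1) = (t0 + h) D_i + i t0^(i-1) h^2, and i^2 + i <= (i+1)^2. The
    factor rho^2 on the left avoids the exponent i - 2. *)
Lemma power_taylor (t0 h : C) (rho : R) (i : nat) :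
  (0 < rho)%R -> (Cmod t0 <= rho)%R -> (Cmod (t0 + h) <= rho)%R ->
  (rho * rho * Cmod ((t0 + h) ^ i - t0 ^ i - INR i * t0 ^ (i - 1) * h)
   <= INR i * INR i * rho ^ i * (Cmod h * Cmod h))%R.
Proof.
  intros Hr H0 H1. pose proof (Cmod_ge_0 h) as Hh. pose proof (Cmod_ge_0 t0) as Ht.
  induction i as [|i IH].
  - simpl. replace (1 - 1 - 0 * 1 * h) with (RtoC 0) by ring. rewrite Cmod_0. lra.
  - set (D := (t0 + h) ^ i - t0 ^ i - INR i * t0 ^ (i - 1) * h) in *.
    assert (E : (t0 + h) ^ S i - t0 ^ S i - INR (S i) * t0 ^ (S i - 1) * h
      = (t0 + h) * D + INR i * t0 ^ (i - 1) * (h * h)).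
    { unfold D. rewrite S_INR, RtoC_plus. replace (S i - 1)%nat with i by lia.
      destruct i as [|i]; [simpl; ring|]. replace (S i - 1)%nat with i by lia.
      cbn [Cpow]. ring. }
    rewrite E.
    assert (L : (rho * rho * Cmod (INR i * t0 ^ (i - 1) * (h * h))
                 <= INR i * rho ^ S i * (Cmod h * Cmod h))%R).
    { rewrite !Cmod_mult, Cmod_R, Cmod_pow, Rabs_pos_eq by apply pos_INR.
      destruct i as [|i]; [simpl; lra|]. replace (S i - 1)%nat with i by lia.
      pose proof (pos_INR (S i)) as PI'.
      apply Rle_trans with (INR (S i) * (rho * rho * Cmod t0 ^ i) * (Cmod h * Cmod h))%R;
        [right; ring|].
      apply Rmult_le_compat_r; [nra|]. apply Rmult_le_compat_l; auto.
      replace (rho ^ S (S i))%R with (rho * rho * rho ^ i)%R by (simpl; ring).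
      apply Rmult_le_compat_l; [nra|]. apply pow_incr. lra. }
    apply Rle_trans with (rho * (rho * rho * Cmod D)
        + rho * rho * Cmod (INR i * t0 ^ (i - 1) * (h * h)))%R.
    + eapply Rle_trans; [apply Rmult_le_compat_l; [nra|apply Cmod_triangle]|].
      rewrite Rmult_plus_distr_l. apply Rplus_le_compat_r.
      rewrite Cmod_mult. pose proof (Cmod_ge_0 D).
      apply Rle_trans with (rho * rho * (rho * Cmod D))%R; [|right; ring].
      apply Rmult_le_compat_l; [nra|]. apply Rmult_le_compat_r; auto.
    + apply Rle_trans with (rho * (INR i * INR i * rho ^ i * (Cmod h * Cmod h))
        + INR i * rho ^ S i * (Cmod h * Cmod h))%R.
      * apply Rplus_le_compat; auto. apply Rmult_le_compat_l; auto; lra.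
      * rewrite S_INR. simpl (rho ^ S i)%R. pose proof (pow_le rho i ltac:(lra)).
        pose proof (pos_INR i). set (I := INR i) in *.
        assert (0 <= rho * rho ^ i * (Cmod h * Cmod h))%R.
        { repeat apply Rmult_le_pos; auto; lra. }
        set (X := (rho * rho ^ i * (Cmod h * Cmod h))%R) in *.
        apply Rle_trans with ((I * I + I) * X)%R; [right; unfold X; ring|].
        apply Rle_trans with (((I + 1) * (I + 1)) * X)%R; [|right; unfold X; ring].
        apply Rmult_le_compat_r; auto. nra.
Qed.

Lemma PS_quad_derive (g : C -> C) (t0 : C) :
  PS g -> (Cmod t0 < 1)%R -> exists l, quad_derive g t0 l.
Proof.
  intros [a [Ba Ha]] Ht0. pose proof (Cmod_ge_0 t0) as P0.
  (* Radii |t0| < rho < r1 < r2 < 1 in equal steps. The first step leaves room for h, and each of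
     the other two absorbs one factor i of i^2 rho^i into a geometric series. *)
  set (d := ((1 - Cmod t0) / 4)%R).
  set (rho := (Cmod t0 + d)%R). set (r1 := (rho + d)%R). set (r2 := (r1 + d)%R).
  assert (Hd : (0 < d)%R) by (unfold d; lra).
  assert (H2 : (0 <= r2 < 1)%R) by (unfold r2, r1, rho, d; lra).
  assert (Hrho : (0 < rho)%R) by (unfold rho; lra).
  assert (H1 : (0 < r1 < r2)%R) by (unfold r2, r1; lra).
  destruct (Ba r2 H2) as [B HB].
  assert (q1 : (0 <= rho / r1 < 1)%R).
  { split; [apply Rdiv_le_0_compat; lra|]. apply Rmult_lt_reg_r with r1; [lra|].
    unfold Rdiv. rewrite Rmult_assoc, Rinv_l by lra. unfold r1. lra. }
  assert (q2 : (0 <= r1 / r2 < 1)%R).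
  { split; [apply Rdiv_le_0_compat; lra|]. apply Rmult_lt_reg_r with r2; [lra|].
    unfold Rdiv. rewrite Rmult_assoc, Rinv_l by lra. unfold r2. lra. }
  set (C1 := (/ (1 - rho / r1))%R). set (C2 := (/ (1 - r1 / r2))%R).
  assert (C1p : (0 < C1)%R) by (apply Rinv_0_lt_compat; lra).
  assert (C2p : (0 < C2)%R) by (apply Rinv_0_lt_compat; lra).
  assert (W : forall i, (INR i * INR i * rho ^ i <= C1 * C2 * r2 ^ i)%R).
  { intros i. pose proof (INR_geom_bound (rho / r1) i q1). fold C1 in H.
    pose proof (INR_geom_bound (r1 / r2) i q2). fold C2 in H0.
    pose proof (pos_INR i). pose proof (pow_le _ i (proj1 q1)). pose proof (pow_le _ i (proj1 q2)).
    assert (E : (rho ^ i = (rho / r1) ^ i * (r1 / r2) ^ i * r2 ^ i)%R).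
    { rewrite <- !Rpow_mult_distr. f_equal. field. lra. }
    rewrite E.
    apply Rle_trans with ((INR i * (rho / r1) ^ i) * (INR i * (r1 / r2) ^ i) * r2 ^ i)%R;
      [right; ring|].
    apply Rmult_le_compat_r; [apply pow_le; lra|].
    apply Rmult_le_compat; auto; apply Rmult_le_pos; auto. }
  assert (W1 : forall i, (INR i * rho ^ i <= C1 * C2 * r2 ^ i)%R).
  { intros i. eapply Rle_trans; [|apply W]. pose proof (pow_le rho i ltac:(lra)).
    apply Rmult_le_compat_r; auto. destruct i as [|i]; [simpl; lra|].
    rewrite S_INR. pose proof (pos_INR i). nra. }
  assert (SW : forall n, (rsum (fun i => C1 * C2 * (Cmod (a i) * r2 ^ i))%R n <= C1 * C2 * B)%R).
  { intros n. rewrite rsum_scal. apply Rmult_le_compat_l; auto. nra. }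
  destruct (csum_abs_cvg (fun i => a i * (INR i * t0 ^ (i - 1)))) as [l Hl].
  { split; [intros; apply Cmod_ge_0|]. exists (/ rho * (C1 * C2 * B))%R. intros n.
    eapply Rle_trans; [|apply Rmult_le_compat_l; [left; now apply Rinv_0_lt_compat|apply SW]].
    rewrite <- rsum_scal. apply rsum_le. intros i _.
    rewrite !Cmod_mult, Cmod_R, Cmod_pow, Rabs_pos_eq by apply pos_INR.
    specialize (W1 i). pose proof (Cmod_ge_0 (a i)). pose proof (pos_INR i).
    apply Rmult_le_reg_l with rho; auto.
    rewrite <- (Rmult_assoc rho (/ rho)), Rinv_r, Rmult_1_l by lra.
    apply Rle_trans with (Cmod (a i) * (INR i * (rho * Cmod t0 ^ (i - 1))))%R; [right; ring|].
    apply Rle_trans with (Cmod (a i) * (C1 * C2 * r2 ^ i))%R; [|right; ring].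
    apply Rmult_le_compat_l; auto. eapply Rle_trans; [|exact W1].
    destruct i as [|i]; [simpl; lra|]. apply Rmult_le_compat_l; auto.
    replace (S i - 1)%nat with i by lia. simpl. apply Rmult_le_compat_l; [lra|].
    apply pow_incr. unfold rho. lra. }
  assert (B0 : (0 <= B)%R) by (specialize (HB 0%nat); simpl in HB; lra).
  exists l, d, (/ (rho * rho) * (C1 * C2 * B))%R. split; auto. split.
  { apply Rmult_le_pos; [left; apply Rinv_0_lt_compat; nra|]. apply Rmult_le_pos; nra. }
  intros h Hh.
  assert (Hth : (Cmod (t0 + h) <= rho)%R).
  { eapply Rle_trans; [apply Cmod_triangle|]. unfold rho. lra. }
  assert (Ht1 : (Cmod (t0 + h) < 1)%R) by (unfold r2, r1 in *; lra).
  pose proof (Ccvg_minus _ _ _ _ (Ccvg_minus _ _ _ _ (Ha _ Ht1) (Ha _ Ht0)) (Ccvg_scal h _ _ Hl))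
    as L.
  replace (g (t0 + h) - g t0 - l * h) with (g (t0 + h) - g t0 - h * l - 0) by ring.
  apply (Ccvg_le 0 _ _ _ _ L). intros n _.
  replace (csum (fun i => a i * (t0 + h) ^ i) n - csum (fun i => a i * t0 ^ i) n
     - h * csum (fun i => a i * (INR i * t0 ^ (i - 1))) n - 0)
    with (csum (fun i => a i * ((t0 + h) ^ i - t0 ^ i - INR i * t0 ^ (i - 1) * h)) n).
  2:{ rewrite (csum_ext _ (fun i => a i * (t0 + h) ^ i - a i * t0 ^ i
        - h * (a i * (INR i * t0 ^ (i - 1))))) by (intros; ring).
      rewrite !csum_minus, csum_scal. ring. }
  eapply Rle_trans; [apply Cmod_csum|].
  apply Rle_trans with (rsum (fun i => / (rho * rho) * (Cmod h * Cmod h) *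
      (C1 * C2 * (Cmod (a i) * r2 ^ i)))%R n).
  - apply rsum_le. intros i _. rewrite Cmod_mult.
    pose proof (power_taylor t0 h rho i Hrho ltac:(unfold rho; lra) Hth) as T.
    set (D := (t0 + h) ^ i - t0 ^ i - INR i * t0 ^ (i - 1) * h) in *.
     pose proof (Cmod_ge_0 (a i)).
    apply Rmult_le_reg_l with (rho * rho)%R; [nra|].
    apply Rle_trans with (Cmod (a i) * (rho * rho * Cmod D))%R; [right; ring|].
    apply Rle_trans with (Cmod (a i) * (C1 * C2 * r2 ^ i * (Cmod h * Cmod h)))%R.
    + apply Rmult_le_compat_l; auto. eapply Rle_trans; [exact T|].
      apply Rmult_le_compat_r; auto. nra.
    + right. field. lra.
  - rewrite rsum_scal.
    apply Rle_trans with (/ (rho * rho) * (Cmod h * Cmod h) * (C1 * C2 * B))%R; [|right; ring].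
    apply Rmult_le_compat_l; auto. apply Rmult_le_pos; [|nra].
    left. apply Rinv_0_lt_compat. nra.
Qed.

Lemma laurent_holomorphic (p : nat) (F : C -> C) : (0 < p)%nat ->
  laurent p F -> holomorphic_H F.
Proof.
  intros Hp [v [g [Hg HF]]] z Hz. unfold upper_half_plane in Hz.
  assert (P0 : INR p <> 0%R) by (apply not_0_INR; lia).
  assert (P0' : RtoC (INR p) <> 0) by now apply RtoC_neq0.
  pose proof (local_parameter_lt_1 p z Hp Hz) as HT.
  destruct (quad_derive_ee (IZR v / INR p) z) as [l1 D1].
  destruct (quad_derive_ee (/ INR p) z) as [l2 D2].
  replace (z / INR p) with (/ INR p * z) in HT by (field; auto).
  destruct (PS_quad_derive g _ Hg HT) as [l3 D3].
  apply quad_derive_is_derive in D1, D2, D3.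
  pose proof (is_derive_mult _ _ _ _ _ D1
    (@is_derive_comp C_AbsRing (AbsRing_NormedModule C_AbsRing) g
      (fun w => ee (/ INR p * w)) z _ _ D3 D2) Cmult_comm) as D.
  (* [holomorphic_H] is stated over [C_NormedModule], the derivative D over
     [AbsRing_NormedModule C_AbsRing]: linearity is proved anew and the remainder estimate is
     carried over. *)
  eexists. split; [apply is_linear_scal_l|]. refine (proj2 (is_derive_ext_loc
    (K := C_AbsRing) (V := AbsRing_NormedModule C_AbsRing)
    (fun w => ee (IZR v / INR p * w) * g (ee (/ INR p * w))) _ _ _ _ D)).
  (* Within distance Im z of z one stays in the upper half plane, where the expansion is valid. *)
  exists (mkposreal _ Hz).
  enough (G : forall w : C, (Cmod (w - z) < Im z)%R ->
    ee (IZR v / INR p * w) * g (ee (/ INR p * w)) = F w) by exact G.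
  intros w Hw. rewrite HF.
  - f_equal; [f_equal; field; auto|]. do 2 f_equal. field; auto.
  - pose proof (Rmax_Cmod (w - z)) as T. pose proof (Rmax_r (Rabs (fst (w - z))) (Rabs (snd (w - z)))).
    assert (D4 : (Rabs (Im (w - z)) < Im z)%R) by (unfold Im at 1; lra).
    apply Rabs_def2 in D4. destruct z, w; simpl in *. lra.
Qed.

(** * Expansions of j at the cusps *)

Lemma klein_product_laurent_unit (p h L : nat) (n : nat -> Z) (T a b : Z) (be : R) :
  (0 < p)%nat -> (0 < L)%nat ->
  (forall i, (i < h)%nat -> laurent_unit p (fun z =>
     klein (INR (S i) / INR p * IZR a) (INR (S i) / INR p * IZR b) (tau_of p L be z))) ->
  laurent_unit p (fun z => klein_product p h n T a b (tau_of p L be z)).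
Proof.
  intros Hp HL HK. unfold klein_product. apply laurent_unit_mult; auto.
  - apply laurent_unit_Cpowz; auto. now apply laurent_unit_Delta.
  - apply (laurent_unit_prodn p (fun i z => Cpowz (- klein (INR (S i) / INR p * IZR a)
        (INR (S i) / INR p * IZR b) (tau_of p L be z)) (n (S i)))); auto.
    intros i Hi. apply laurent_unit_Cpowz; auto.
    apply laurent_unit_ext with (fun z => - (1) * klein (INR (S i) / INR p * IZR a)
        (INR (S i) / INR p * IZR b) (tau_of p L be z)).
    + intros z _. ring.
    + apply laurent_unit_mult; auto. apply laurent_unit_const; auto.
      apply Copp_neq0, C1_nz.
Qed.

(** Integrality of the leading exponent x (x - p)/2 of a Klein form with r = x/p at t = p z. *)
Lemma odd_product_even (p x : Z) : Z.Odd p -> exists v, ((x - p) * x = 2 * v)%Z.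
Proof.
  intros [q Hq]. destruct (Z.Even_or_Odd x) as [[y Hy]|[y Hy]].
  - exists ((x - p) * y)%Z. rewrite Hy. ring.
  - exists ((y - q) * x)%Z. rewrite Hq, Hy. ring.
Qed.

(** The map z -> p A z is factored as an element of SL2(Z) after an upper triangular map. If p
    divides c the latter is z -> p z, that is L = p^2; otherwise it is z -> (z + be)/p, that is L =
    1. *)
Lemma slash_j_laurent (p : nat) (n : nat -> Z) (T : Z) (A : mat2) :
  let h := ((p - 1) / 2)%nat in
  prime (Z.of_nat p) -> (3 < p)%nat ->
  (n 0%nat + 3 * zsum (fun i => n (S i)) h = 24 * T)%Z ->
  weight_vector T h n -> SL2Z A -> laurent p (slash 1 (j p n) A).
Proof.
  intros h hp hp3 H3 Hw HS. destruct A as [a b c d].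
  assert (P : (0 < INR p)%R) by (apply lt_0_INR; lia).
  assert (P0 : INR p <> 0%R) by lra.
  assert (P0' : RtoC (INR p) <> 0) by now apply RtoC_neq0.
  unfold SL2Z, det2 in HS. simpl in HS.
  assert (N0 : forall z, (0 < Im z)%R -> IZR c * z + IZR d <> 0)
    by (intros; apply (denominator_neq0 a b c d); auto; lia).
  assert (Hodd : Z.Odd (Z.of_nat p)).
  { destruct (Z.Even_or_Odd (Z.of_nat p)) as [[x Hx]|]; auto. exfalso.
    destruct (prime_divisors _ hp 2 ltac:(exists x; lia)); lia. }
  destruct (Zdivide_dec (Z.of_nat p) c) as [[c1 Hc]|Hc].
  - apply laurent_ext with (fun z => klein_product p h n T a (Z.of_nat p * b)
      (tau_of p (p * p) 0 z)).
    + intros z Hz. rewrite slash_1_SL2 by exact HS. unfold moebius. simpl.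
      rewrite (j_klein_product p n T hp hp3) by
        (auto; unfold upper_half_plane; apply moebius_upper; auto; lia).
      fold h. pose proof (Im_scal_pos _ _ P Hz) as Ht.
      assert (Ec : IZR c1 * (INR p * z) + IZR d = IZR c * z + IZR d)
        by (rewrite Hc, mult_IZR, <- INR_IZR_INZ, RtoC_mult; ring).
      replace (INR p * ((IZR a * z + IZR b) / (IZR c * z + IZR d))) with
        ((IZR a * (INR p * z) + IZR (Z.of_nat p * b)) / (IZR c1 * (INR p * z) + IZR d))
        by (rewrite Ec, mult_IZR, <- INR_IZR_INZ, RtoC_mult; field; auto).
      rewrite (klein_product_SL2 p n T hp hp3) by (auto; nia). fold h. rewrite Ec.
      replace (tau_of p (p * p) 0 z) with (INR p * z); [field; auto|].
      unfold tau_of. rewrite mult_INR, RtoC_mult. field; auto.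
    + apply klein_product_laurent_unit; try nia. intros i Hi.
      pose proof (index_bound p hp3 i Hi) as Hk.
      assert (Hx : (0 < (Z.of_nat (S i) * a) mod Z.of_nat p < Z.of_nat p)%Z).
      { pose proof (Z.mod_pos_bound (Z.of_nat (S i) * a) (Z.of_nat p) ltac:(lia)).
        enough ((Z.of_nat (S i) * a) mod Z.of_nat p <> 0)%Z by lia. intros E.
        apply Z.mod_divide in E; [|lia]. apply prime_mult in E as [E|E]; auto.
        - apply Z.divide_pos_le in E; lia.
        - assert (D : (Z.of_nat p | 1)%Z).
          { rewrite <- HS. apply Z.divide_sub_r; [now apply Z.divide_mul_l|].
            apply Z.divide_mul_r. now exists c1. }
          apply Z.divide_pos_le in D; lia. }
      pose proof (Z.div_mod (Z.of_nat (S i) * a) (Z.of_nat p) ltac:(lia)) as Ediv.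
      set (q := (Z.of_nat (S i) * a / Z.of_nat p)%Z) in *.
      set (xz := ((Z.of_nat (S i) * a) mod Z.of_nat p)%Z) in *.
      set (x := Z.to_nat xz). set (s := (INR (S i) / INR p * IZR (Z.of_nat p * b))%R).
      assert (Ex : INR x = IZR xz) by (unfold x; rewrite INR_IZR_INZ, Z2Nat.id; auto; lia).
      (* Reducing k a modulo p moves the first characteristic into the open interval (0, 1); it is
         not 0 because p does not divide a when it divides c. *)
      apply laurent_unit_ext with (fun z => ee (IZR q * (1 - s) / 2)
        * klein (INR x / INR p) s (tau_of p (p * p) 0 z)).
      * intros z Hz. rewrite <- klein_r_plus_Z by (apply tau_of_upper; auto; nia). f_equal.
        apply (f_equal IZR) in Ediv. rewrite plus_IZR, !mult_IZR, <- !INR_IZR_INZ in Ediv.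
        replace (INR (S i) / INR p * IZR a)%R with ((INR (S i) * IZR a) / INR p)%R
          by (field; auto).
        rewrite Ediv, Ex. field; auto.
      * apply laurent_unit_mult; [lia|apply laurent_unit_const; [lia|apply ee_neq0]|].
        destruct (odd_product_even (Z.of_nat p) xz Hodd) as [v Hv].
        apply (laurent_unit_klein_pos p (p * p) (p * x) 0 _ s v); [lia| | |].
        --  nia.
        -- rewrite !mult_INR. field; auto.
        -- apply (f_equal IZR) in Hv. rewrite !mult_IZR, minus_IZR, <- INR_IZR_INZ in Hv.
           rewrite <- Hv, mult_INR, Ex. field; auto.
  - assert (Hrel : rel_prime c (Z.of_nat p)).
    { apply rel_prime_sym. now apply prime_rel_prime. }
    apply rel_prime_bezout in Hrel as [u v Huv].
    (* Bezout's relation times d gives c be + p w = d. Then the matrix with rows (p a, y) and (c, w)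
       has determinant 1 and sends (z + be)/p to p A z. *)
    set (be := (u * d)%Z). set (w := (v * d)%Z). set (y := (b - a * be)%Z).
    assert (E1 : (c * be + Z.of_nat p * w = d)%Z).
    { transitivity (d * (u * c + v * Z.of_nat p))%Z; [unfold be, w; ring|].
      rewrite Huv. ring. }
    assert (Hdet : ((Z.of_nat p * a) * w - y * c = 1)%Z).
    { transitivity (a * (c * be + Z.of_nat p * w) - b * c)%Z; [unfold y; ring|].
      rewrite E1. exact HS. }
    apply laurent_ext with (fun z => / INR p *
       klein_product p h n T (Z.of_nat p * a) y (tau_of p 1 (IZR be) z)).
    + intros z Hz. rewrite slash_1_SL2 by exact HS. unfold moebius. simpl.
      rewrite (j_klein_product p n T hp hp3) by
        (auto; unfold upper_half_plane; apply moebius_upper; auto; lia).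
      fold h.  set (tau := tau_of p 1 (IZR be) z).
      assert (Ec : IZR c * tau + IZR w = (IZR c * z + IZR d) / INR p).
      { apply (f_equal IZR) in E1. rewrite plus_IZR, !mult_IZR, <- INR_IZR_INZ in E1.
        rewrite <- E1, RtoC_plus, !RtoC_mult. unfold tau, tau_of. simpl INR. field; auto. }
      replace (INR p * ((IZR a * z + IZR b) / (IZR c * z + IZR d))) with
        ((IZR (Z.of_nat p * a) * tau + IZR y) / (IZR c * tau + IZR w)).
      2:{ rewrite Ec. unfold y, tau, tau_of. simpl INR.
          rewrite mult_IZR, <- INR_IZR_INZ, minus_IZR, mult_IZR, RtoC_minus, !RtoC_mult.
          field; auto. }
      rewrite (klein_product_SL2 p n T hp hp3); auto.
      * fold h. rewrite Ec. field; auto.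
      * apply tau_of_upper; auto; lia.
    + apply laurent_unit_mult; [lia|apply laurent_unit_const; [lia|now apply Cinv_neq0]|].
      apply klein_product_laurent_unit; try lia. intros i Hi.
      pose proof (index_bound p hp3 i Hi) as Hk.
      set (s := (INR (S i) / INR p * IZR y)%R).
      (* The first characteristic is now the integer k a and is shifted to 0; the second, k y/p, is
         not an integer since p does not divide y. *)
      apply laurent_unit_ext with (fun z => ee (IZR (Z.of_nat (S i) * a) * (1 - s) / 2)
        * klein 0 s (tau_of p 1 (IZR be) z)).
      * intros z Hz. rewrite <- klein_r_plus_Z by (apply tau_of_upper; auto; lia). f_equal.
        rewrite !mult_IZR, <- !INR_IZR_INZ. field; auto.
      * apply laurent_unit_mult; [lia|apply laurent_unit_const; [lia|apply ee_neq0]|].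
        apply laurent_unit_klein_0; try lia. intros k.
        apply (rational_not_integer p hp hp3 (S i) y); [lia|].
        intros D. assert (D1 : (Z.of_nat p | 1)%Z).
        { rewrite <- Hdet. apply Z.divide_sub_r.
          - rewrite <- Z.mul_assoc. apply Z.divide_factor_l.
          - now apply Z.divide_mul_l. }
        apply Z.divide_pos_le in D1; lia.
Qed.
Local Close Scope C_scope.

Theorem theorem3p1 (p : nat) (m : Z) (n : nat -> Z)
  (hp : prime (Z.of_nat p)) (hp3 : (3 < p)%nat)
  (h1 : (n 0%nat + Zsum (map n (seq 1 ((p - 1) / 2))) = 2)%Z)
  (h2 : (Z.of_nat p | Zsum (map (fun k => (Z.of_nat k) ^ 2 * n k)
                              (seq 1 ((p - 1) / 2))) - 2 * m)%Z)
  (h3 : (24 | n 0%nat + 3 * Zsum (map n (seq 1 ((p - 1) / 2))))%Z) :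
  weakly_holomorphic_Gamma (Z.of_nat p) 1 (j p n)
  /\ (forall A : mat2, Gamma1 (Z.of_nat p) A ->
        forall z : C, upper_half_plane z ->
          slash 1 (j p n) A z
          = (Cexp (2 * PI * Ci * IZR (mb A) * IZR m / INR p) * j p n z)%C).
Proof.
  rewrite Zsum_zsum in h1, h2, h3. destruct h3 as [T h3].
  change (fun i => n (1 + i)%nat) with (fun i => n (S i)) in *.
  set (h := ((p - 1) / 2)%nat) in *.
  assert (P0 : RtoC (INR p) <> RtoC 0) by (apply INR_C_neq0; lia).
  assert (H3 : (n 0%nat + 3 * zsum (fun i => n (S i)) h = 24 * T)%Z) by lia.
  (* Subtracting (1) from (3) gives 2 sum n_k = 24 T - 2. *)
  assert (Hw : weight_vector T h n) by (unfold weight_vector; lia).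
  assert (HG : forall A, Gamma1 (Z.of_nat p) A -> forall z, upper_half_plane z ->
    slash 1 (j p n) A z = (ee (IZR (mb A) * IZR m / INR p) * j p n z)%C).
  { intros A HA z Hz. now apply (slash_j_Gamma1 p m n T). }
  assert (HL : forall A, SL2Z A -> laurent p (slash 1 (j p n) A)).
  { intros A HA. now apply (slash_j_laurent p n T). }
  split; [split; [|split]|].
  - apply (laurent_holomorphic p); [lia|].
    (* Holomorphy of j is read off from the expansion at infinity, that is from the identity
       matrix. *)
    apply laurent_ext with (slash 1 (j p n) (Mat2 1 0 0 1)); [|now apply HL].
    intros z Hz. rewrite slash_1_SL2 by reflexivity. unfold moebius. simpl.
    replace ((1 * z + 0) / (0 * z + 1))%C with z by (field; nzc).
    field; nzc.
  - intros A [HA [b1 Hb]] z Hz. rewrite (HG A HA z Hz), Hb, mult_IZR, <- INR_IZR_INZ.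
    (* On Gamma(p) the upper right entry is divisible by p, so the multiplier is e of an integer. *)
    replace (((IZR b1 * INR p)%R * IZR m / INR p)%C) with (RtoC (IZR (b1 * m))).
    + rewrite ee_Z. ring.
    + rewrite mult_IZR, !RtoC_mult. field; auto.
  - intros A HA. apply laurent_meromorphic; [lia|now apply HL].
  - intros A HA z Hz. rewrite (HG A HA z Hz). f_equal.
    Transparent ee. unfold ee. f_equal. field; auto.
Qed.
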